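(* Let $K \subset \mathbb{R}^2$ be a centrally symmetric convex body with John ellipse $\mathfrak{J}_K$ and Loewner ellipse $\mathfrak{L}_K$, and let $\lambda$ be a number in the range $|\mathfrak{J}_K| \le \lambda \le |\mathfrak{L}_K|$. Then there exists a unique maximal intersection (MI) ellipse $\mathfrak{M}_K(\lambda)$ of area $\lambda$ for $K$, and it is centrally symmetric.
   Context: A convex body in $\mathbb{R}^2$ is a compact convex set with nonempty interior. A set $A$ is centrally symmetric if $A=-A$. $|\cdot|$ denotes area (Lebesgue measure). An ellipse means the closed filled region, i.e. the image of the closed unit disk under an invertible affine map (its center may be any point). The John ellipse $\mathfrak{J}_K$ is the unique ellipse of maximal area contained in $K$; the Loewner ellipse $\mathfrak{L}_K$ is the unique ellipse of minimal area containing $K$. An ellipse $E$ is a maximal intersection (MI) ellipse for $K$ if, among all ellipses (with arbitrary center) with the same area as $E$, it maximizes the area $|E\cap K|$. *)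

(* Defs.v *)
From mathcomp Require Import all_boot all_order all_algebra.
From mathcomp Require Import all_classical all_reals all_analysis.

Set Implicit Arguments.
Unset Strict Implicit.
Unset Printing Implicit Defensive.

Import Order.TTheory GRing.Theory Num.Theory.
Import numFieldNormedType.Exports.

Local Open Scope classical_set_scope.
Local Open Scope ring_scope.

Notation plane R := (R * R)%type.

Section plane_geometry.
Variable R : realType.
Implicit Types (A K E : set (plane R)).

Definition area A : \bar R :=
  ((@lebesgue_measure R) \x (@lebesgue_measure R))%E A.

Definition convex_body K : Prop :=
  [/\ compact K, convex_set (K : set (convex_lmodType (plane R))) & K° !=set0].

Definition centrally_symmetric A : Prop := A = [set - x | x in A].

(* The norm on a product is the maximum norm, so the Euclidean unit disk is
   given by its equation and not as a ball. *)
Definition unit_disk : set (plane R) :=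
  [set x | x.1 ^+ 2 + x.2 ^+ 2 <= 1].

Definition ellipse E : Prop :=
  exists (f : {linear plane R -> plane R}) (c : plane R),
    bijective f /\ E = [set c + f x | x in unit_disk].

Definition john_ellipse K E : Prop :=
  [/\ ellipse E, E `<=` K &
      forall E', ellipse E' -> E' `<=` K -> (area E' <= area E)%E].

Definition loewner_ellipse K E : Prop :=
  [/\ ellipse E, K `<=` E &
      forall E', ellipse E' -> K `<=` E' -> (area E <= area E')%E].

Definition MI_ellipse K E : Prop :=
  ellipse E /\
  forall E', ellipse E' -> area E' = area E ->
    (area (E' `&` K) <= area (E `&` K))%E.

End plane_geometry.

(* Main.v *)
(* After a linear change of variables the ellipses of area [lambda] are those of the form
   [c + g D] with [D] the unit disk and [|det g| = 1].
   A centered maximizer of [|g D `&` K|] exists by compactness. If there were two, they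
   could be taken to be [D] and its image under [diag (e^t, e^-t)], and an intermediate
   stretch would be an approximate local minimum of the overlap. Approximating [K] by a
   polygon and keeping, for each cluster of overlapping caps, one strip instead, one may
   assume that the caps cut off from the disk are disjoint; the overlap is then explicit in
   terms of cap areas, and its first two derivatives rule such a minimum out. The range of
   [lambda] enters here: neither [D] nor [K] contains the other up to measure zero.
   For disks centered at [c], averaging the chords of [D `&` (K - c)] that are symmetric
   about its midline at distance [m] from 0 with each other gives
   [|(c + D) `&` K| <= |r D `&` K|], where [r^2 = 1 - m^2]. For an optimal disk this forces
   [m = 0] in every direction, so [D `&` (K - c)] is symmetric; if [c <> 0], a small shear
   along [c] keeps it inside [K], against the uniqueness of the centered maximizer. *)
From HB Require Import structures.
Require Import Defs.
From mathcomp Require Import all_boot all_order all_algebra.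
From mathcomp Require Import all_classical all_reals all_analysis.
From mathcomp Require Import measurable_realfun ring lra.
Import Order.TTheory GRing.Theory Num.Theory.
Import numFieldNormedType.Exports.
Set Implicit Arguments.
Unset Strict Implicit.
Unset Printing Implicit Defensive.
Local Open Scope classical_set_scope.
Local Open Scope ring_scope.

(** * Area under affine maps *)

Section area_theory.
Variable R : realType.
Local Notation mR := (measurableTypeR R).
Local Notation leb := (@lebesgue_measure R).

(** The polygon is chosen only after the bound that is to exclude the approximate minimum, so this
    bound may depend on the polygon only through two areas: the part of the disk it leaves out, and
    a set [S] that it contains outside the disk. For a cap let [s] be its half chord, [d] its
    distance from the origin and [x] the cosine of twice the angle of its normal. Along the
    stretches the first and second derivatives of its area are proportional to [s d x] and
    [s d (1 - 2 x^2 + x^2 / (2 s^2))]. The latter is positive while [2 s^2 < 1]. Disjoint caps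
    satisfy [s_i^2 + s_j^2 < 1], so at most one antipodal pair of caps violates this, and the near
    vanishing of the sum of the first derivatives forces the other caps to outweigh it. When two
    pairs of caps nearly fill the circle this argument degenerates; the area of [S] keeps
    [s_i^2 + s_j^2] away from 1 by a fixed amount. *)

Definition plane_measurable (A : set (plane R)) : Prop :=
  measurable (A : set (mR * mR)%type).

Definition affine (a b : R) (y : mR) : mR := a * y + b.

Lemma measurable_affine (a b : R) : measurable_fun setT (affine a b).
Proof.
apply: measurable_funD; last exact: measurable_cst.
exact: measurable_funM.
Qed.

(** Both sides are measures in [B], so by uniqueness of Lebesgue measure it suffices to compare them
    on half-open intervals. *)
Lemma lebesgue_affine (a b : R) (B : set mR) : a != 0 -> measurable B ->
  (`|a|%:E * leb (affine a b @^-1` B) = leb B)%E.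
Proof.
move=> a0 mB.
have na0 : 0 <= `|a| by [].
pose push : {measure set mR -> \bar R} :=
  measure_function_pushforward__canonical__measure_function_Measure leb
    (measurable_affine a b).
suff : leb B = mscale (NngNum na0) push B by move=> ->.
apply: lebesgue_measure_unique => // _ [[u v] _ <-] /=.
rewrite /mscale/= /pushforward/= /affine.
rewrite lebesgue_measure_itv/= lte_fin.
have [a_gt0|a_le0] := ltP 0 a.
  rewrite (_ : _ @^-1` _ = [set` `](u - b) / a, (v - b) / a]]); last first.
    apply/seteqP; split => y /=; rewrite !in_itv/= ltr_pdivrMr// ler_pdivlMr//;
    by rewrite ltrBlDr lerBrDr mulrC.
  rewrite lebesgue_measure_itv/= lte_fin ltr_pM2r ?invr_gt0// ltrD2r.
  case: ifP => _; last by rewrite mule0.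
  rewrite -!EFinD -EFinM gtr0_norm//; congr EFin; by field; rewrite gt_eqF.
have {a_le0} a_lt0 : a < 0 by rewrite lt_neqAle a0.
(* A negative factor reverses the interval, so the closed end changes sides. *)
rewrite (_ : _ @^-1` _ = [set` `[(v - b) / a, (u - b) / a[]); last first.
  apply/seteqP; split => y /=; rewrite !in_itv/= ltr_ndivlMr// ler_ndivrMr//;
  by rewrite ltrBlDr lerBrDr mulrC andbC.
rewrite lebesgue_measure_itv/= lte_fin ltr_nM2r ?invr_lt0// ltrD2r.
case: ifP => _; last by rewrite mule0.
rewrite -!EFinD -EFinM ltr0_norm//; congr EFin; by field; rewrite lt_eqF.
Qed.

(** The matrix with rows [(a, b)] and [(c, d)]. Regions are transported by preimages, which makes
    measurability immediate and divides areas by the determinant. *)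
Definition lin (a b c d : R) (x : plane R) : plane R :=
  (a * x.1 + b * x.2, c * x.1 + d * x.2).

Lemma measurable_lin (a b c d : R) :
  measurable_fun setT (lin a b c d : (mR * mR)%type -> (mR * mR)%type).
Proof.
apply/measurable_fun_pairP; split => /=; apply: measurable_funD;
  apply: measurable_funM => //; exact: measurable_cst.
Qed.

Definition shift (v x : plane R) : plane R := x + v.

Lemma measurable_shift (v : plane R) :
  measurable_fun setT (shift v : (mR * mR)%type -> (mR * mR)%type).
Proof.
by apply/measurable_fun_pairP; split => /=; apply: measurable_funD => //;
  exact: measurable_cst.
Qed.

Lemma plane_measurable_lin (a b c d : R) A :
  plane_measurable A -> plane_measurable (lin a b c d @^-1` A).
Proof. by move=> mA; rewrite -[X in plane_measurable X]setTI; exact: measurable_lin. Qed.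

Lemma plane_measurable_shift v A :
  plane_measurable A -> plane_measurable (shift v @^-1` A).
Proof. by move=> mA; rewrite -[X in plane_measurable X]setTI; exact: measurable_shift. Qed.

Lemma area_rect (A B : set mR) : measurable A -> measurable B ->
  area (A `*` B) = (leb A * leb B)%E.
Proof. exact: product_measure1E. Qed.

(** By uniqueness of the product measure only rectangles have to be checked, where the two
    coordinates separate. *)
Lemma area_diag (a d : R) A : a != 0 -> d != 0 -> plane_measurable A ->
  (`|a * d|%:E * area (lin a 0 0 d @^-1` A) = area A)%E.
Proof.
move=> a0 d0 mA.
have n0 : 0 <= `|a * d| by [].
pose push : {measure set (mR * mR)%type -> \bar R} :=
  measure_function_pushforward__canonical__measure_function_Measure
    (leb \x leb)%E (measurable_lin a 0 0 d).
suff : area A = mscale (NngNum n0) push A by move=> ->.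
rewrite /area; apply: product_measure_unique => // X Y mX mY.
change ((`|a * d|%:E * area (lin a 0 0 d @^-1` (X `*` Y)) = leb X * leb Y)%E).
rewrite (_ : _ @^-1` _ = (affine a 0 @^-1` X) `*` (affine d 0 @^-1` Y)); last first.
  by rewrite /lin/affine; apply/seteqP; split => -[x y] /=;
   rewrite !mul0r !addr0 !add0r.
have mp (c : R) Z : measurable (Z : set mR) -> measurable (affine c 0 @^-1` Z : set mR).
  by move=> mZ; rewrite -[X in measurable X]setTI; exact: measurable_affine.
rewrite area_rect; [|exact: mp|exact: mp].
by rewrite -(lebesgue_affine 0 a0 mX) -(lebesgue_affine 0 d0 mY) muleACA -EFinM normrM.
Qed.

Lemma area_shift v A : plane_measurable A -> area (shift v @^-1` A) = area A.
Proof.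
move=> mA.
pose push : {measure set (mR * mR)%type -> \bar R} :=
  measure_function_pushforward__canonical__measure_function_Measure
    (leb \x leb)%E (measurable_shift v).
suff : area A = push A by move=> ->.
rewrite /area; apply: product_measure_unique => // X Y mX mY.
change (area (shift v @^-1` (X `*` Y)) = leb X * leb Y)%E.
rewrite (_ : _ @^-1` _ = (affine 1 v.1 @^-1` X) `*` (affine 1 v.2 @^-1` Y)); last first.
  by rewrite /affine; apply/seteqP; split => -[x y] /=; rewrite !mul1r.
have mp (c : R) Z : measurable (Z : set mR) -> measurable (affine 1 c @^-1` Z : set mR).
  by move=> mZ; rewrite -[X in measurable X]setTI; exact: measurable_affine.
rewrite area_rect; [|exact: mp|exact: mp].
have o0 : (1 : R) != 0 by exact: oner_neq0.
by rewrite -(lebesgue_affine v.1 o0 mX) -(lebesgue_affine v.2 o0 mY) normr1 !mul1e.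
Qed.

Lemma area_swap A : plane_measurable A -> area (lin 0 1 1 0 @^-1` A) = area A.
Proof.
move=> mA.
pose push : {measure set (mR * mR)%type -> \bar R} :=
  measure_function_pushforward__canonical__measure_function_Measure
    (leb \x leb)%E (measurable_lin 0 1 1 0).
suff : area A = push A by move=> ->.
rewrite /area; apply: product_measure_unique => // X Y mX mY.
change (area (lin 0 1 1 0 @^-1` (X `*` Y)) = leb X * leb Y)%E.
rewrite (_ : _ @^-1` _ = Y `*` X); last first.
  by rewrite /lin; apply/seteqP; split => -[x y]; rewrite /= !mul0r !mul1r add0r addr0 => -[].
by rewrite area_rect// muleC.
Qed.

(** Cavalieri's principle: every vertical section is merely translated. *)
Lemma area_shear t A : plane_measurable A -> area (lin 1 0 t 1 @^-1` A) = area A.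
Proof.
move=> mA; rewrite /area /product_measure1; apply: eq_integral => x _ /=.
rewrite (_ : xsection _ _ = affine 1 (t * x) @^-1` xsection A x); last first.
  rewrite !xsectionE; apply/seteqP; split => y;
  by rewrite /lin/affine /= !mul1r mul0r addr0 addrC.
have mx : measurable (xsection A x : set mR) by exact: measurable_xsection.
by rewrite -[RHS](lebesgue_affine (t * x) (oner_neq0 R) mx) normr1 mul1e.
Qed.

Lemma lin_comp (a b c d a' b' c' d' : R) (x : plane R) :
  lin a b c d (lin a' b' c' d' x) =
  lin (a * a' + b * c') (a * b' + b * d') (c * a' + d * c') (c * b' + d * d') x.
Proof. by rewrite /lin /=; congr pair; ring. Qed.

Lemma area_shearT t A : plane_measurable A -> area (lin 1 t 0 1 @^-1` A) = area A.
Proof.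
move=> mA; have mA' := plane_measurable_lin 0 1 1 0 mA.
rewrite -[RHS](area_swap mA) -[RHS](area_shear t mA').
rewrite -[RHS]area_swap; last by do 2 apply: plane_measurable_lin.
by congr area; apply/funext => x /=; rewrite !lin_comp; congr (A (lin _ _ _ _ x)); ring.
Qed.

(** With a nonzero pivot the matrix is a lower shear times a diagonal matrix times an upper
    shear. *)
Lemma area_lin_diag (a b c d : R) A : a != 0 -> a * d - b * c != 0 -> plane_measurable A ->
  (`|a * d - b * c|%:E * area (lin a b c d @^-1` A) = area A)%E.
Proof.
move=> a0 D0 mA.
have d0 : d - b * c / a != 0.
  by apply: contra D0 => /eqP/subr0_eq->; rewrite mulrCA divff// mulr1 subrr.
have mA1 := plane_measurable_lin 1 0 (c / a) 1 mA.
have mA2 := plane_measurable_lin a 0 0 (d - b * c / a) mA1.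
rewrite -[RHS](area_shear (c / a) mA) -[RHS](area_diag a0 d0 mA1).
rewrite -[in RHS](area_shearT (b / a) mA2); congr (_%:E * area _)%E.
  by congr (`| _ |); field.
by apply/funext => x /=; rewrite !lin_comp; congr (A (lin _ _ _ _ x)); field.
Qed.

(** A zero pivot is removed by exchanging the rows. *)
Lemma area_lin (a b c d : R) A : a * d - b * c != 0 -> plane_measurable A ->
  (`|a * d - b * c|%:E * area (lin a b c d @^-1` A) = area A)%E.
Proof.
move=> D0 mA; have [a0|a0] := eqVneq a 0; last exact: area_lin_diag.
have c0 : c != 0 by apply: contra D0 => /eqP ->; rewrite a0 mul0r mulr0 subrr.
have D0' : c * b - d * a != 0 by move: D0; rewrite -oppr_eq0 opprB mulrC [a * d]mulrC.
have mA1 := plane_measurable_lin 0 1 1 0 mA.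
rewrite -[RHS](area_swap mA) -[RHS](area_lin_diag c0 D0' mA1); congr (_%:E * area _)%E.
  by rewrite -normrN; congr (`| _ |); ring.
by apply/funext => x /=; rewrite !lin_comp; congr (A (lin _ _ _ _ x)); ring.
Qed.

End area_theory.

(** * Real-valued area of bounded measurable sets *)

Section real_area.
Variable R : realType.
Implicit Types (A B K : set (plane R)) (x y v : plane R).
Local Notation mR := (measurableTypeR R).
Local Notation leb := (@lebesgue_measure R).
Local Notation lambda2 := (leb \x leb)%E.

Definition dot (a x : plane R) : R := a.1 * x.1 + a.2 * x.2.
Definition norm2 (x : plane R) : R := x.1 ^+ 2 + x.2 ^+ 2.
(** [fine] sends an infinite area to 0. On the bounded measurable sets singled out by [bmeas] the
    area is finite, so [ar] is the true area and can be subtracted. *)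
Definition ar A : R := fine (area A).
Definition bmeas A : Prop :=
  plane_measurable A /\ exists r : R, forall x, A x -> norm2 x <= r.

Lemma norm2_ge0 x : 0 <= norm2 x.
Proof. by rewrite addr_ge0 ?sqr_ge0. Qed.

Lemma plane_measurable_le (f g : plane R -> R) :
  measurable_fun setT (f : (mR * mR)%type -> R) ->
  measurable_fun setT (g : (mR * mR)%type -> R) ->
  plane_measurable [set x | f x <= g x].
Proof.
move=> mf mg.
have := measurable_fun_ler mf mg => /(_ measurableT [set true]).
by rewrite setTI; apply.
Qed.

Lemma plane_measurable_lt (f g : plane R -> R) :
  measurable_fun setT (f : (mR * mR)%type -> R) ->
  measurable_fun setT (g : (mR * mR)%type -> R) ->
  plane_measurable [set x | f x < g x].
Proof.
move=> mf mg.
have := measurable_fun_ltr mf mg => /(_ measurableT [set true]).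
by rewrite setTI; apply.
Qed.

Lemma measurable_dot a : measurable_fun setT (dot a : (mR * mR)%type -> R).
Proof.
by apply: measurable_funD; apply: measurable_funM => //; exact: measurable_cst.
Qed.

Lemma measurable_norm2 : measurable_fun setT (norm2 : (mR * mR)%type -> R).
Proof. by apply: measurable_funD; apply: measurable_funX. Qed.

Lemma plane_measurableI A B :
  plane_measurable A -> plane_measurable B -> plane_measurable (A `&` B).
Proof. exact: measurableI. Qed.
Lemma plane_measurableU A B :
  plane_measurable A -> plane_measurable B -> plane_measurable (A `|` B).
Proof. exact: measurableU. Qed.
Lemma plane_measurableD A B :
  plane_measurable A -> plane_measurable B -> plane_measurable (A `\` B).
Proof. exact: measurableD. Qed.

Lemma plane_measurable_disk r : plane_measurable [set x | norm2 x <= r].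
Proof. exact: plane_measurable_le measurable_norm2 (measurable_cst _). Qed.
Lemma plane_measurable_dot_le a r : plane_measurable [set x | dot a x <= r].
Proof. exact: plane_measurable_le (measurable_dot a) (measurable_cst _). Qed.
Lemma plane_measurable_dot_gt a r : plane_measurable [set x | r < dot a x].
Proof. exact: plane_measurable_lt (measurable_cst _) (measurable_dot a). Qed.
Lemma plane_measurable_strip a r : plane_measurable [set x | `|dot a x| <= r].
Proof.
rewrite (_ : mkset _ = [set x | dot a x <= r] `&` [set x | - r <= dot a x]).
  apply: plane_measurableI; first exact: plane_measurable_dot_le.
  exact: plane_measurable_le (measurable_cst _) (measurable_dot a).
by apply/seteqP; split => x /=; rewrite ler_norml; [move=> /andP[]|move=> [-> ->]].
Qed.

Definition box (a b c d : R) : set (plane R) := `[a, b]%classic `*` `[c, d]%classic.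

Lemma boxP a b c d x : box a b c d x <-> (a <= x.1 <= b /\ c <= x.2 <= d).
Proof. by rewrite /box /= !in_itv. Qed.

Lemma plane_measurable_box a b c d : plane_measurable (box a b c d).
Proof. by apply: measurableX; exact: measurable_itv. Qed.

Lemma area_box a b c d : a <= b -> c <= d ->
  area (box a b c d) = ((b - a) * (d - c))%:E.
Proof.
move=> ab cd; rewrite area_rect; [|exact: measurable_itv..].
rewrite !lebesgue_measure_itv/= !lte_fin -!EFinD.
move: ab; rewrite le_eqVlt => /predU1P[->|->]; first by rewrite ltxx subrr mul0r mul0e.
by move: cd; rewrite le_eqVlt => /predU1P[->|->//]; rewrite ltxx subrr mulr0 mule0.
Qed.

Lemma le_area A B : plane_measurable A -> plane_measurable B -> A `<=` B ->
  (area A <= area B)%E.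
Proof.
by move=> mA mB AB; apply: (@le_measure _ _ _ lambda2); rewrite ?inE.
Qed.

Lemma norm2_box r x : norm2 x <= r -> box (- (1 + r)) (1 + r) (- (1 + r)) (1 + r) x.
Proof.
rewrite /norm2 => xr; apply/boxP.
have [x0 y0] := (sqr_ge0 x.1, sqr_ge0 x.2).
by split; apply/andP; split; nra.
Qed.

Lemma bmeas_fin A : bmeas A -> (area A < +oo)%E.
Proof.
move=> [mA [r Ar]]; have [->|/set0P[x Ax]] := eqVneq A set0.
  by rewrite /area measure0.
have r0 : 0 <= r by apply: le_trans (norm2_ge0 x) (Ar _ Ax).
apply: le_lt_trans (le_area mA (plane_measurable_box _ _ _ _) _) _.
  by move=> y /Ar; exact: norm2_box.
by rewrite area_box ?ltry// ler_wpDr; lra.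
Qed.

Lemma ar_set0 : ar set0 = 0.
Proof. by rewrite /ar /area measure0. Qed.

Lemma arE A : bmeas A -> area A = (ar A)%:E.
Proof.
move=> bA; rewrite /ar fineK// ge0_fin_numE ?bmeas_fin//.
Qed.

Lemma ar_ge0 A : 0 <= ar A.
Proof. by apply/fine_ge0/integral_ge0. Qed.

Lemma bmeasS A B : plane_measurable A -> A `<=` B -> bmeas B -> bmeas A.
Proof. by move=> mA AB [_ [r Br]]; split=> //; exists r => x /AB/Br. Qed.

Lemma bmeasI A B : bmeas A -> plane_measurable B -> bmeas (A `&` B).
Proof.
move=> bA mB; apply: (bmeasS _ _ bA); last by move=> x [].
by apply: plane_measurableI => //; case: bA.
Qed.

Lemma bmeasD A B : bmeas A -> plane_measurable B -> bmeas (A `\` B).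
Proof.
move=> bA mB; apply: (bmeasS _ _ bA); last by move=> x [].
by apply: plane_measurableD => //; case: bA.
Qed.

Lemma bmeasU A B : bmeas A -> bmeas B -> bmeas (A `|` B).
Proof.
move=> [mA [r Ar]] [mB [s Bs]]; split; first exact: plane_measurableU.
exists (Num.max r s) => x [/Ar|/Bs] h; first by rewrite le_max h.
by rewrite le_max h orbT.
Qed.

Lemma ar_le A B : plane_measurable A -> bmeas B -> A `<=` B -> ar A <= ar B.
Proof.
move=> mA bB AB; rewrite -lee_fin -!arE//; last exact: bmeasS bB.
by apply: le_area => //; case: bB.
Qed.

Lemma ar_split A B : bmeas A -> plane_measurable B ->
  ar A = ar (A `&` B) + ar (A `\` B).
Proof.
move=> bA mB; apply: EFin_inj; rewrite EFinD -!arE//; [|exact: bmeasD|exact: bmeasI].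
rewrite addeC; apply: (measureDI lambda2) => //; by case: bA.
Qed.

Lemma ar_diff A B : bmeas A -> plane_measurable B ->
  ar (A `\` B) = ar A - ar (A `&` B).
Proof. by move=> bA mB; rewrite (ar_split bA mB); ring. Qed.

Lemma arU A B : bmeas A -> bmeas B -> A `&` B = set0 -> ar (A `|` B) = ar A + ar B.
Proof.
move=> bA bB AB; apply: EFin_inj; rewrite EFinD -!arE//; last exact: bmeasU.
by apply: (measureU lambda2) => //; [case: bA|case: bB].
Qed.

Lemma ar_box a b c d : a <= b -> c <= d -> ar (box a b c d) = (b - a) * (d - c).
Proof. by move=> ab cd; rewrite /ar area_box. Qed.

Lemma bmeas_box a b c d : bmeas (box a b c d).
Proof.
split; first exact: plane_measurable_box.
exists (a ^+ 2 + b ^+ 2 + (c ^+ 2 + d ^+ 2)) => x /boxP[/andP[x1 x2] /andP[x3 x4]].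
have sq (u v w : R) : u <= w -> w <= v -> w ^+ 2 <= u ^+ 2 + v ^+ 2.
  by move=> uw wv; have [w0|w0] := leP 0 w; nra.
by rewrite lerD//; exact: sq.
Qed.

Lemma ar_box_gt0 a b c d A : a < b -> c < d -> bmeas A -> box a b c d `<=` A -> 0 < ar A.
Proof.
move=> ab cd bA sA; apply: lt_le_trans (ar_le (plane_measurable_box _ _ _ _) bA sA).
by rewrite ar_box ?ltW// mulr_gt0 ?subr_gt0.
Qed.

Lemma norm2_lin_le (a b c d : R) x :
  norm2 (lin a b c d x) <= (a ^+ 2 + b ^+ 2 + c ^+ 2 + d ^+ 2) * norm2 x.
Proof.
rewrite /norm2 /=.
rewrite -subr_ge0 [leRHS](_ : _ = (a * x.2 - b * x.1) ^+ 2 + (c * x.2 - d * x.1) ^+ 2); last by ring.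
by rewrite addr_ge0 ?sqr_ge0.
Qed.

Lemma lin_inv (a b c d : R) x : a * d - b * c != 0 ->
  let D := a * d - b * c in
  lin (d / D) (- b / D) (- c / D) (a / D) (lin a b c d x) = x.
Proof. by move=> D0 /=; case: x => x y; rewrite /lin /=; congr pair; field. Qed.

Lemma bmeas_lin (a b c d : R) A : a * d - b * c != 0 -> bmeas A ->
  bmeas (lin a b c d @^-1` A).
Proof.
move=> D0 [mA [r Ar]]; split; first exact: plane_measurable_lin.
eexists => x /Ar le_r; rewrite -{1}(lin_inv x D0).
apply: le_trans (norm2_lin_le _ _ _ _ _) _.
by apply: ler_wpM2l le_r; rewrite !addr_ge0 ?sqr_ge0.
Qed.

Lemma ar_lin (a b c d : R) A : a * d - b * c != 0 -> bmeas A ->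
  ar (lin a b c d @^-1` A) = ar A / `|a * d - b * c|.
Proof.
move=> D0 bA; have := area_lin D0 bA.1; rewrite !arE//; last exact: bmeas_lin.
by rewrite -EFinM => -[<-]; rewrite mulrC mulKf// normr_eq0.
Qed.

Lemma ar_lin1 (a b c d : R) A : `|a * d - b * c| = 1 -> bmeas A ->
  ar (lin a b c d @^-1` A) = ar A.
Proof.
move=> D1 bA; rewrite ar_lin ?D1 ?divr1//.
by rewrite -normr_eq0 D1 oner_eq0.
Qed.

Lemma norm2_shift v x : norm2 x <= 2 * norm2 (x + v) + 2 * norm2 v.
Proof.
rewrite /norm2 /= -subr_ge0.
rewrite [leRHS](_ : _ = (x.1 + 2 * v.1) ^+ 2 + (x.2 + 2 * v.2) ^+ 2); last by ring.
by rewrite addr_ge0 ?sqr_ge0.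
Qed.

Lemma bmeas_shift v A : bmeas A -> bmeas (shift v @^-1` A).
Proof.
move=> [mA [r Ar]]; split; first exact: plane_measurable_shift.
exists (2 * r + 2 * norm2 v) => x /Ar le_r.
by apply: le_trans (norm2_shift v x) _; rewrite lerD2r ler_pM2l.
Qed.

Lemma ar_shift v A : plane_measurable A -> ar (shift v @^-1` A) = ar A.
Proof. by move=> mA; rewrite /ar area_shift. Qed.

Lemma unit_diskE : @unit_disk R = [set x | norm2 x <= 1].
Proof. by []. Qed.

Lemma bmeas_disk r : bmeas [set x | norm2 x <= r].
Proof. by split; [exact: plane_measurable_disk|exists r]. Qed.

Lemma ar_disk_gt0 : 0 < ar (@unit_disk R).
Proof.
apply: (@ar_box_gt0 0 2^-1 0 2^-1); rewrite ?invr_gt0//.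
  exact: bmeas_disk.
by move=> x /boxP[/andP[x1 x2] /andP[x3 x4]]; rewrite unit_diskE /= /norm2; nra.
Qed.

End real_area.

#[local] Opaque ar.

(** * Strips and caps of the disk *)

Section arcs.
Variable R : realType.
Implicit Types (a b c x y : plane R) (p q u v : R).

(** A point with [x.2 > 0] is [x.2] times [(v, 1)] with [v = x.1 / x.2]. Its norm is then
    [x.2 * hyp v] and [dot a x] is [x.2 * line a v], so the cap of [a] is met exactly in the
    directions where the line lies above the convex curve [hyp]. *)
Definition hyp v : R := Num.sqrt (1 + v ^+ 2).
Definition line a v : R := a.1 * v + a.2.

Lemma sqr_hyp v : hyp v ^+ 2 = 1 + v ^+ 2.
Proof. by rewrite sqr_sqrtr// addr_ge0 ?sqr_ge0. Qed.

Lemma hyp_gt0 v : 0 < hyp v.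
Proof. by rewrite sqrtr_gt0 ltr_wpDr ?sqr_ge0. Qed.

Lemma le_of_sqr u v : 0 <= v -> u ^+ 2 <= v ^+ 2 -> u <= v.
Proof. by move=> v0 uv; rewrite leNgt; apply/negP => vu; nra. Qed.

Lemma sqr_le_norm u v : `|u| <= v -> u ^+ 2 <= v ^+ 2.
Proof. by rewrite ler_norml => /andP[? ?]; nra. Qed.

Lemma hyp_ge v : `|v| <= hyp v.
Proof.
apply: le_of_sqr; first exact: ltW (hyp_gt0 v).
by rewrite sqr_hyp real_normK ?num_real// lerDr.
Qed.

(** [hyp v] is the Euclidean norm of [(v, 1)]. After squaring, the cross term is controlled by
    Cauchy-Schwarz in the form [1 + p * q <= hyp p * hyp q]. *)
Lemma hyp_convex p q v : p <= v -> v <= q ->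
  (q - p) * hyp v <= (q - v) * hyp p + (v - p) * hyp q.
Proof.
move=> pv vq; have [[hp hq] hv] := (hyp_gt0 p, hyp_gt0 q, hyp_gt0 v).
have cs : 1 + p * q <= hyp p * hyp q.
  have [pq0|pq0] := leP (1 + p * q) 0; first by apply: le_trans pq0 _; rewrite mulr_ge0 ?ltW.
  apply: le_of_sqr; first by rewrite mulr_ge0 ?ltW.
  by rewrite exprMn !sqr_hyp; nra.
apply: le_of_sqr; first by apply: addr_ge0; apply: mulr_ge0; rewrite ?subr_ge0//; exact: ltW.
rewrite exprMn [leRHS](_ : _ = (q - v) ^+ 2 * hyp p ^+ 2 + (v - p) ^+ 2 * hyp q ^+ 2 +
  2 * ((q - v) * (v - p) * (hyp p * hyp q))); last by ring.
rewrite !sqr_hyp.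
have : (q - v) * (v - p) * (1 + p * q) <= (q - v) * (v - p) * (hyp p * hyp q).
  by rewrite ler_wpM2l// mulr_ge0// subr_ge0.
by move: (hyp p * hyp q) => z; nra.
Qed.

(** [p] and [q] are the slopes [x.1 / x.2] of the ends of the arc that the strip of [a] cuts from
    the upper half of the unit circle. *)
Definition arc a p q : Prop :=
  [/\ p < q, line a p = hyp p, line a q = hyp q &
   forall v, hyp v <= line a v <-> p <= v <= q].

(** The difference of the squares of [line] and [hyp] is the quadratic [(1 - a1^2) (v - p) (q - v)].
    The bound on [a.1] makes it positive on a bounded interval only and excludes the branch where
    the line equals [- hyp]. *)
Lemma arc_exists a : `|a.1| < 1 -> 0 < a.2 -> 1 < norm2 a -> exists p q, arc a p q.
Proof.
case: a => a1 a2; rewrite /norm2 /= => /[dup] a1_lt1 + a2_gt0 na.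
rewrite ltr_norml => /andP[a1l a1r].
have D0 : 0 < 1 - a1 ^+ 2 by nra.
pose d := Num.sqrt (a1 ^+ 2 + a2 ^+ 2 - 1).
have d0 : 0 < d by rewrite sqrtr_gt0 subr_gt0.
have dd : d ^+ 2 = a1 ^+ 2 + a2 ^+ 2 - 1 by rewrite sqr_sqrtr// subr_ge0 ltW.
pose p := (a1 * a2 - d) / (1 - a1 ^+ 2); pose q := (a1 * a2 + d) / (1 - a1 ^+ 2).
have pq : p < q by rewrite ltr_pM2r ?invr_gt0//; lra.
have factor v : line (a1, a2) v ^+ 2 - hyp v ^+ 2 = (1 - a1 ^+ 2) * ((v - p) * (q - v)).
  rewrite sqr_hyp /line /=.
  have -> : (1 - a1 ^+ 2) * ((v - p) * (q - v)) =
     (((1 - a1 ^+ 2) * v - a1 * a2) + d) * (d - ((1 - a1 ^+ 2) * v - a1 * a2)) / (1 - a1 ^+ 2).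
    by rewrite /p /q; field; rewrite gt_eqF.
  rewrite -[X in X / _](_ : (d ^+ 2 - ((1 - a1 ^+ 2) * v - a1 * a2) ^+ 2) = _); last by ring.
  by rewrite dd; field; rewrite gt_eqF.
have nneg v : - hyp v < line (a1, a2) v.
  rewrite /line/=; have := hyp_ge v; have : `|a1 * v| <= `|v|.
    by rewrite normrM ler_piMl// ltW.
  rewrite !ler_norml => /andP[]; have [v0|v0] := leP 0 v.
    by rewrite ger0_norm//; lra.
  by rewrite ltr0_norm//; lra.
have eqv v : line (a1, a2) v ^+ 2 - hyp v ^+ 2 = 0 -> line (a1, a2) v = hyp v.
  move=> /eqP; rewrite subr_sqr mulf_eq0 subr_eq0 => /orP[/eqP//|].
  by rewrite addr_eq0 => /eqP h; have := nneg v; rewrite h ltxx.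
exists p, q; split=> //.
- by apply: eqv; rewrite factor subrr mul0r mulr0.
- by apply: eqv; rewrite factor subrr !mulr0.
move=> v; have := factor v; rewrite subr_sqr.
have := nneg v; have := hyp_gt0 v; move: (line _ v) (hyp v) => l h h0 lh E.
split=> [hl|/andP[pv vq]].
  have : 0 <= (1 - a1 ^+ 2) * ((v - p) * (q - v)) by rewrite -E mulr_ge0//; lra.
  rewrite pmulr_rge0//; clear E; nra.
have : 0 <= (1 - a1 ^+ 2) * ((v - p) * (q - v)) by rewrite mulr_ge0 ?(ltW D0)// mulr_ge0// subr_ge0.
by rewrite -E pmulr_lge0; lra.
Qed.

Lemma dotN a x : dot a (- x) = - dot a x.
Proof. by rewrite /dot /= !mulrN opprD. Qed.

Lemma dotNl a x : dot (- a) x = - dot a x.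
Proof. by rewrite /dot /= !mulNr opprD. Qed.

Lemma norm2N x : norm2 (- x) = norm2 x.
Proof. by rewrite /norm2 /= !sqrrN. Qed.

Lemma dot_line a x : x.2 != 0 -> dot a x = x.2 * line a (x.1 / x.2).
Proof. by move=> x0; rewrite /dot /line; field. Qed.

Lemma norm2_hyp x : x.2 != 0 -> norm2 x = (x.2 * hyp (x.1 / x.2)) ^+ 2.
Proof. by move=> x0; rewrite exprMn sqr_hyp /norm2; field. Qed.

(** The bound on [a.1] keeps the horizontal directions out of the cap, so the whole cap is visible
    in the coordinate [v]. *)
Lemma cap_upper a x : `|a.1| < 1 -> 0 < a.2 -> norm2 x <= 1 -> 1 <= dot a x ->
  0 < x.2 /\ hyp (x.1 / x.2) <= line a (x.1 / x.2).
Proof.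
move=> a1 a2 nx ax.
have x2_gt0 : 0 < x.2.
  rewrite ltNge; apply/negP => x2; move: nx ax; rewrite /norm2 /dot => nx ax.
  have x1 : `|x.1| <= 1.
    by apply: le_of_sqr => //; rewrite real_normK ?num_real// expr1n; have := sqr_ge0 x.2; lra.
  have : `|a.1 * x.1| < 1 by apply: le_lt_trans a1; rewrite normrM ler_piMr.
  by rewrite ltr_norml => /andP[]; nra.
split=> //; move: nx ax; rewrite (dot_line a (lt0r_neq0 x2_gt0)).
rewrite (norm2_hyp (lt0r_neq0 x2_gt0)) => nx ax.
have h : x.2 * hyp (x.1 / x.2) <= 1 by apply: le_of_sqr; rewrite ?expr1n.
by rewrite -(ler_pM2l x2_gt0) (le_trans h).
Qed.

Lemma line_interp c a u v w : u <= w <= v -> line a u <= line c u ->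
  line a v <= line c v -> line a w <= line c w.
Proof.
move=> /andP[uw wv]; rewrite /line => Hu Hv.
have [uv|uv] := ltP u v; last by have -> : w = u by lra.
rewrite -(@ler_pM2l _ (v - u)) ?subr_gt0//.
have -> : (v - u) * (a.1 * w + a.2) = (v - w) * (a.1 * u + a.2) + (w - u) * (a.1 * v + a.2) by ring.
have -> : (v - u) * (c.1 * w + c.2) = (v - w) * (c.1 * u + c.2) + (w - u) * (c.1 * v + c.2) by ring.
by apply: lerD; rewrite ler_wpM2l// subr_ge0.
Qed.

(** Along the arc of [a] the line of [c] lies above that of [a], since it does so at both ends; a
    point of the disk cut off by [a] is therefore cut off by [c]. *)
Lemma cap_mono a c p q x : `|a.1| < 1 -> 0 < a.2 -> arc a p q ->
  hyp p <= line c p -> hyp q <= line c q ->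
  norm2 x <= 1 -> `|dot c x| <= 1 -> `|dot a x| <= 1.
Proof.
move=> a1 a2 [pq ap aq av] cp cq.
have half y : norm2 y <= 1 -> `|dot c y| <= 1 -> dot a y <= 1.
  move=> ny cy; rewrite leNgt; apply/negP => ay.
  have [y2 /av yv] := cap_upper a1 a2 ny (ltW ay).
  have := line_interp (c := c) (a := a) yv; rewrite ap aq => /(_ cp cq).
  rewrite -(ler_pM2l y2) -!dot_line ?lt0r_neq0// => /(lt_le_trans ay).
  by move: cy; rewrite ler_norml => /andP[_]; lra.
move=> nx cx; rewrite ler_norml half// andbT lerNl -dotN half ?norm2N//.
by rewrite dotN normrN.
Qed.

(** The normal of the strip with an edge through the points of the unit circle of slopes [p] and
    [q]; its line is the secant of [hyp] between them. *)
Definition chord p q : plane R :=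
  let s := (hyp q - hyp p) / (q - p) in (s, hyp p - s * p).

Lemma chordl p q : line (chord p q) p = hyp p.
Proof. by rewrite /line /=; ring. Qed.

Lemma chordr p q : p < q -> line (chord p q) q = hyp q.
Proof. by move=> pq; rewrite /line /=; field; rewrite subr_eq0 gt_eqF. Qed.

Lemma chord_ge p q v : p < q -> p <= v -> v <= q -> hyp v <= line (chord p q) v.
Proof.
move=> pq pv vq; rewrite -(@ler_pM2l _ (q - p)) ?subr_gt0//.
apply: le_trans (hyp_convex pv vq) _; rewrite le_eqVlt; apply/orP; left; apply/eqP.
by rewrite /line /=; field; rewrite subr_eq0 gt_eqF.
Qed.

Lemma norm2_gt1 c v : hyp v < line c v -> 1 < norm2 c.
Proof.
move=> cv; have h := hyp_gt0 v.
have : hyp v ^+ 2 < line c v ^+ 2 by nra.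
have : line c v ^+ 2 <= norm2 c * hyp v ^+ 2.
  rewrite sqr_hyp /line /norm2 -subr_ge0.
  by rewrite [leRHS](_ : _ = (c.1 - c.2 * v) ^+ 2) ?sqr_ge0//; ring.
move=> h1 h2; have := lt_le_trans h2 h1.
by rewrite -{1}[_ ^+ 2]mul1r ltr_pM2r// exprn_gt0.
Qed.

(** [hyp] is strictly convex, so its secant lies strictly above it at the midpoint of the arc. *)
Lemma arc_gt a p q : `|a.1| < 1 -> arc a p q -> exists2 v, p <= v <= q & hyp v < line a v.
Proof.
move=> a1 [pq ap aq av]; exists ((p + q) / 2); first by apply/andP; split; lra.
rewrite lt_neqAle; apply/andP; split; last by apply/av; apply/andP; split; lra.
apply/eqP => E.
have hp := hyp_gt0 p; have hq := hyp_gt0 q.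
have E2 : hyp ((p + q) / 2) = (hyp p + hyp q) / 2.
  by rewrite E -ap -aq /line; field.
have := sqr_hyp ((p + q) / 2); rewrite E2.
have := sqr_hyp p; have := sqr_hyp q.
have := hyp_gt0 p; have := hyp_gt0 q.
have d : hyp q - hyp p = a.1 * (q - p) by rewrite -aq -ap /line; ring.
have -> : hyp q = hyp p + a.1 * (q - p) by lra.
move: (hyp p) a1; rewrite ltr_norml => h /andP[al ar] _ _ E3 E4 E5.
have : (1 - a.1 ^+ 2) * (q - p) ^+ 2 = 0 by lra.
move/eqP; rewrite mulf_eq0 => /orP[|]; last by rewrite sqrf_eq0 subr_eq0 gt_eqF.
by rewrite gt_eqF//; nra.
Qed.

(** Over [[p, q]] no point outside the disk satisfies both strips. Beyond it the ordering
    [a.1 <= c.1 <= b.1] squeezes the line of [c] between those of [a] and [b]. *)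
Lemma merge_outer a b c p q pb qa x : 
  arc a p qa -> arc b pb q -> p < q -> qa <= q -> p <= pb -> c = chord p q ->
  (forall v, p <= v <= q -> hyp v <= line a v \/ hyp v <= line b v) ->
  1 < norm2 x -> `|dot a x| <= 1 -> `|dot b x| <= 1 -> `|dot c x| <= 1.
Proof.
move=> [pqa ap aqa av] [pqb bp bq bv] pq qaq ppb cE cover.
have cpE : line c p = hyp p by rewrite cE chordl.
have cqE : line c q = hyp q by rewrite cE chordr.
have sL : a.1 <= c.1.
  have : line a qa <= line c qa by rewrite aqa cE chord_ge// ltW.
  have : line a p = line c p by rewrite cpE.
  by rewrite /line; nra.
have sR : c.1 <= b.1.
  have : line b pb <= line c pb by rewrite bp cE chord_ge// ltW.
  have : line b q = line c q by rewrite cqE.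
  by rewrite /line; nra.
have Ea v : line c v - line a v = (c.1 - a.1) * (v - p).
  have : line a p = line c p by rewrite cpE.
  by rewrite /line; lra.
have Eb v : line c v - line b v = (c.1 - b.1) * (v - q).
  have : line b q = line c q by rewrite cqE.
  by rewrite /line; lra.
have pos y : 0 < y.2 -> 1 < norm2 y -> `|dot a y| <= 1 -> `|dot b y| <= 1 -> `|dot c y| <= 1.
  move=> y2 ny; rewrite (dot_line a (lt0r_neq0 y2)) (dot_line b (lt0r_neq0 y2)).
  rewrite (dot_line c (lt0r_neq0 y2)).
  move: ny; rewrite norm2_hyp ?lt0r_neq0// => ny.
  move: (y.1 / y.2) ny => v ny.
  have kh : 1 < y.2 * hyp v.
    rewrite ltNge; apply/negP => h; move: ny; rewrite ltNge => /negP; apply.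
    by rewrite expr_le1// mulr_ge0 ?ltW// hyp_gt0.
  rewrite !ler_norml => /andP[al ar] /andP[bl br].
  have avn : line a v < hyp v by rewrite -(ltr_pM2l y2); apply: le_lt_trans kh.
  have bvn : line b v < hyp v by rewrite -(ltr_pM2l y2); apply: le_lt_trans kh.
  have [vp|pv] := ltP v p.
    have ca : line c v <= line a v by have := Ea v; nra.
    have cb : line b v <= line c v by have := Eb v; nra.
    by apply/andP; split; nra.
  have [qv|vq] := ltP q v.
    have ca : line a v <= line c v by have := Ea v; nra.
    have cb : line c v <= line b v by have := Eb v; nra.
    by apply/andP; split; nra.
  by case: (cover v); rewrite ?pv ?vq// leNgt ?avn ?bvn.
case: (ltgtP x.2 0) => [x2|x2|x2].
- by have := pos (- x); rewrite !dotN !normrN norm2N /= oppr_gt0; apply.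
- exact: pos.
rewrite /dot x2 !mulr0 !addr0 !ler_norml => _ /andP[? ?] /andP[? ?].
by have [x1|x1] := leP 0 x.1; apply/andP; split; nra.
Qed.

End arcs.

(** * Merging overlapping caps *)

Section arcs.
Variable R : realType.
Implicit Types (a b c x y : plane R) (p q u v : R).

(** [z] lies in a cap of each strip, so the two arcs overlap and their union is an interval
    [[p, q]]; the secant over this interval defines the merged strip. *)
Lemma merge_upper a b z : `|a.1| < 1 -> 0 < a.2 -> 1 < norm2 a ->
  `|b.1| < 1 -> 0 < b.2 -> 1 < norm2 b ->
  norm2 z <= 1 -> 1 <= dot a z -> 1 <= `|dot b z| ->
  exists c, [/\ 1 < norm2 c,
    forall x, norm2 x <= 1 -> `|dot c x| <= 1 -> `|dot a x| <= 1 /\ `|dot b x| <= 1 &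
    forall x, 1 < norm2 x -> `|dot a x| <= 1 -> `|dot b x| <= 1 -> `|dot c x| <= 1].
Proof.
move=> a1 a2 na b1 b2 nb nq aq bq.
have [q2 qa_v] := cap_upper a1 a2 nq aq.
have bq' : 1 <= dot b z.
  move: bq; rewrite ler_normr => /orP[//|]; rewrite -dotN => bq.
  have [] := cap_upper b1 b2 _ bq; rewrite ?norm2N//= oppr_gt0.
  by move=> /(lt_trans q2); rewrite ltxx.
have [_ qb_v] := cap_upper b1 b2 nq bq'.
have [pa [qa Aa]] := arc_exists a1 a2 na.
have [pb [qb Ab]] := arc_exists b1 b2 nb.
have [paqa pae qae va] := Aa; have [pbqb pbe qbe vb] := Ab.
move: qa_v qb_v => /va/andP[v1 v2] /vb/andP[v3 v4].
set v0 := (z.1 / z.2) in v1 v2 v3 v4.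
pose p := Num.min pa pb; pose q := Num.max qa qb.
have pq : p < q by rewrite /p /q gt_min !lt_max paqa.
have cover v : p <= v <= q -> hyp v <= line a v \/ hyp v <= line b v.
  rewrite /p /q ge_min le_max => /andP[/orP[h1|h1] /orP[h2|h2]].
  - by left; apply/va/andP.
  - have [h|h] := leP v v0; first by left; apply/va; rewrite h1 (le_trans h).
    by right; apply/vb; rewrite h2 (le_trans v3)// ltW.
  - have [h|h] := leP v v0; first by right; apply/vb; rewrite h1 (le_trans h).
    by left; apply/va; rewrite h2 (le_trans v1)// ltW.
  - by right; apply/vb/andP.
have cge v : p <= v -> v <= q -> hyp v <= line (chord p q) v by exact: chord_ge.
have [ppa ppb] : p <= pa /\ p <= pb by rewrite /p !ge_min !lexx orbT.
have [qqa qqb] : qa <= q /\ qb <= q by rewrite /q !le_max !lexx orbT.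
have capa : hyp pa <= line (chord p q) pa by apply: cge => //; lra.
have caqa : hyp qa <= line (chord p q) qa by apply: cge => //; lra.
have cbpb : hyp pb <= line (chord p q) pb by apply: cge => //; lra.
have cbqb : hyp qb <= line (chord p q) qb by apply: cge => //; lra.
exists (chord p q); split.
- have [v vpq av] := arc_gt a1 Aa.
  apply: (norm2_gt1 (v := v)); apply: lt_le_trans av _.
  by apply: line_interp vpq _ _; rewrite ?pae ?qae.
- move=> x nx cx; split; first exact: cap_mono Aa _ _ nx cx.
  exact: cap_mono Ab _ _ nx cx.
move=> x nx ax bx.
have coverb v : p <= v <= q -> hyp v <= line b v \/ hyp v <= line a v.
  by move=> /cover[]; [right|left].
(* Which arc owns each end of the hull decides the roles in [merge_outer]; an arc that contains the
   other plays both. *)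
have [h1|h1] := leP pa pb; have [h2|h2] := leP qb qa.
- have pE : p = pa by rewrite /p min_l.
  have qE : q = qa by rewrite /q max_l.
  rewrite pE qE in pq coverb cover *.
  have H v : pa <= v <= qa -> hyp v <= line a v \/ hyp v <= line a v by move=> /va; left.
  by apply: (merge_outer Aa Aa _ _ _ erefl H).
- have pE : p = pa by rewrite /p min_l.
  have qE : q = qb by rewrite /q max_r// ltW.
  rewrite pE qE in pq coverb cover *.
  by apply: (merge_outer Aa Ab _ _ _ erefl cover) => //; rewrite ltW.
- have pE : p = pb by rewrite /p min_r// ltW.
  have qE : q = qa by rewrite /q max_l.
  rewrite pE qE in pq coverb cover *.
  by apply: (merge_outer Ab Aa _ _ _ erefl coverb) => //; rewrite ltW.
- have pE : p = pb by rewrite /p min_r// ltW.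
  have qE : q = qb by rewrite /q max_r// ltW.
  rewrite pE qE in pq coverb cover *.
  have H v : pb <= v <= qb -> hyp v <= line b v \/ hyp v <= line b v by move=> /vb; left.
  by apply: (merge_outer Ab Ab _ _ _ erefl H).
Qed.

Lemma upper_sign a : `|a.1| < 1 -> 1 < norm2 a ->
  exists a', [/\ `|a'.1| < 1, 0 < a'.2, 1 < norm2 a' & forall x, `|dot a' x| = `|dot a x|].
Proof.
move=> a1 na; have [a2|a2|a2] := ltgtP a.2 0.
- exists (- a); split; rewrite ?norm2N /= ?normrN ?oppr_gt0//.
  by move=> x; rewrite dotNl normrN.
- by exists a.
move: na; rewrite /norm2 a2 expr0n addr0 => na.
by have := normr_ge0 a.1; have := real_normK (num_real a.1); nra.
Qed.

Lemma merge_axis a b z : `|a.1| < 1 -> 1 < norm2 a -> `|b.1| < 1 -> 1 < norm2 b ->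
  norm2 z <= 1 -> 1 <= `|dot a z| -> 1 <= `|dot b z| ->
  exists c, [/\ 1 < norm2 c,
    forall x, norm2 x <= 1 -> `|dot c x| <= 1 -> `|dot a x| <= 1 /\ `|dot b x| <= 1 &
    forall x, 1 < norm2 x -> `|dot a x| <= 1 -> `|dot b x| <= 1 -> `|dot c x| <= 1].
Proof.
move=> a1 na b1 nb nz az bz.
have [a' [a'1 a'2 na' aE]] := upper_sign a1 na.
have [b' [b'1 b'2 nb' bE]] := upper_sign b1 nb.
have [z' [nz' az' bz']] : exists z', [/\ norm2 z' <= 1, 1 <= dot a' z' & 1 <= `|dot b' z'|].
  move: az; rewrite -aE ler_normr => /orP[h|h]; first by exists z; rewrite bE.
  by exists (- z); rewrite norm2N !dotN normrN bE.
have [c [nc H1 H2]] := merge_upper a'1 a'2 na' b'1 b'2 nb' nz' az' bz'.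
exists c; split=> // x nx; first by rewrite -aE -bE; exact: H1.
by rewrite -aE -bE; exact: H2.
Qed.

Definition turn (e x : plane R) : plane R := lin e.1 e.2 (- e.2) e.1 x.

Lemma dot_turn e a x : norm2 e = 1 -> dot (turn e a) (turn e x) = dot a x.
Proof. by rewrite /norm2 => e1; rewrite /dot /turn /lin /= -[RHS]mul1r -e1; ring. Qed.

Lemma norm2_turn e x : norm2 e = 1 -> norm2 (turn e x) = norm2 x.
Proof. by rewrite /norm2 => e1; rewrite /turn /lin /= -[RHS]mul1r -e1; ring. Qed.

Lemma turnK e : norm2 e = 1 -> cancel (turn (e.1, - e.2)) (turn e).
Proof.
rewrite /norm2 => e1 [x y]; rewrite /turn lin_comp /lin /=; congr pair;
by rewrite -[RHS]mul1r -e1; ring.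
Qed.

(** Lying in both strips and outside the disk, [x0] points in a direction that meets neither cap.
    Once it is rotated to the first axis, the normals have first coordinates below 1 in absolute
    value. *)
Lemma merge_strips a b z x0 : 1 < norm2 a -> 1 < norm2 b ->
  norm2 z <= 1 -> 1 <= `|dot a z| -> 1 <= `|dot b z| ->
  1 < norm2 x0 -> `|dot a x0| <= 1 -> `|dot b x0| <= 1 ->
  exists c, [/\ 1 < norm2 c,
    forall x, norm2 x <= 1 -> `|dot c x| <= 1 -> `|dot a x| <= 1 /\ `|dot b x| <= 1 &
    forall x, 1 < norm2 x -> `|dot a x| <= 1 -> `|dot b x| <= 1 -> `|dot c x| <= 1].
Proof.
move=> na nb nz az bz nx0 ax0 bx0.
pose r := Num.sqrt (norm2 x0).
have r1 : 1 < r by rewrite -[ltLHS]sqrtr1 ltr_sqrt// (lt_trans _ nx0).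
have r0 : r != 0 by rewrite gt_eqF// (lt_trans _ r1).
have rr : r ^+ 2 = norm2 x0 by rewrite sqr_sqrtr// norm2_ge0.
pose e : plane R := (x0.1 / r, x0.2 / r).
have ne : norm2 e = 1 by rewrite /norm2 /= !expr_div_n -mulrDl -/(norm2 x0) rr divff// -rr expf_neq0.
have ne' : norm2 (e.1, - e.2) = 1 by rewrite -ne /norm2 /= sqrrN.
have first_lt c : `|dot c x0| <= 1 -> `|(turn e c).1| < 1.
  have -> : dot c x0 = r * (turn e c).1 by rewrite /dot /turn /=; field.
  rewrite normrM gtr0_norm ?(lt_trans _ r1)// => h.
  by have := normr_ge0 (turn e c).1; nra.
have := @merge_axis (turn e a) (turn e b) (turn e z).
rewrite !norm2_turn// !dot_turn//.
move=> /(_ (first_lt _ ax0) na (first_lt _ bx0) nb nz az bz) [c [nc H1 H2]].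
exists (turn (e.1, - e.2) c); rewrite norm2_turn//; split=> // x nx.
  rewrite -(dot_turn _ _ ne) turnK// => cx.
  by have := H1 (turn e x); rewrite norm2_turn// !dot_turn//; apply.
move=> ax bx; rewrite -(dot_turn _ _ ne) turnK//.
by apply: H2; rewrite ?norm2_turn ?dot_turn.
Qed.

Definition polygon (l : seq (plane R)) : set (plane R) :=
  [set x | forall a, a \in l -> `|dot a x| <= 1].

(* Replacing two strips whose caps meet in the disk by one strip cut off by the
   hull of the two arcs shortens the list, so the process stops with disjoint caps. *)
Lemma disjoint_caps l x0 : polygon l x0 -> 1 < norm2 x0 ->
  exists l', [/\ uniq l', forall a, a \in l' -> 1 < norm2 a,
    forall x, norm2 x <= 1 -> polygon l' x -> polygon l x,
    forall x, 1 < norm2 x -> polygon l x -> polygon l' x &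
    forall a b x, a \in l' -> b \in l' -> a != b -> norm2 x <= 1 ->
      1 <= `|dot a x| -> 1 <= `|dot b x| -> False].
Proof.
move=> lx0 nx0.
pose good l' := [/\ uniq l', forall a, a \in l' -> 1 < norm2 a,
    forall x, norm2 x <= 1 -> polygon l' x -> polygon l x &
    forall x, 1 < norm2 x -> polygon l x -> polygon l' x].
suff : forall n l', (size l' <= n)%N -> good l' -> exists l', good l' /\
    forall a b x, a \in l' -> b \in l' -> a != b -> norm2 x <= 1 ->
      1 <= `|dot a x| -> 1 <= `|dot b x| -> False.
  (* A strip with [norm2 a <= 1] contains the disk, so dropping it changes nothing there. *)
  move=> H; pose l1 := undup [seq a <- l | 1 < norm2 a].
  have [|l' [[? ? ? ?] ?]] := H (size l1) l1 (leqnn _); last by exists l'.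
  split; first exact: undup_uniq.
  - by move=> a; rewrite mem_undup mem_filter => /andP[].
  - move=> x nx lx a al; have [na|na] := ltP 1 (norm2 a).
      by apply: lx; rewrite mem_undup mem_filter na.
    apply: le_of_sqr => //; rewrite real_normK ?num_real// expr1n.
    have : dot a x ^+ 2 <= norm2 a * norm2 x.
      rewrite -subr_ge0 /dot /norm2.
      by rewrite [leRHS](_ : _ = (a.1 * x.2 - a.2 * x.1) ^+ 2) ?sqr_ge0//; ring.
    by move/le_trans; apply; rewrite mulr_ile1// norm2_ge0.
  - by move=> x _ lx a; rewrite mem_undup mem_filter => /andP[_ /lx].
elim=> [l' /[!leqn0]/nilP-> g|n IH l' sl' [ul' nl' H1 H2]].
  by exists [::]; split.
have [|noex] := pselect (exists a b x, [/\ a \in l', b \in l', a != b & [/\ norm2 x <= 1,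
      1 <= `|dot a x| & 1 <= `|dot b x|]]); last first.
  exists l'; split=> // a b x al bl ab nx ax bx; apply: noex.
  by exists a, b, x.
move=> [a [b [z [al bl ab [nz az bz]]]]].
have l'x0 : polygon l' x0 by apply: H2.
have [c [nc C1 C2]] := merge_strips (nl' _ al) (nl' _ bl) nz az bz nx0 (l'x0 _ al) (l'x0 _ bl).
pose l2 := [seq d <- l' | (d != a) && (d != b)].
have sl2 : (size l2 + 2 <= size l')%N.
  rewrite -(count_predC (fun d => (d != a) && (d != b)) l') size_filter leq_add2l -size_filter.
  apply: (@uniq_leq_size _ [:: a; b]); first by rewrite /= inE ab.
  by move=> d; rewrite !inE mem_filter /= -negb_or negbK => /orP[]/eqP->;
    rewrite eqxx ?orbT.
apply: (IH (undup (c :: l2))).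
  by apply: leq_trans (size_undup _) _; rewrite /= -ltnS (leq_trans _ sl')// -addn2.
split; first exact: undup_uniq.
- move=> d; rewrite mem_undup inE mem_filter => /predU1P[->//|/andP[_]].
  exact: nl'.
- move=> x nx l2x; apply: H1 => // d dl.
  have cx : `|dot c x| <= 1 by apply: l2x; rewrite mem_undup inE eqxx.
  have [ax bx] := C1 x nx cx.
  have [->//|da] := eqVneq d a; have [->//|db] := eqVneq d b.
  by apply: l2x; rewrite mem_undup inE mem_filter da db dl orbT.
move=> x nx lx d; rewrite mem_undup inE mem_filter => /predU1P[->|/andP[_ dl]].
  by apply: C2 => //; apply: H2.
by apply: H2.
Qed.

End arcs.

(** * Areas of caps *)

Section caps.
Variable R : realType.
Implicit Types (a b c x y : plane R) (p q u v z : R).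

Definition halfcap d : R := ar (@unit_disk R `&` [set x | d < x.1]).

Lemma bmeas_halfcap d : bmeas (@unit_disk R `&` [set x | d < x.1]).
Proof.
apply: bmeasI; first exact: bmeas_disk.
by apply: plane_measurable_lt; [exact: measurable_cst|exact: measurable_fst].
Qed.

(** The slab between the distances [u] and [v] lies between two rectangles, with the shorter and the
    longer bounding chord as height. *)
Lemma halfcap_bounds u v : 0 < u -> u <= v -> v < 1 ->
  2 * Num.sqrt (1 - v ^+ 2) * (v - u) <= halfcap u - halfcap v <=
  2 * Num.sqrt (1 - u ^+ 2) * (v - u).
Proof.
move=> u0 uv v1.
have mv : plane_measurable [set x : plane R | v < x.1].
  by apply: plane_measurable_lt; [exact: measurable_cst|exact: measurable_fst].
have Du : 0 < 1 - u ^+ 2 by nra.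
have Dv : 0 < 1 - v ^+ 2 by nra.
set su := Num.sqrt (1 - u ^+ 2); set sv := Num.sqrt (1 - v ^+ 2).
have su2 : su ^+ 2 = 1 - u ^+ 2 by rewrite sqr_sqrtr// ltW.
have sv2 : sv ^+ 2 = 1 - v ^+ 2 by rewrite sqr_sqrtr// ltW.
have su0 : 0 <= su by exact: sqrtr_ge0.
have sv0 : 0 <= sv by exact: sqrtr_ge0.
have -> : halfcap u - halfcap v =
    ar (@unit_disk R `&` [set x | u < x.1] `\` [set x | v < x.1]).
  rewrite ar_diff//; last exact: bmeas_halfcap.
  congr (_ - ar _); apply/seteqP; split => x /=; last by move=> [[]].
  by move=> [? h]; split=> //; split=> //; exact: le_lt_trans h.
set S := _ `\` _.
have bS : bmeas S by apply: bmeasD => //; exact: bmeas_halfcap.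
apply/andP; split; last first.
  apply: (@le_trans _ _ (ar (box u v (- su) su))).
    apply: ar_le; [by case: bS|exact: bmeas_box|].
    move=> x [[+ /= ux] /negP]; rewrite unit_diskE /norm2 /= -leNgt => nx xv.
    apply/boxP; rewrite (ltW ux) xv; split=> //; rewrite -ler_norml.
    by apply: le_of_sqr => //; rewrite real_normK ?num_real// su2; nra.
  by rewrite ar_box//; [lra|rewrite -subr_ge0 opprK addr_ge0].
have [->|neuv] := eqVneq u v; first by rewrite subrr mulr0 ar_ge0.
(* The slab is open on the left. Without its left edge the box fits in, and the edge has area 0. *)
pose T := box u v (- sv) sv `&` [set x | u < x.1].
have mu : plane_measurable [set x : plane R | u < x.1].
  by apply: plane_measurable_lt; [exact: measurable_cst|exact: measurable_fst].
have TE : ar T = 2 * sv * (v - u).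
  have -> : 2 * sv * (v - u) = ar (box u v (- sv) sv).
    by rewrite ar_box//; [ring|rewrite -subr_ge0 opprK addr_ge0].
  rewrite (ar_split (bmeas_box u v (- sv) sv) mu) -[LHS]addr0; congr (_ + _).
  apply/esym/le_anti; rewrite ar_ge0 andbT.
  apply: (@le_trans _ _ (ar (box u u (- sv) sv))); last first.
    by rewrite ar_box ?subrr ?mul0r// -subr_ge0 opprK addr_ge0.
  apply: ar_le; [|exact: bmeas_box|].
    by apply: plane_measurableD => //; exact: plane_measurable_box.
  move=> x [/boxP[/andP[x1 x2] x3] /negP]; rewrite /= -leNgt => x4.
  by apply/boxP; rewrite x1 x4 x3.
rewrite -TE; apply: ar_le => //.
  by apply: plane_measurableI => //; exact: plane_measurable_box.
move=> x [/boxP[/andP[x1 x2] x3] ux]; split; last by apply/negP; rewrite -leNgt.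
split=> //; rewrite unit_diskE /norm2 /=.
have : x.2 ^+ 2 <= sv ^+ 2 by move: x3 => /andP[x3 x4]; nra.
by rewrite sv2; nra.
Qed.

Lemma halfcap_le u : 0 < u -> u < 1 -> halfcap u <= 2 * Num.sqrt (1 - u ^+ 2).
Proof.
move=> u0 u1; set su := Num.sqrt (1 - u ^+ 2).
have su2 : su ^+ 2 = 1 - u ^+ 2 by rewrite sqr_sqrtr//; nra.
have su0 : 0 <= su by exact: sqrtr_ge0.
apply: (@le_trans _ _ (ar (box 0 1 (- su) su))).
  apply: ar_le; [by case: (bmeas_halfcap u)|exact: bmeas_box|].
  move=> x [+ /= ux]; rewrite unit_diskE /norm2 /= => nx.
  apply/boxP; split; first by apply/andP; split; nra.
  rewrite -ler_norml; apply: le_of_sqr => //.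
  by rewrite real_normK ?num_real// su2; nra.
by rewrite ar_box//; [lra|rewrite -subr_ge0 opprK addr_ge0].
Qed.

(** Two-sided bounds on an increment give exactly this error estimate. The difference quotient,
    completed by [phi x] at [x], is then continuous there. *)
Lemma is_derive_squeeze (f phi : R -> R) (x e : R) : 0 < e ->
  {for x, continuous phi} ->
  (forall z, `|z - x| < e ->
     `|f z - f x - phi x * (z - x)| <= `|phi z - phi x| * `|z - x|) ->
  is_derive x 1 f (phi x).
Proof.
move=> e0 cphi H; apply/is_derive1_caratheodory.
exists (fun z => if z == x then phi x else (f z - f x) / (z - x)); split.
- move=> z; case: eqVneq => [->|zx]; first by rewrite !subrr mulr0.
  by rewrite mulfVK// subr_eq0.
- apply/cvgrPdist_le => /= d d0; rewrite eqxx.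
  have : \forall z \near x, `|phi x - phi z| <= d.
    by move/cvgrPdist_le : cphi; exact.
  have : \forall z \near x, `|z - x| < e.
    by near=> z; rewrite distrC; near: z; exact: nbhsx_ballx.
  apply: filterS2 => z ze zd.
  case: eqVneq => [_|zx]; first by rewrite subrr normr0 ltW.
  apply: le_trans zd; rewrite [leRHS]distrC.
  have zx0 : 0 < `|z - x| by rewrite normr_gt0 subr_eq0.
  rewrite -(ler_pM2r zx0); apply: le_trans (H z ze).
  rewrite -normrM -normrN -mulNr opprB mulrBl mulfVK// subr_eq0//.
- by rewrite eqxx.
Unshelve. all: by end_near. Qed.

Lemma is_derive_halfcap u : 0 < u -> u < 1 ->
  is_derive u 1 halfcap (- (2 * Num.sqrt (1 - u ^+ 2))).
Proof.
move=> u0 u1; pose phi z : R := - (2 * Num.sqrt (1 - z ^+ 2)).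
apply: (@is_derive_squeeze halfcap phi u (Num.min u (1 - u))).
- by rewrite lt_min u0 subr_gt0.
- apply: continuousN; apply: continuousM; first exact: cvg_cst.
  apply: (@continuous_comp _ _ _ (fun z => 1 - z ^+ 2) Num.sqrt).
    apply: continuousB; first exact: cvg_cst.
    exact: exprn_continuous.
  exact: sqrt_continuous.
move=> z; rewrite lt_min !ltr_norml => /andP[/andP[z1 z2] /andP[z3 z4]].
have [z0 z5] : 0 < z /\ z < 1 by split; lra.
rewrite /phi; have [uz|zu] := leP u z.
  have /andP[] := halfcap_bounds u0 uz z5.
  rewrite (ger0_norm (x := z - u)) ?subr_ge0//.
  set s := Num.sqrt _; set t := Num.sqrt _ => h1 h2.
  have [->|zu] := eqVneq u z; first by rewrite !subrr !mulr0 subrr normr0.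
  have zu0 : 0 < z - u by rewrite subr_gt0 lt_neqAle zu.
  have st : s <= t by move: (le_trans h1 h2); rewrite ler_pM2r// ler_pM2l.
  rewrite ger0_norm; last by lra.
  rewrite (ger0_norm (x := _ - - _)); last by lra.
  by lra.
have /andP[] := halfcap_bounds z0 (ltW zu) u1.
rewrite (ltr0_norm (x := z - u)) ?subr_lt0//.
set s := Num.sqrt _; set t := Num.sqrt _ => h1 h2.
have zu0 : 0 < u - z by rewrite subr_gt0.
have st : s <= t by move: (le_trans h1 h2); rewrite ler_pM2r// ler_pM2l.
rewrite ger0_norm; last by lra.
rewrite (ler0_norm (x := _ - - _)); last by lra.
by lra.
Qed.

End caps.

(** * Derivatives of cap areas along a stretch *)

Section second_order.
Variable R : realType.
Implicit Types (a b c x y : plane R) (p q u v z s t : R).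

Lemma cap_area a : 0 < norm2 a ->
  ar (@unit_disk R `&` [set x | 1 < dot a x]) = halfcap (Num.sqrt (norm2 a))^-1.
Proof.
move=> na; set r := Num.sqrt (norm2 a).
have r0 : 0 < r by rewrite sqrtr_gt0.
have rr : r ^+ 2 = norm2 a by rewrite sqr_sqrtr// ltW.
pose e : plane R := (a.1 / r, a.2 / r).
have ne : norm2 e = 1.
  by rewrite /norm2 /= !expr_div_n -mulrDl -/(norm2 a) rr divff// gt_eqF.
rewrite /halfcap -[RHS](@ar_lin1 R e.1 e.2 (- e.2) e.1); last 2 first.
- by rewrite mulrN opprK -!expr2 -/(norm2 e) ne normr1.
- exact: bmeas_halfcap.
have key x : (1 < dot a x) = (r^-1 < (turn e x).1).
  rewrite -[RHS](ltr_pM2l r0) mulfV ?gt_eqF//; congr (_ < _).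
  by rewrite /dot /turn /lin /=; field; rewrite gt_eqF.
congr ar; apply/seteqP; split => x; rewrite !unit_diskE /= key;
  by rewrite -[lin _ _ _ _ x]/(turn e x) norm2_turn.
Qed.

(** The squared norm of the normal [a] after the stretch by [s]; a cap of the stretched disk has the
    area of a unit cap at distance [1 / sqrt (qform a s)]. *)
Definition qform a s : R := expR (2 * s) * a.1 ^+ 2 + expR (- (2 * s)) * a.2 ^+ 2.
Definition dqform a s : R := 2 * (expR (2 * s) * a.1 ^+ 2 - expR (- (2 * s)) * a.2 ^+ 2).

Lemma is_derive_qform a (s : R) : is_derive s 1 (qform a) (dqform a s).
Proof.
rewrite /qform /dqform; apply: is_derive_eq.
by rewrite /GRing.scale /=; ring.
Qed.

Lemma is_derive_dqform a (s : R) : is_derive s 1 (dqform a) (4 * qform a s).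
Proof.
rewrite /qform /dqform; apply: is_derive_eq.
by rewrite /GRing.scale /=; ring.
Qed.

(** The chain rule for [halfcap (1 / sqrt q)] with [q = qform a s], after cancelling the roots of
    [q]. *)
Definition dcap a s : R := Num.sqrt (qform a s - 1) / qform a s ^+ 2 * dqform a s.

Lemma is_derive_cap a (s : R) : 1 < qform a s ->
  is_derive s 1 (fun t => halfcap (Num.sqrt (qform a t))^-1) (dcap a s).
Proof.
move=> q1; have q0 : 0 < qform a s by apply: lt_trans q1.
have r0 : 0 < Num.sqrt (qform a s) by rewrite sqrtr_gt0.
have r1 : 1 < Num.sqrt (qform a s) by rewrite -[ltLHS]sqrtr1 ltr_sqrt.
have dq := is_derive_qform a s.
have dsq : is_derive s 1 (fun t => Num.sqrt (qform a t))
    ((2 * Num.sqrt (qform a s))^-1 * dqform a s).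
  by apply: is_derive1_comp; exact: is_derive1_sqrt.
have dinv : is_derive s 1 (fun t => (Num.sqrt (qform a t))^-1)
    (- Num.sqrt (qform a s) ^- 2 *: ((2 * Num.sqrt (qform a s))^-1 * dqform a s)).
  by apply: is_deriveV => //; rewrite gt_eqF.
have dh := @is_derive_halfcap R (Num.sqrt (qform a s))^-1.
have {}dh := dh _ _; rewrite invr_gt0 invf_lt1// in dh; have {}dh := dh r0 r1.
have dc := is_derive1_comp (f := halfcap (R := R)) (g := fun t => (Num.sqrt (qform a t))^-1) dh dinv.
apply: is_derive_eq.
rewrite /dcap /GRing.scale /=.
have rr : Num.sqrt (qform a s) ^+ 2 = qform a s by rewrite sqr_sqrtr// ltW.
rewrite exprVn rr.
have -> : Num.sqrt (1 - (qform a s)^-1) = Num.sqrt (qform a s - 1) / Num.sqrt (qform a s).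
  rewrite -sqrtrV ?ltW// -sqrtrM ?subr_ge0 ?ltW//; congr Num.sqrt.
  by rewrite mulrBl divff ?gt_eqF// mul1r.
rewrite -{3}rr; move: (Num.sqrt (qform a s)) r0 rr => r r0 <-.
by field; rewrite gt_eqF.
Qed.

Lemma is_derive_dcap a : 1 < norm2 a -> let Z := norm2 a in let r := Num.sqrt (Z - 1) in
  let X := a.1 ^+ 2 - a.2 ^+ 2 in
  is_derive (0 : R) 1 (dcap a)
    (4 * X ^+ 2 * ((2 * r * Z ^+ 2)^-1 - 2 * r / Z ^+ 3) + 4 * r / Z).
Proof.
move=> Z1 Z r X.
have q0E : qform a 0 = Z by rewrite /qform mulr0 oppr0 expR0 !mul1r.
have dq0E : dqform a 0 = 2 * X by rewrite /dqform mulr0 oppr0 expR0 !mul1r.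
have Z0 : 0 < Z by apply: lt_trans Z1.
have r0 : 0 < r by rewrite sqrtr_gt0 subr_gt0.
have dq := is_derive_qform a 0.
have ddq := is_derive_dqform a 0.
have dq1 : is_derive (0 : R) 1 (fun t => qform a t - 1) (dqform a 0).
  by apply: is_derive_eq; rewrite subr0.
have dsq : is_derive (0 : R) 1 (fun t => Num.sqrt (qform a t - 1)) ((2 * r)^-1 * dqform a 0).
  rewrite /r -q0E; apply: is_derive1_comp.
  by apply: is_derive1_sqrt; rewrite q0E subr_gt0.
have dq2 : is_derive (0 : R) 1 (fun t => qform a t ^+ 2) (2 * Z * dqform a 0).
  by apply: is_derive_eq; rewrite q0E /GRing.scale /=; ring.
have dinv : is_derive (0 : R) 1 (fun t => (qform a t ^+ 2)^-1)
    (- (qform a 0 ^+ 2) ^- 2 *: (2 * Z * dqform a 0)).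
  by apply: is_deriveV => //; rewrite q0E gt_eqF// exprn_gt0.
have dm := is_deriveM dsq dinv.
have dmm := is_deriveM dm ddq.
apply: is_derive_eq.
rewrite /GRing.scale fctE /= q0E dq0E -/Z -/r; have Zr : Z = r ^+ 2 + 1.
  by rewrite sqr_sqrtr ?subrK// subr_ge0 ltW.
by field; rewrite !gt_eqF.
Qed.

Lemma is_derive_sumseq (T : eqType) (l : seq T) (f : T -> R -> R) (df : T -> R) s :
  (forall i, i \in l -> is_derive s 1 (f i) (df i)) ->
  is_derive s 1 (fun t => \sum_(i <- l) f i t) (\sum_(i <- l) df i).
Proof.
elim: l => [_|i l IH H].
  rewrite big_nil (_ : (fun _ => _) = cst 0); first exact: is_derive_cst.
  by apply/funext => t; rewrite big_nil.
rewrite big_cons (_ : (fun _ => _) = f i \+ (fun t => \sum_(i <- l) f i t)).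
  apply: is_deriveD; first by apply: H; rewrite inE eqxx.
  by apply: IH => j jl; apply: H; rewrite inE jl orbT.
by apply/funext => t; rewrite big_cons.
Qed.

(** The first conclusion is Fermat's rule. If [c] were negative, [G'] would be negative just to the
    right of 0, and by the mean value theorem [G] would fall below [G 0]. *)
Lemma second_order_min (G G' : R -> R) (c e : R) : 0 < e ->
  (forall s, `|s| < e -> is_derive s 1 G (G' s)) -> is_derive (0 : R) 1 G' c ->
  (forall s, `|s| < e -> G 0 <= G s) -> G' 0 = 0 /\ 0 <= c.
Proof.
move=> e0 dG dG' Gmin.
have in_e s : s \in `](- e), e[ -> `|s| < e by rewrite in_itv /= ltr_norml.
have G'0 : G' 0 = 0.
  have d0 : is_derive (0 : R) 1 G 0.
    apply: (@derive1_at_min _ G (- e) e); rewrite ?in_itv/= ?oppr_lt0 ?e0//; first lra.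
      by move=> t /in_e /dG [].
    by move=> t /in_e /Gmin.
  have := dG 0; rewrite normr0 => /(_ e0) h.
  by rewrite -(@derive_val _ _ _ _ _ _ _ h) (@derive_val _ _ _ _ _ _ _ d0).
split=> //; rewrite leNgt; apply/negP => c0.
have /is_derive1_caratheodory[g [gE cg gc]] := dG'.
have : \forall z \near (0 : R), g z < 0.
  have /cvgrPdist_lt := cg; rewrite gc => /(_ (- c)); rewrite oppr_gt0 => /(_ c0).
  apply: filterS => z; rewrite ltr_norml => /andP[h _]; lra.
move=> /nbhs_ballP[d /= d0 Hd].
pose t := Num.min d e / 2.
have m0 : 0 < Num.min d e by rewrite lt_min d0.
have t0 : 0 < t by rewrite divr_gt0.
have [td te] : t < d /\ t < e.
  have : t < Num.min d e by rewrite ltr_pdivrMr// ltr_pMr// ltr1n.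
  by rewrite lt_min => /andP[].
have sub s : s \in `[0, t] -> `|s| < e.
  by rewrite in_itv /= => /andP[s0 st]; rewrite ger0_norm// (le_lt_trans st).
have [| |xi xt] := @MVT R G G' 0 t t0.
- by move=> x xt; apply: dG; apply: sub; apply: subset_itv_oo_cc xt.
- apply: derivable_within_continuous => s st; by case: (dG s (sub s st)).
have : `|t| < e by rewrite ger0_norm// ltW.
move=> /Gmin; rewrite -subr_ge0 => h E; move: h; rewrite E subr0 pmulr_lge0//.
have := gE xi; rewrite G'0 !subr0 => ->.
move: xt; rewrite in_itv /= => /andP[xi0 xit].
rewrite pmulr_lge0// leNgt => /negP; apply; apply: Hd.
by rewrite /ball /= sub0r normrN ger0_norm ?ltW// (lt_trans xit).
Qed.

End second_order.

(** * Stretching the disk against a polygon *)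

Section barrier.
Variable R : realType.
Implicit Types (a b c x y : plane R) (p q u v z s t : R) (X K : set (plane R)).

Lemma plane_measurable_polygon (l : seq (plane R)) : plane_measurable (polygon l).
Proof.
elim: l => [|a l IH].
  by rewrite (_ : polygon _ = setT) ?/plane_measurable//; apply/seteqP; split.
rewrite (_ : polygon _ = [set x | `|dot a x| <= 1] `&` polygon l).
  by apply: plane_measurableI => //; exact: plane_measurable_strip.
apply/seteqP; split => [x H|x [H1 H2]].
  split; first by apply: H; rewrite inE eqxx.
  by move=> b bl; apply: H; rewrite inE bl orbT.
by move=> b; rewrite inE => /predU1P[->//|/H2].
Qed.

(** The half turn about the origin exchanges the two caps and preserves area. *)
Lemma ar_two_caps X a : bmeas X -> (forall x, X x -> X (- x)) ->
  ar (X `&` [set x | 1 < `|dot a x|]) = 2 * ar (X `&` [set x | 1 < dot a x]).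
Proof.
move=> bX sX.
have bU : bmeas (X `&` [set x | 1 < dot a x]).
  by apply: bmeasI => //; exact: plane_measurable_dot_gt.
have d1 : `|(-1) * (-1) - 0 * 0| = 1 :> R by rewrite mulrNN mul0r subr0 mulr1 normr1.
rewrite mulr_natl mulr2n -[X in _ + X](ar_lin1 d1 bU) -arU//; last 2 first.
- by apply: bmeas_lin => //; rewrite mulrNN mul0r subr0 mulr1 oner_neq0.
- apply/seteqP; split => // x [[Xx /= ax] [_ /=]].
  have -> : lin (-1) 0 0 (-1) x = - x.
    by rewrite /lin; apply: injective_projections => /=; ring.
  by rewrite dotN; lra.
have linN x : lin (-1) 0 0 (-1) x = - x.
  by rewrite /lin; apply: injective_projections => /=; ring.
congr ar; apply/seteqP; split => [x [Xx /=]|x].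
  rewrite ltr_normr => /orP[h|h]; first by left.
  by right => /=; rewrite linN; split; [exact: sX|rewrite /= dotN].
move=> [[Xx /= h]|/=]; first by split=> //=; rewrite ltr_normr h.
rewrite linN => -[Xx /= h]; split; first by rewrite -[x]opprK; exact: sX.
by rewrite /= ltr_normr -dotN h orbT.
Qed.

Lemma ar_caps_sum X (l : seq (plane R)) : bmeas X -> (forall x, X x -> X (- x)) -> uniq l ->
  (forall a b x, a \in l -> b \in l -> a != b -> X x ->
     1 < `|dot a x| -> 1 < `|dot b x| -> False) ->
  ar (X `\` polygon l) = \sum_(a <- l) 2 * ar (X `&` [set x | 1 < dot a x]).
Proof.
move=> bX sX; elim: l => [_ _|a l IH /= /andP[al ul] H].
  rewrite big_nil (_ : _ `\` _ = set0); first by rewrite ar_set0.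
  by apply/seteqP; split => // x [_ /=]; apply.
rewrite big_cons -IH//; last first.
  by move=> b c x bl cl; apply: H; rewrite inE ?bl ?cl orbT.
rewrite -ar_two_caps// -arU; last 3 first.
- apply: bmeasI => //; apply: plane_measurable_lt; first exact: measurable_cst.
  by apply: measurableT_comp => //; exact: measurable_dot.
- by apply: bmeasD => //; exact: plane_measurable_polygon.
- apply/seteqP; split => // x [[Xx /= ax] [_]]; apply => b bl.
  rewrite leNgt; apply/negP => bx; apply: (H a b x) => //.
  + by rewrite inE eqxx.
  + by rewrite inE bl orbT.
  + by apply: contra al => /eqP->.
congr ar; apply/seteqP; split => [x [Xx nP]|x].
  have [ax|ax] := ltP 1 `|dot a x|; first by left.
  right; split=> // Pl; apply: nP => b; rewrite inE => /predU1P[->//|].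
  exact: Pl.
move=> [[Xx /= ax]|[Xx nP]]; split=> //.
  by move=> /(_ a); rewrite inE eqxx => /(_ isT); rewrite leNgt ax.
by move=> Pl; apply: nP => b bl; apply: Pl; rewrite inE bl orbT.
Qed.

Definition stretch s x : plane R := lin (expR s) 0 0 (expR (- s)) x.

(* The image of the unit disk under [stretch s]. *)
Definition stretched_disk s : set (plane R) := stretch (- s) @^-1` @unit_disk R.

Lemma stretch_det s : expR s * expR (- s) - 0 * 0 = 1.
Proof. by rewrite mul0r subr0 -expRD subrr expR0. Qed.

Lemma norm_stretch_det s : `|expR s * expR (- s) - 0 * 0| = 1.
Proof. by rewrite stretch_det normr1. Qed.

Lemma stretch_det_neq0 s : expR s * expR (- s) - 0 * 0 != 0.
Proof. by rewrite stretch_det oner_neq0. Qed.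

Lemma stretchD s t x : stretch s (stretch t x) = stretch (s + t) x.
Proof.
by rewrite /stretch lin_comp !mul0r !mulr0 !addr0 !add0r -!expRD opprD.
Qed.

Lemma stretch0 x : stretch 0 x = x.
Proof.
by case: x => x y; rewrite /stretch /lin oppr0 expR0 /= !mul1r !mul0r addr0 add0r.
Qed.

Lemma stretchN s x : stretch s (- x) = - stretch s x.
Proof. by rewrite /stretch /lin; apply: injective_projections => /=; ring. Qed.

Lemma dot_stretch a s x : dot a (stretch s x) = dot (stretch s a) x.
Proof. by rewrite /dot /stretch /=; ring. Qed.

Lemma norm2_stretch a s : norm2 (stretch s a) = qform a s.
Proof.
rewrite /norm2 /qform /stretch /= !mul0r addr0 add0r !exprMn.
by rewrite -!expRM_natl// mulrN.
Qed.

Lemma bmeas_stretched s : bmeas (stretched_disk s).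
Proof. by apply: bmeas_lin; [exact: stretch_det_neq0|exact: bmeas_disk]. Qed.

Lemma stretched_sym s x : stretched_disk s x -> stretched_disk s (- x).
Proof. by rewrite /stretched_disk /= !unit_diskE /= stretchN norm2N. Qed.

Lemma ar_stretched s : ar (stretched_disk s) = ar (@unit_disk R).
Proof. by apply: ar_lin1; [exact: norm_stretch_det|exact: bmeas_disk]. Qed.

(** The stretch preserves area and is a symmetric matrix: pulling back turns the stretched disk into
    the disk and the normal [a] into [stretch s a]. *)
Lemma ar_stretched_cap s a : 0 < qform a s ->
  ar (stretched_disk s `&` [set x | 1 < dot a x]) = halfcap (Num.sqrt (qform a s))^-1.
Proof.
move=> q0; rewrite -norm2_stretch -cap_area; last by rewrite norm2_stretch.
rewrite -(ar_lin1 (norm_stretch_det s)); last first.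
  by apply: bmeasI; [exact: bmeas_stretched|exact: plane_measurable_dot_gt].
congr ar; apply/seteqP; split => x; rewrite /stretched_disk /= -/(stretch s x);
  by rewrite stretchD addNr stretch0 dot_stretch.
Qed.

Lemma norm2_stretched s x : stretched_disk s x -> norm2 x <= expR (2 * `|s|).
Proof.
rewrite /stretched_disk /= unit_diskE /= norm2_stretch /qform !mulrN opprK => nx.
rewrite -(ler_pM2l (expR_gt0 (- (2 * `|s|)))) -expRD addNr expR0.
apply: le_trans nx; rewrite /norm2 mulrDr.
apply: lerD; rewrite ler_wpM2r ?sqr_ge0// ler_expR.
  by rewrite lerN2 ler_pM2l// ler_norm.
by have := ler_norm (- s); rewrite normrN; lra.
Qed.

(** Used with [Y] the disk, [X] a stretched disk and [P] the polygon after merging. [P] is smaller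
    inside [Y] and larger outside, so [X] gains more outside [Y] and gives up less inside it; the
    part common to [X] and [Y] cancels. *)
Lemma bodies_swap X K P Y : bmeas X -> bmeas Y -> plane_measurable K -> plane_measurable P ->
  (forall x, Y x -> P x -> K x) -> (forall x, ~ Y x -> K x -> P x) ->
  ar (X `&` K) - ar (Y `&` K) <= ar (X `&` P) - ar (Y `&` P).
Proof.
move=> bX bY mK mP YPK KPY.
have [[mX _] [mY _]] := (bX, bY).
rewrite (ar_split (bmeasI bX mK) mY) (ar_split (bmeasI bX mP) mY).
rewrite (ar_split (bmeasI bY mK) mX) (ar_split (bmeasI bY mP) mX).
have -> : X `&` K `&` Y = Y `&` K `&` X by rewrite setIAC -setIA setIC setIAC.
have -> : X `&` P `&` Y = Y `&` P `&` X by rewrite setIAC -setIA setIC setIAC.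
have : ar (X `&` K `\` Y) <= ar (X `&` P `\` Y).
  apply: ar_le; [|by apply: bmeasD => //; exact: bmeasI|].
    by apply: plane_measurableD => //; exact: plane_measurableI.
  by move=> x [[Xx Kx] Yx]; split=> //; split=> //; exact: KPY.
have : ar (Y `&` P `\` X) <= ar (Y `&` K `\` X).
  apply: ar_le; [|by apply: bmeasD => //; exact: bmeasI|].
    by apply: plane_measurableD => //; exact: plane_measurableI.
  by move=> x [[Xx Kx] Yx]; split=> //; split=> //; exact: YPK.
clear; move: (ar (X `&` K `\` Y)) (ar (X `&` P `\` Y)) (ar (Y `&` P `\` X)).
by move: (ar (Y `&` K `\` X)) (ar (Y `&` K `&` X)) (ar (Y `&` P `&` X)) => *; lra.
Qed.

Lemma finite_radius (T : eqType) (l : seq T) (P : T -> R -> Prop) :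
  (forall i r r', P i r -> 0 < r' -> r' <= r -> P i r') ->
  (forall i, i \in l -> exists2 r, 0 < r & P i r) ->
  exists2 r, 0 < r & forall i, i \in l -> P i r.
Proof.
move=> mono; elim: l => [_|i l IH H]; first by exists 1.
have [|r r0 Hr] := IH; first by move=> j jl; apply: H; rewrite inE jl orbT.
have [|r1 r10 Hr1] := H i; first by rewrite inE eqxx.
have m0 : 0 < Num.min r r1 by rewrite lt_min r0.
exists (Num.min r r1) => // j; rewrite inE => /predU1P[->|jl].
  by apply: mono Hr1 _ _ => //; rewrite ge_min lexx orbT.
by apply: mono (Hr _ jl) _ _ => //; rewrite ge_min lexx.
Qed.

Lemma continuous_dot a : continuous (dot a).
Proof.
move=> x; rewrite /dot; apply: cvgD; apply: cvgM; try exact: cvg_cst.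
  exact: cvg_fst.
exact: cvg_snd.
Qed.

Lemma continuous_norm2 : continuous (@norm2 R).
Proof.
rewrite (_ : @norm2 R = fun x => x.1 * x.1 + x.2 * x.2) => [x|].
  by apply: cvgD; apply: cvgM; [exact: cvg_fst..|exact: cvg_snd|exact: cvg_snd].
by apply/funext => x; rewrite /norm2 !expr2.
Qed.

Lemma compact_box (p q u v : R) : compact (box p q u v).
Proof. by apply: compact_setX; exact: segment_compact. Qed.

Lemma compact_disk r : compact [set x : plane R | norm2 x <= r].
Proof.
apply: (subclosed_compact _ (@compact_box (- (1 + r)) (1 + r) (- (1 + r)) (1 + r))).
  rewrite (_ : mkset _ = @norm2 R @^-1` [set u | u <= r]); last by [].
  by apply: preimage_closed; [by move=> x _; exact: continuous_norm2|exact: closed_le].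
by move=> x /=; exact: norm2_box.
Qed.

(** Stretched disks stick out of the unit disk, so the caps have to stay disjoint in a slightly
    larger one. By compactness the smaller of the two absolute values has a maximum below 1 on the
    disk, which leaves room for scaling by [sqrt (1 + r)]. *)
Lemma disjoint_caps_margin a b :
  (forall x, norm2 x <= 1 -> 1 <= `|dot a x| -> 1 <= `|dot b x| -> False) ->
  exists2 r, 0 < r & forall x, norm2 x <= 1 + r -> 1 < `|dot a x| -> 1 < `|dot b x| -> False.
Proof.
move=> H; pose f x := Num.min `|dot a x| `|dot b x|.
have cf : continuous f.
  move=> x; apply: (@continuous_min _ _ (fun y => `|dot a y|) (fun y => `|dot b y|));
    apply: (@continuous_comp _ _ _ (dot _) Num.norm).
  - exact: continuous_dot.
  - exact: norm_continuous.
  - exact: continuous_dot.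
  - exact: norm_continuous.
have [|x xD xmax] := @compact_EVT_max _ R f _ _ (@compact_disk 1) (continuous_subspaceT cf).
  by exists 0; rewrite /= /norm2 /= expr0n addr0.
rewrite inE /= in xD; have fx1 : f x < 1.
  by rewrite ltNge /f le_min; apply/negP => /andP[]; exact: H.
have fx0 : 0 <= f x by rewrite /f le_min !normr_ge0.
have [r [r0 rf]] : exists r, 0 < r /\ (1 + r) * f x ^+ 2 <= 1.
  (* With [u = f x ^+ 2] this choice gives [(1 + r) u = 1 - (1 - u)^2]. *)
  exists (1 - f x ^+ 2); split; first by rewrite subr_gt0 expr_lt1.
  by have := sqr_ge0 (1 - f x ^+ 2); lra.
exists r => // y ny ay by'.
have k0 : 0 < Num.sqrt (1 + r) by rewrite sqrtr_gt0; lra.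
set k := Num.sqrt (1 + r) in k0.
have kk : k ^+ 2 = 1 + r by rewrite sqr_sqrtr//; lra.
pose w : plane R := (y.1 / k, y.2 / k).
have nw : norm2 w <= 1.
  by rewrite /norm2 /= !expr_div_n -mulrDl kk ler_pdivrMr ?mul1r//; lra.
have dw c : dot c y = k * dot c w by rewrite /dot /=; field; rewrite gt_eqF.
have := xmax w; rewrite inE /= => /(_ nw); rewrite {1}/f => le_f.
have : 1 < k * f x.
  apply: (@lt_le_trans _ _ (k * Num.min `|dot a w| `|dot b w|)); last by rewrite ler_pM2l.
  move: ay by'; rewrite !dw !normrM (gtr0_norm k0) => ? ?.
  by rewrite minEle; case: ifP.
move=> h; have : 1 < (k * f x) ^+ 2 by rewrite exprn_egt1// ltW.
by rewrite exprMn kk ltNge rf.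
Qed.

End barrier.

(** * Incompatibility of the two derivative conditions *)

Section strict_gap.
Variable R : realType.
Implicit Types (a b c x y : plane R) (p q u v z s t : R) (X K S : set (plane R)).

(* A strip [|dot a x| <= 1] meets the unit circle along the chords at distance
   [chord_dist a] from the origin, of half-length [chord_half a]. *)
Definition chord_dist a : R := (Num.sqrt (norm2 a))^-1.
Definition chord_half a : R := Num.sqrt (1 - (norm2 a)^-1).
(** The cosine of twice the angle between [a] and the first axis; twice this number is the
    logarithmic derivative of [qform a] at 0. *)
Definition anisotropy a : R := (a.1 ^+ 2 - a.2 ^+ 2) / norm2 a.

Lemma chord_facts a : 1 < norm2 a -> [/\ 0 < chord_dist a, 0 < chord_half a,
  chord_half a ^+ 2 + chord_dist a ^+ 2 = 1 & norm2 a = chord_dist a ^- 2].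
Proof.
move=> na; have n0 : 0 < norm2 a by apply: lt_trans na.
have d2 : chord_dist a ^+ 2 = (norm2 a)^-1.
  by rewrite /chord_dist exprVn sqr_sqrtr// ltW.
split.
- by rewrite invr_gt0 sqrtr_gt0.
- by rewrite sqrtr_gt0 subr_gt0 invf_lt1.
- by rewrite d2 sqr_sqrtr ?subrK// subr_ge0 invf_le1// ltW.
- by rewrite d2 invrK.
Qed.

Lemma anisotropy_le1 a : 1 < norm2 a -> `|anisotropy a| <= 1.
Proof.
move=> na; have n0 : 0 < norm2 a by apply: lt_trans na.
rewrite normrM normfV (gtr0_norm n0) ler_pdivrMr// mul1r ler_norml /norm2.
by have := sqr_ge0 a.1; have := sqr_ge0 a.2; lra.
Qed.

(** If every [2 s_i^2] is at most [1 - g/2], every bracket in the second sum is at least [g/2] and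
    the sum is too large. Otherwise one index [i0] may have a negative bracket. The first sum makes
    the others carry nearly as much weighted [|x|], and their brackets compensate because
    [1/a + 1/b >= 2 + g] when [a + b = 2 - g]. *)
Lemma sum_contradiction (T : eqType) (l : seq T) (s d x : T -> R) (g r e h : R) :
  uniq l -> 0 < g -> g <= 2^-1 -> 0 < r ->
  (forall i, i \in l -> [/\ 0 < s i, r <= d i, s i ^+ 2 + d i ^+ 2 = 1 & `|x i| <= 1]) ->
  (forall i j, i \in l -> j \in l -> i != j -> s i ^+ 2 + s j ^+ 2 <= 1 - g / 2) ->
  h <= \sum_(i <- l) 4 * s i ->
  `|\sum_(i <- l) 2 * s i * d i * x i| <= e / 2 ->
  \sum_(i <- l) 2 * s i * d i * (1 - 2 * x i ^+ 2 + x i ^+ 2 / (2 * s i ^+ 2)) <= e / 2 ->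
  e < g * r * h / 2 -> e < r * g -> False.
Proof.
move=> ul g0 g1 r0 H pairs hl fst_le snd_le e1 e2.
have e0 : 0 <= e / 2 by exact: le_trans (normr_ge0 _) fst_le.
have w_ge0 i : i \in l -> 0 <= 2 * s i * d i.
  by move=> /H[s0 rd _ _]; rewrite !mulr_ge0 ?ltW// (lt_le_trans r0).
have A_ge i (b : R) : i \in l -> 2 * s i ^+ 2 <= b ->
    1 - 2 * x i ^+ 2 + x i ^+ 2 / b <= 1 - 2 * x i ^+ 2 + x i ^+ 2 / (2 * s i ^+ 2).
  move=> /H[s0 _ _ _] sb; rewrite lerD2l ler_wpM2l ?sqr_ge0//.
  have p0 : 0 < 2 * s i ^+ 2 by rewrite mulr_gt0// exprn_gt0.
  by rewrite lef_pV2 ?posrE// (lt_le_trans p0).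
have x2 i : i \in l -> 0 <= x i ^+ 2 /\ x i ^+ 2 <= 1.
  move=> /H[_ _ _ xi]; split; first exact: sqr_ge0.
  by rewrite -[x i ^+ 2]real_normK ?num_real// expr_le1.
have [all_small|] := pselect (forall i, i \in l -> 2 * s i ^+ 2 <= 1 - g / 2).
  have : \sum_(i <- l) (2 * s i * d i) * (g / 2) <= e / 2.
    apply: le_trans snd_le; rewrite big_seq [leRHS]big_seq; apply: ler_sum => i il.
    rewrite ler_wpM2l ?w_ge0//; apply: le_trans (A_ge i _ il (all_small i il)).
    have b0 : 0 < 1 - g / 2 by lra.
    have -> : (1 - 2 * x i ^+ 2 + x i ^+ 2 / (1 - g / 2)) =
      (1 - x i ^+ 2) + x i ^+ 2 * (g / 2) / (1 - g / 2) by field; rewrite gt_eqF//; lra.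
    have [x0 x1] := x2 i il.
    have : x i ^+ 2 * (g / 2) <= x i ^+ 2 * (g / 2) / (1 - g / 2).
      apply: ler_peMr; first by rewrite mulr_ge0// divr_ge0// ltW.
      by rewrite invf_ge1//; lra.
    by move: (_ / (1 - g / 2)) => t; nra.
  have : h * (r * (g / 4)) <= \sum_(i <- l) (2 * s i * d i) * (g / 2).
    apply: (@le_trans _ _ ((\sum_(i <- l) 4 * s i) * (r * (g / 4)))).
      by rewrite ler_wpM2r// !mulr_ge0 ?divr_ge0// ltW.
    rewrite big_distrl /= big_seq [leRHS]big_seq; apply: ler_sum => i il.
    have [s0 rd _ _] := H i il.
    have : 0 <= s i * g * (d i - r) by rewrite !mulr_ge0 ?subr_ge0// ltW.
    lra.
  lra.
(* The exceptional cap: by the pair condition all others have [2 s^2] at most [2 - a - g]. *)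
move=> /existsNP[i0 /not_implyP[i0l /negP]]; rewrite -ltNge => a_gt.
have [s0 rd sd xi] := H i0 i0l.
set a := 2 * s i0 ^+ 2 in a_gt.
have d0 : 0 < d i0 by apply: lt_le_trans rd.
have a2 : a < 2 by rewrite /a; have : 0 < d i0 ^+ 2 by [exact: exprn_gt0]; lra.
have a0 : 0 < a by lra.
(* The lower bound 1/2 ensures [b^-1 <= 2]; the estimate of [F2] by [F1] and the absorption of the
   error [e / 2] both rely on it. *)
pose b := Num.max 2^-1 (2 - a - g).
have b_ge : 2^-1 <= b by rewrite le_max lexx.
have b0 : 0 < b by lra.
have b1 : b <= 1 by rewrite ge_max; apply/andP; split; lra.
have Vb2 : b^-1 <= 2 by rewrite invf_ple ?posrE//.
have Vb1 : 1 <= b^-1 by rewrite invf_ge1.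
have s_ge : 2^-1 <= s i0.
  rewrite leNgt; apply/negP => sl; have : s i0 ^+ 2 < 2^-1 ^+ 2 by nra.
  by move: a_gt; rewrite /a; lra.
have w0 : r <= 2 * s i0 * d i0 by nra.
rewrite (bigD1_seq i0)//= in fst_le; rewrite (bigD1_seq i0)//= in snd_le.
set F1 := \sum_(_ <- _ | _) _ in fst_le; set F2 := \sum_(_ <- _ | _) _ in snd_le.
have F12 : (b^-1 - 1) * `|F1| <= F2.
  apply: (@le_trans _ _ (\sum_(i <- l | i != i0) (b^-1 - 1) * (2 * s i * d i * `|x i|))).
    rewrite -big_distrr /= ler_wpM2l ?subr_ge0//.
    apply: le_trans (ler_norm_sum _ _ _) _.
    rewrite [leLHS]big_seq_cond [leRHS]big_seq_cond; apply: (@ler_sum R _ l) => i /andP[il _].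
    by rewrite normrM (ger0_norm (w_ge0 i il)).
  rewrite /F2 [leLHS]big_seq_cond [leRHS]big_seq_cond; apply: ler_sum => i /andP[il ii0].
  rewrite mulrCA ler_wpM2l ?w_ge0//.
  have sb : 2 * s i ^+ 2 <= b.
    rewrite le_max; apply/orP; right; have := pairs i i0 il i0l ii0; rewrite /a; lra.
  apply: le_trans (A_ge i b il sb).
  have [_ _ _ xl] := H i il.
  rewrite -[x i ^+ 2]real_normK ?num_real//.
  move: `|x i| (normr_ge0 (x i)) xl => z z0 z1.
  (* The product is the difference of the two sides. *)
  have : 0 <= (1 - z) * (1 + z * (2 - b^-1)).
    by rewrite mulr_ge0 ?subr_ge0// addr_ge0// mulr_ge0// subr_ge0.
  lra.
have ab : g <= a^-1 + b^-1 - 2.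
  have Va : 2^-1 <= a^-1 by rewrite lef_pV2 ?posrE// ltW.
  have [bE|bE] : b = 2^-1 \/ b = 2 - a - g.
    by rewrite /b; case: leP => _; [right|left].
  - rewrite bE invrK; lra.
  - have -> : a^-1 + b^-1 = (2 - g) / (a * b) by rewrite bE; field; rewrite -bE !gt_eqF.
    rewrite lerBrDr ler_pdivlMr ?mulr_gt0//.
    have : a * b <= (1 - g / 2) ^+ 2.
      by rewrite bE; have := sqr_ge0 (a - (1 - g / 2)); lra.
    move: (a * b) => t; nra.
have A0 : `|x i0| * (a^-1 - 1) + (1 - `|x i0|) <=
    1 - 2 * x i0 ^+ 2 + x i0 ^+ 2 / (2 * s i0 ^+ 2).
  rewrite -/a -[x i0 ^+ 2]real_normK ?num_real//.
  have Va : a^-1 <= 2 by rewrite invf_ple ?posrE//; lra.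
  move: `|x i0| (normr_ge0 (x i0)) xi => z z0 z1.
  have : 0 <= (1 - z) * (z * (2 - a^-1)).
    by rewrite mulr_ge0 ?subr_ge0// mulr_ge0// subr_ge0.
  lra.
have wpos : 0 <= 2 * s i0 * d i0 by lra.
have F1_ge : 2 * s i0 * d i0 * `|x i0| - e / 2 <= `|F1|.
  rewrite lerBlDr -lerBlDl; apply: le_trans fst_le.
  rewrite -[X in X - _](ger0_norm (mulr_ge0 wpos (normr_ge0 _))) normrM normr_id -normrM.
  by apply: le_trans (lerB_normD _ _) _.
have : 2 * s i0 * d i0 * (`|x i0| * (a^-1 - 1) + (1 - `|x i0|)) + F2 <= e / 2.
  by apply: le_trans snd_le; rewrite lerD2r ler_wpM2l.
move: F12 F1_ge; move: `|F1| (normr_ge0 F1) (2 * s i0 * d i0) w0 wpos => f1 f10 w w0 wpos F12 F1_ge tot.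
move: `|x i0| (normr_ge0 (x i0)) xi F1_ge tot {fst_le snd_le A0} => z z0 z1 F1_ge tot.
have h1 : (b^-1 - 1) * (w * z - e / 2) <= F2.
  by apply: le_trans F12; rewrite ler_wpM2l// subr_ge0.
have h2 : (b^-1 - 1) * (e / 2) <= e / 2 by rewrite ler_piMl//; lra.
have h3 : w * z * g <= w * z * (a^-1 + b^-1 - 2) by rewrite ler_wpM2l// mulr_ge0.
have h4 : w * (1 - z) * g <= w * (1 - z) by rewrite ler_piMr ?mulr_ge0 ?subr_ge0//; lra.
have h5 : r * g <= w * g by rewrite ler_wpM2r// ltW.
lra.
Qed.

End strict_gap.

(** * A quantitative gap between disjoint caps *)

Section local.
Variable R : realType.
Implicit Types (a b c x y : plane R) (p q u v z s t : R) (X K S : set (plane R)).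

Lemma dcap0E a : 1 < norm2 a ->
  dcap a 0 = 2 * chord_half a * chord_dist a * anisotropy a.
Proof.
move=> na; have [d0 s0 sd nE] := chord_facts na.
have rE : Num.sqrt (norm2 a - 1) = chord_half a / chord_dist a.
  have -> : norm2 a - 1 = (chord_half a / chord_dist a) ^+ 2.
    rewrite nE expr_div_n (_ : chord_half a ^+ 2 = 1 - chord_dist a ^+ 2); last lra.
    by field; rewrite gt_eqF.
  by rewrite sqrtr_sqr ger0_norm// divr_ge0// ltW.
rewrite /dcap /qform /dqform mulr0 oppr0 expR0 !mul1r -/(norm2 a) rE /anisotropy nE.
by field; rewrite gt_eqF.
Qed.

Lemma ddcap0E a : 1 < norm2 a -> is_derive (0 : R) 1 (dcap a)
  (2 * (2 * chord_half a * chord_dist a *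
    (1 - 2 * anisotropy a ^+ 2 + anisotropy a ^+ 2 / (2 * chord_half a ^+ 2)))).
Proof.
move=> na; have [d0 s0 sd nE] := chord_facts na.
have rE : Num.sqrt (norm2 a - 1) = chord_half a / chord_dist a.
  have -> : norm2 a - 1 = (chord_half a / chord_dist a) ^+ 2.
    rewrite nE expr_div_n (_ : chord_half a ^+ 2 = 1 - chord_dist a ^+ 2); last lra.
    by field; rewrite gt_eqF.
  by rewrite sqrtr_sqr ger0_norm// divr_ge0// ltW.
have := is_derive_dcap na => /= h; apply: (is_derive_eq h).
rewrite rE /anisotropy nE.
by field; rewrite !gt_eqF.
Qed.

(** In the frame of [a] the set lies in a box of sides [2 * chord_dist a] and [2 * r]. It serves to
    bound [chord_dist a] from below by the area of [S]. *)
Lemma strip_area S a (r : R) : bmeas S -> 1 < norm2 a -> 0 < r ->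
  (forall x, S x -> `|dot a x| <= 1 /\ norm2 x <= r ^+ 2) ->
  ar S <= 4 * r * chord_dist a.
Proof.
move=> bS na r0 HS; have [d0 s0 sd nE] := chord_facts na; set d := chord_dist a in d0 sd nE *.
pose e : plane R := (d * a.1, d * a.2).
have ne : norm2 e = 1.
  have -> : norm2 e = d ^+ 2 * norm2 a by rewrite /norm2 /=; ring.
  by rewrite nE divff// expf_neq0// gt_eqF.
have dete : `|e.1 * e.1 - e.2 * - e.2| = 1.
  by rewrite -[RHS]normr1 -ne; congr `|_|; rewrite /norm2; ring.
have -> : 4 * r * d = ar (lin e.1 e.2 (- e.2) e.1 @^-1` box (- d) d (- r) r).
  by rewrite (ar_lin1 dete (bmeas_box _ _ _ _)) ar_box; [ring|lra|lra].
apply: ar_le; [by case: bS| |].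
  by apply: bmeas_lin (bmeas_box _ _ _ _); rewrite -normr_eq0 dete oner_neq0.
move=> x /HS[ax nx]; apply/boxP; split; rewrite -ler_norml.
  rewrite (_ : (lin _ _ _ _ x).1 = d * dot a x); last by rewrite /dot /lin /e /=; ring.
  by rewrite normrM gtr0_norm// ler_piMr// ltW.
apply: le_of_sqr; first exact: ltW.
rewrite real_normK ?num_real//; apply: le_trans nx.
by rewrite -(norm2_turn x ne) /norm2 /turn lerDr sqr_ge0.
Qed.

(** [c] and [o] are the cosine and sine of the angle between the normals of two strips. For small
    [c] the area inequality, the one with [h], gives the gap. Otherwise the corner inequality
    [d * c + s * o < d'] does, because [d * c] is at least twice the loss [s * (1 - o)]. *)
Lemma chord_gap_real (d s d' c o h r : R) : 0 < d -> 0 < s -> s ^+ 2 + d ^+ 2 = 1 ->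
  0 <= c -> 0 < o -> c ^+ 2 + o ^+ 2 = 1 -> c < d -> d * c + s * o < d' ->
  (h + 4 * d * s) * o <= 4 * d * d' -> 0 < h -> 0 < r -> r <= d -> 2^-1 <= s ->
  h * r / 32 <= d' - s.
Proof.
move=> d0 s0 sd c0 o0 co cd H1 H2 h0 r0 rd sh.
have d1 : d < 1 by rewrite ltNge; apply/negP; nra.
have s1 : s < 1 by rewrite ltNge; apply/negP; nra.
have o1 : o <= 1 by rewrite leNgt; apply/negP; nra.
have so : s < o by rewrite ltNge; apply/negP; nra.
have o2 : 1 - o <= c ^+ 2 by nra.
have [ch|hc] := leP c (h / 16).
  have h1 : o * h + 4 * s * o <= 4 * d'.
    rewrite -(ler_pM2l d0); apply: le_trans (_ : (h + 4 * d * s) * o <= _); last by lra.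
    have : 0 <= o * h * (1 - d) by rewrite !mulr_ge0 ?subr_ge0// ltW.
    lra.
  have h2 : h / 2 <= o * h by nra.
  have h3 : s * (1 - o) <= c.
    apply: (@le_trans _ _ (1 - o)); first by rewrite ler_piMl ?subr_ge0// ltW.
    by apply: le_trans o2 _; nra.
  have h4 : h * r <= h by rewrite ler_piMr ?ltW//; lra.
  lra.
have h1 : d * c / 2 <= d * c - s * (1 - o).
  have h2 : (1 + o) * (1 - o) = c ^+ 2 by lra.
  have h3 : s * c ^+ 2 <= s * (d * c) by rewrite ler_wpM2l ?ltW//; nra.
  rewrite -(@ler_pM2l _ (1 + o)); last by lra.
  have -> : (1 + o) * (d * c - s * (1 - o)) = (1 + o) * (d * c) - s * c ^+ 2.
    by rewrite -h2; ring.
  have : 0 <= d * c * (1 - o) by rewrite !mulr_ge0 ?subr_ge0// ltW.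
  have : 0 <= d * c * (o - s) by rewrite !mulr_ge0 ?subr_ge0// ltW.
  lra.
have : r * (h / 16) <= d * c by apply: ler_pM => //; lra.
lra.
Qed.

(** The rectangle [T] spanned by the two chords of [a] has its corners in caps of [a], hence inside
    the strip of [b]. So [T], which lies in the disk, and [S], which lies outside, are disjoint
    subsets of the parallelogram [Q] cut out by both strips, and their areas add up to at most that
    of [Q]. *)
Lemma opposite_caps_gap S a b (h r : R) : bmeas S -> 1 < norm2 a -> 1 < norm2 b ->
  (forall x, norm2 x <= 1 -> 1 <= `|dot a x| -> 1 <= `|dot b x| -> False) ->
  (forall x, S x -> [/\ 1 < norm2 x, `|dot a x| <= 1 & `|dot b x| <= 1]) ->
  0 < h -> h <= ar S -> 0 < r -> r <= chord_dist a ->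
  2^-1 <= chord_half a -> h * r / 32 <= chord_dist b - chord_half a.
Proof.
move=> bS na nb disj HS h0 hS r0 rd sh.
have [d0 s0 sd nE] := chord_facts na; have [d0' s0' sd' nE'] := chord_facts nb.
set d := chord_dist a in d0 sd nE rd *; set d' := chord_dist b in d0' sd' nE' *.
set s := chord_half a in s0 sd sh *.
pose e : plane R := (d * a.1, d * a.2).
have ne : norm2 e = 1.
  have -> : norm2 e = d ^+ 2 * norm2 a by rewrite /norm2 /=; ring.
  by rewrite nE divff// expf_neq0// gt_eqF.
have ne12 : e.1 ^+ 2 + e.2 ^+ 2 = 1 by [].
have aE1 : a.1 = d^-1 * e.1 by rewrite /=; field; rewrite gt_eqF.
have aE2 : a.2 = d^-1 * e.2 by rewrite /=; field; rewrite gt_eqF.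
have dote x : dot a x = d^-1 * (e.1 * x.1 + e.2 * x.2) by rewrite /dot aE1 aE2; ring.
move: (e) ne ne12 aE1 aE2 dote => {e} e ne ne12 aE1 aE2 dote.
pose b1 := e.1 * b.1 + e.2 * b.2; pose b2 := e.1 * b.2 - e.2 * b.1.
have bE x : dot b x = b1 * (e.1 * x.1 + e.2 * x.2) + b2 * (- e.2 * x.1 + e.1 * x.2).
  by rewrite /b1 /b2 /dot -[LHS]mulr1 -ne12; ring.
have nbE : norm2 b = b1 ^+ 2 + b2 ^+ 2.
  by rewrite /b1 /b2 /norm2 -[LHS]mulr1 -ne12; ring.
(* The unit vector along [b] lies in a cap of [b], hence in none of [a]. *)
have H1 : `|b1| * d' < d.
  have := disj (d' * b.1, d' * b.2).
  have -> : norm2 (d' * b.1, d' * b.2) = d' ^+ 2 * norm2 b by rewrite /norm2 /=; ring.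
  rewrite {1}nE' divff ?expf_neq0 ?gt_eqF// => /(_ (lexx _)) H.
  rewrite ltNge; apply/negP => hb; apply: H.
    rewrite dote /= (_ : e.1 * _ + _ = b1 * d'); last by rewrite /b1; ring.
    rewrite !normrM normfV (gtr0_norm d0) (gtr0_norm d0').
    by rewrite ler_pdivlMl// mulr1.
  rewrite (_ : dot b _ = d' * norm2 b); last by rewrite /dot /norm2 /=; ring.
  rewrite nE' (_ : d' * d' ^- 2 = d'^-1); last by field; rewrite gt_eqF.
  by rewrite normfV (gtr0_norm d0') invf_ge1//; nra.
(* For [k = 1] and [k = -1] these are the endpoints of a chord of [a], which no cap of [b]
   contains. *)
have corner (k : R) : k ^+ 2 = 1 -> `|b1 * d + b2 * (k * s)| < 1.
  move=> k2; pose x : plane R := (d * e.1 - k * s * e.2, d * e.2 + k * s * e.1).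
  have x1 : e.1 * x.1 + e.2 * x.2 = d by rewrite /x /= -[RHS]mulr1 -ne12; ring.
  have x2 : - e.2 * x.1 + e.1 * x.2 = k * s by rewrite /x /= -[RHS]mulr1 -ne12; ring.
  have nx : norm2 x = 1.
    have -> : norm2 x = (d ^+ 2 + k ^+ 2 * s ^+ 2) * (e.1 ^+ 2 + e.2 ^+ 2).
      by rewrite /norm2 /x /=; ring.
    by rewrite ne12 k2 mul1r mulr1 addrC.
  have := disj x; rewrite nx => /(_ (lexx _)).
  rewrite dote bE x1 x2 mulVf ?gt_eqF// normr1 => /(_ (lexx _)) H.
  by rewrite ltNge; apply/negP.
have H2 : `|b1| * d + `|b2| * s < 1.
  have := corner 1 (expr1n _ _); have := corner (-1) (sqrr_sign _ 1).
  rewrite !ltr_norml => /andP[? ?] /andP[? ?].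
  by case: (ger0P b1) => ?; case: (ger0P b2) => ?; lra.
have b2_neq0 : b2 != 0.
  apply/eqP => b20; move: nbE; rewrite b20 expr0n addr0 nE' => E.
  have d2 : (`|b1| * d') ^+ 2 = 1.
    rewrite exprMn real_normK ?num_real// -E mulVf// expf_neq0// gt_eqF//.
  have : d < 1 by rewrite ltNge; apply/negP; nra.
  have : 0 <= `|b1| * d' by rewrite mulr_ge0// ltW.
  by move: (`|b1| * d') d2 H1 => y; nra.
have b2_gt0 : 0 < `|b2| by rewrite normr_gt0.
have detE : a.1 * b.2 - a.2 * b.1 = d^-1 * b2 by rewrite aE1 aE2 /b2; ring.
have det0 : a.1 * b.2 - a.2 * b.1 != 0 by rewrite detE mulf_neq0// invr_neq0// gt_eqF.
have dete : `|e.1 * e.1 - e.2 * - e.2| = 1.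
  by rewrite -[RHS]normr1 -ne; congr `|_|; rewrite /norm2; ring.
have dete0 : e.1 * e.1 - e.2 * - e.2 != 0 by rewrite -normr_eq0 dete oner_neq0.
pose Q := lin a.1 a.2 b.1 b.2 @^-1` box (-1) 1 (-1) 1.
pose T := lin e.1 e.2 (- e.2) e.1 @^-1` box (- d) d (- s) s.
have bQ : bmeas Q by exact: bmeas_lin (bmeas_box _ _ _ _).
have bT : bmeas T by exact: bmeas_lin (bmeas_box _ _ _ _).
have arQ : ar Q = 4 * d / `|b2|.
  rewrite (ar_lin det0 (bmeas_box _ _ _ _)) ar_box ?detE; [|lra|lra].
  rewrite normrM normfV (gtr0_norm d0); field.
  by rewrite !gt_eqF.
have arT : ar T = 4 * d * s.
  by rewrite (ar_lin1 dete (bmeas_box _ _ _ _)) ar_box; [ring|lra|lra].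
have Tn x : T x -> `|e.1 * x.1 + e.2 * x.2| <= d /\ `|- e.2 * x.1 + e.1 * x.2| <= s.
  by move=> /boxP; rewrite /lin /= !ler_norml.
have ST : S `&` T = set0.
  apply/seteqP; split => // x [/HS[nx _ _] /Tn[t1 t2]].
  move: nx; rewrite ltNge => /negP; apply.
  have -> : norm2 x = (e.1 * x.1 + e.2 * x.2) ^+ 2 + (- e.2 * x.1 + e.1 * x.2) ^+ 2.
    by rewrite /norm2 -[LHS]mulr1 -ne12; ring.
  have p1 : (e.1 * x.1 + e.2 * x.2) ^+ 2 <= d ^+ 2.
    by apply: sqr_le_norm.
  have p2 : (- e.2 * x.1 + e.1 * x.2) ^+ 2 <= s ^+ 2.
    by apply: sqr_le_norm.
  by clear -p1 p2 sd; lra.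
have STQ : S `|` T `<=` Q.
  move=> x [/HS[_ ax bx]|/Tn[t1 t2]].
    by apply/boxP; rewrite /lin /= -!/(dot _ _) -!ler_norml.
  apply/boxP; rewrite /lin /= -/(dot a x) -/(dot b x) -!ler_norml; split.
    by rewrite dote normrM normfV (gtr0_norm d0) ler_pdivrMl// mulr1.
  rewrite bE; apply: le_trans (ler_normD _ _) _; rewrite !normrM.
  apply: le_trans (_ : `|b1| * d + `|b2| * s <= _); last exact: ltW.
  by apply: lerD; rewrite ler_wpM2l.
have H3 : h + 4 * d * s <= 4 * d / `|b2|.
  rewrite -arQ -arT; apply: le_trans (_ : ar S + ar T <= _); first by rewrite lerD2r.
  by rewrite -arU//; apply: ar_le => //; case: (bmeasU bS bT).
apply: (@chord_gap_real d s d' (`|b1| * d') (`|b2| * d')) => //.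
- by rewrite mulr_ge0// ltW.
- by rewrite mulr_gt0.
- rewrite !exprMn !real_normK ?num_real// -mulrDl -nbE nE' mulVf// expf_neq0//.
  by rewrite gt_eqF.
- rewrite [ltLHS](_ : _ = (`|b1| * d + `|b2| * s) * d'); last by ring.
  by rewrite gtr_pMl.
- move: H3; rewrite ler_pdivlMr// => H3.
  by have := ler_wpM2r (ltW d0') H3; clear; lra.
Qed.

End local.

(** * Excluding approximate minima along the stretch *)

Section slow_minimum.
Variable R : realType.
Implicit Types (a b c x y : plane R) (p q u v z s t : R) (X K S : set (plane R)).

Lemma stretched_disk0 : stretched_disk 0 = @unit_disk R.
Proof. by apply/seteqP; split => x; rewrite /stretched_disk /= oppr0 stretch0. Qed.

Lemma qform0 a : qform a 0 = norm2 a.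
Proof. by rewrite /qform mulr0 oppr0 expR0 !mul1r. Qed.

Lemma qform_gt1_near a : 1 < norm2 a ->
  exists2 r : R, 0 < r & forall s, `|s| < r -> 1 < qform a s.
Proof.
move=> na; have n0 : 0 < norm2 a by apply: lt_trans na.
exists (ln (norm2 a) / 2); first by rewrite divr_gt0// ln_gt0.
move=> s; rewrite ltr_norml => /andP[s1 s2].
have E t : `|t| < ln (norm2 a) -> (norm2 a)^-1 < expR t.
  by rewrite ltr_norml => /andP[t1 _]; rewrite -[X in X^-1]lnK ?posrE// -expRN ltr_expR.
have h1 : (norm2 a)^-1 < expR (2 * s) by apply: E; rewrite ltr_norml; apply/andP; split; lra.
have h2 : (norm2 a)^-1 < expR (- (2 * s)) by apply: E; rewrite ltr_norml; apply/andP; split; lra.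
rewrite /qform -[ltLHS](mulVf (lt0r_neq0 n0)).
have [a10|a10] := eqVneq a.1 0.
  rewrite {2}/norm2 a10 expr0n mulr0 !add0r ltr_pM2r//.
  by move: n0; rewrite /norm2 a10 expr0n add0r.
have : (norm2 a)^-1 * a.1 ^+ 2 < expR (2 * s) * a.1 ^+ 2.
  by rewrite ltr_pM2r// exprn_even_gt0.
have : (norm2 a)^-1 * a.2 ^+ 2 <= expR (- (2 * s)) * a.2 ^+ 2.
  by rewrite ler_wpM2r ?sqr_ge0// ltW.
rewrite {4}/norm2; lra.
Qed.

Lemma halfcap_le_chord a : 1 < norm2 a ->
  halfcap (Num.sqrt (norm2 a))^-1 <= 2 * chord_half a.
Proof.
move=> na; have [d0 s0 sd nE] := chord_facts na.
apply: le_trans (halfcap_le d0 _) _; first by nra.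
by rewrite /chord_half nE invrK.
Qed.

Lemma ar_polygonD X (l : seq (plane R)) : bmeas X ->
  ar (X `&` polygon l) = ar X - ar (X `\` polygon l).
Proof. by move=> bX; rewrite (ar_split bX (plane_measurable_polygon l)); ring. Qed.

(* The stretches preserve area; the overlap of the disk with a polygon cannot have an
   approximate local minimum along them at [s = 0]. *)
Lemma no_slow_minimum (h1 h2 r : R) : 0 < h1 -> 0 < h2 -> 0 < r ->
  exists2 e : R, 0 < e & forall (l : seq (plane R)) p S (f : R), 0 < f -> bmeas S ->
    h2 <= ar S -> (forall x, S x -> [/\ polygon l x, 1 < norm2 x & norm2 x <= r ^+ 2]) ->
    h1 <= ar (@unit_disk R `\` polygon l) -> `|p| <= e ->
    (forall s, `|s| < f -> p * s - e * s ^+ 2 <=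
       ar (stretched_disk s `&` polygon l) - ar (@unit_disk R `&` polygon l)) -> False.
Proof.
(* [d] will bound every chord distance from below, by [strip_area] for [S]; [g] is the gap that
   [opposite_caps_gap] then yields, cut at 1/2 as [sum_contradiction] demands. *)
move=> h10 h20 r0; pose d := h2 / (4 * r); pose g := Num.min 2^-1 (h2 * d / 32).
have d0 : 0 < d by rewrite divr_gt0// mulr_gt0.
have g0 : 0 < g by rewrite lt_min invr_gt0 ltr0n divr_gt0// mulr_gt0.
have m10 : 0 < Num.min 1 h1 by rewrite lt_min ltr01.
have gdm : 0 < g * d * Num.min 1 h1 by rewrite mulr_gt0// mulr_gt0.
(* The factor 1/4 makes both upper bounds on [e] in [sum_contradiction] strict. *)
exists (g * d * Num.min 1 h1 / 4); first by rewrite divr_gt0.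
set e := _ / 4 => l p S f f0 bS hS HS hD pe Hmin.
have S0 : S !=set0.
  apply/set0P/eqP => SE; move: hS; rewrite SE ar_set0 leNgt.
  by rewrite h20.
have [x0 /HS[lx0 nx0 _]] := S0.
have [L [uL nL C1 C2 C3]] := disjoint_caps lx0 nx0.
have SL x : S x -> polygon L x by move=> /HS[lx nx _]; exact: C2.
have [m m0 margin] : exists2 m, 0 < m & forall ab, ab \in [seq (a, b) | a <- L, b <- L] ->
    ab.1 != ab.2 -> forall x, norm2 x <= 1 + m -> 1 < `|dot ab.1 x| -> 1 < `|dot ab.2 x| -> False.
  apply: finite_radius => [[a b] m m' H m'0 m'm ab x nx|[a b] /allpairsP[[a' b'] /= [aL bL [-> ->]]]].
    by apply: H => //; apply: le_trans nx _; rewrite lerD2l.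
  have [->|ab] := eqVneq a' b'; first by exists 1.
  have [m m0 Hm] := disjoint_caps_margin (fun x => C3 a' b' x aL bL ab).
  by exists m.
have [q q0 Hq] : exists2 q : R, 0 < q & forall a, a \in L -> forall s, `|s| < q -> 1 < qform a s.
  apply: finite_radius => [a q q' H q'0 q'q s sq|a aL]; first by apply: H; exact: lt_le_trans q'q.
  exact: qform_gt1_near (nL _ aL).
(* Below [w] the assumed inequality applies, every edge still cuts the stretched disk, and the caps
   are still disjoint in it. *)
pose w := Num.min f (Num.min q (ln (1 + m) / 2)).
have lm0 : 0 < ln (1 + m) by rewrite ln_gt0// ltrDl.
have w0 : 0 < w by rewrite !lt_min f0 q0 divr_gt0.
have ws s : `|s| < w -> [/\ `|s| < f, `|s| < q & expR (2 * `|s|) <= 1 + m].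
  rewrite !lt_min => /and3P[sf sq sm]; split=> //.
  rewrite -[leRHS]lnK ?posrE; last by rewrite addr_gt0.
  by rewrite ler_expR; lra.
have disj s a b x : `|s| < w -> a \in L -> b \in L -> a != b -> stretched_disk s x ->
    1 < `|dot a x| -> 1 < `|dot b x| -> False.
  move=> /ws[_ _ sm] aL bL ab sx ax bx; apply: (margin (a, b) _ _ x) => //.
    by apply/allpairsP; exists (a, b).
  exact: le_trans (norm2_stretched sx) sm.
have caps s : `|s| < w -> ar (stretched_disk s `\` polygon L) =
    \sum_(a <- L) 2 * halfcap (Num.sqrt (qform a s))^-1.
  move=> sw; have [_ sq _] := ws s sw.
  rewrite (ar_caps_sum (bmeas_stretched s) (@stretched_sym R s) uL).
    rewrite big_seq [RHS]big_seq; apply: eq_bigr => a aL.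
    by rewrite ar_stretched_cap// (lt_trans ltr01)// Hq.
  by move=> a b x aL bL ab; exact: disj.
have w00 : `|0 : R| < w by rewrite normr0.
have capsD := caps 0 w00; rewrite stretched_disk0 in capsD.
have [Sg SgE] : exists Sg : R -> R, Sg =
    fun s => \sum_(a <- L) 2 * halfcap (Num.sqrt (qform a s))^-1 by eexists.
have [D1 D1E] : exists D1 : R -> R, D1 = fun s => \sum_(a <- L) 2 * dcap a s by eexists.
have [D2 D2E] : exists D2 : R, D2 = \sum_(a <- L) 2 * (2 * (2 * chord_half a * chord_dist a *
    (1 - 2 * anisotropy a ^+ 2 + anisotropy a ^+ 2 / (2 * chord_half a ^+ 2)))) by eexists.
(* [Sg] is the area cut off by the merged polygon, so [G] is the gain in overlap minus the allowed
   parabola. Its minimum at 0 yields [D1 0 = - p] and [D2 <= 2 * e]. *)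
pose G s := Sg 0 - Sg s - (p * s - e * s ^+ 2).
pose G' s := - D1 s - (p - 2 * e * s).
have G0 : G 0 = 0 by rewrite /G subrr mulr0 expr0n /= mulr0 !subr0.
have Gge s : `|s| < w -> G 0 <= G s.
  move=> sw; have [sf _ _] := ws s sw; rewrite G0 subr_ge0.
  apply: le_trans (Hmin s sf) _.
  have := @bodies_swap R (stretched_disk s) (polygon l) (polygon L) (@unit_disk R)
    (bmeas_stretched s) (bmeas_disk _) (plane_measurable_polygon _) (plane_measurable_polygon _).
  move=> /(_ _ _)/le_trans; apply.
  - by move=> x; exact: C1.
  - by move=> x nD; apply: C2; rewrite ltNge; exact/negP.
  rewrite !ar_polygonD; [|exact: bmeas_disk|exact: bmeas_stretched].
  have cs := caps s sw; have cD := capsD.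
  rewrite -[RHS]/((fun s => \sum_(a <- L) 2 * halfcap (Num.sqrt (qform a s))^-1) s) -SgE in cs.
  rewrite -[RHS]/((fun s => \sum_(a <- L) 2 * halfcap (Num.sqrt (qform a s))^-1) 0) -SgE in cD.
  by rewrite ar_stretched cs cD le_eqVlt; apply/orP; left; apply/eqP; ring.
have dSg s : `|s| < w -> is_derive s 1 Sg (D1 s).
  move=> sw; have [_ sq _] := ws s sw; rewrite SgE D1E.
  apply: is_derive_sumseq => a aL.
  have dc := is_derive_cap (Hq a aL s sq).
  by apply: is_derive_eq; rewrite /GRing.scale /=; ring.
have dG s : `|s| < w -> is_derive s 1 G (G' s).
  move=> /dSg h; apply: is_derive_eq; rewrite /G' /GRing.scale /=; ring.
have dD1 : is_derive (0 : R) 1 D1 D2.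
  rewrite D1E D2E; apply: is_derive_sumseq => a aL.
  have dc := ddcap0E (nL a aL).
  by apply: is_derive_eq; rewrite /GRing.scale /=; ring.
have dG' : is_derive (0 : R) 1 G' (- D2 + 2 * e).
  apply: is_derive_eq; rewrite /GRing.scale /=; ring.
have [G'0 G''0] := second_order_min w0 dG dG' Gge.
have d_le a : a \in L -> d <= chord_dist a.
  move=> aL; rewrite /d ler_pdivrMr ?mulr_gt0// mulrC.
  apply: le_trans hS _; apply: strip_area => //; first exact: nL.
  by move=> x /[dup] /SL/(_ _ aL) ? /HS[].
apply: (@sum_contradiction R _ L (@chord_half R) (@chord_dist R) (@anisotropy R) g d e h1) => //.
- by rewrite /g ge_min lexx.
- move=> a aL; have [? ? ? _] := chord_facts (nL a aL).
  by split=> //; [exact: d_le|exact: anisotropy_le1 (nL a aL)].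
(* If one half chord, say [s_a], is at least 1/2, the gap gives [s_a^2 + s_b^2 = 1 - (d_b - s_a)
   (d_b + s_a) <= 1 - g]. If both are below 1/2 the sum is below 1/2. *)
- move=> a b aL bL ab.
  have [da sa sda _] := chord_facts (nL a aL); have [db sb sdb _] := chord_facts (nL b bL).
  have gh : g <= h2 * d / 32 by rewrite /g ge_min lexx orbT.
  have g2 : g <= 2^-1 by rewrite /g ge_min lexx.
  have [sa2|sa2] := leP 2^-1 (chord_half a).
    have : h2 * d / 32 <= chord_dist b - chord_half a.
      apply: (@opposite_caps_gap R S) => //; [exact: nL|exact: nL| | |exact: d_le].
        by move=> x; exact: C3.
      by move=> x Sx; split; [by case: (HS x Sx)|exact: (SL x Sx)..].
    nra.
  have [sb2|sb2] := leP 2^-1 (chord_half b).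
    have : h2 * d / 32 <= chord_dist a - chord_half b.
      apply: (@opposite_caps_gap R S) => //; [exact: nL|exact: nL| | |exact: d_le].
        by move=> x nx bx ax; exact: (C3 a b x).
      by move=> x Sx; split; [by case: (HS x Sx)|exact: (SL x Sx)..].
    nra.
  nra.
- apply: le_trans hD _; apply: (@le_trans _ _ (ar (@unit_disk R `\` polygon L))).
    apply: ar_le.
    + by apply: plane_measurableD; [exact: plane_measurable_disk|exact: plane_measurable_polygon].
    + by apply: bmeasD; [exact: bmeas_disk|exact: plane_measurable_polygon].
    + by move=> x [Dx nl]; split=> // Lx; apply: nl; exact: C1.
  rewrite capsD big_seq [leRHS]big_seq; apply: ler_sum => a aL.
  by rewrite qform0; have := halfcap_le_chord (nL a aL); lra.
- have E : 2 * (\sum_(a <- L) 2 * chord_half a * chord_dist a * anisotropy a) = D1 0.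
    rewrite D1E mulr_sumr big_seq [RHS]big_seq; apply: eq_bigr => a aL.
    by rewrite dcap0E// nL.
  move: (\sum_(a <- L) _) E G'0 => T E; rewrite /G' -E mulr0 subr0 => G'0.
  have -> : T = - p / 2 by lra.
  by rewrite normrM normrN normfV (ger0_norm (x := 2))// ler_wpM2r// invr_ge0.
- have E : D2 = 4 * (\sum_(a <- L) 2 * chord_half a * chord_dist a *
    (1 - 2 * anisotropy a ^+ 2 + anisotropy a ^+ 2 / (2 * chord_half a ^+ 2))).
    rewrite D2E mulr_sumr; apply: eq_bigr => a _; rewrite mulrA; congr (_ * _).
    by rewrite -natrM.
  by move: (\sum_(a <- L) _) E G''0 => T E; rewrite E; lra.
- have m1 : Num.min 1 h1 <= h1 by rewrite ge_min lexx orbT.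
  have gd : 0 < g * d by rewrite mulr_gt0.
  have := ler_wpM2l (ltW gd) m1; rewrite /e; have := mulr_gt0 gd h10; lra.
have m1 : Num.min 1 h1 <= 1 by rewrite ge_min lexx.
have gd : 0 < g * d by rewrite mulr_gt0.
have := ler_wpM2l (ltW gd) m1; rewrite /e; lra.
Qed.

End slow_minimum.

(** * Symmetric bodies *)

Section bodies.
Variable R : realType.
Implicit Types (a b c x y z : plane R) (p q u v s t : R) (X K S U C : set (plane R)).

(* Being an intersection of strips, a body is closed, convex and centrally symmetric. *)
Definition body K : Prop :=
  [/\ exists2 r : R, 0 < r & forall x, norm2 x <= r ^+ 2 -> K x,
      exists2 r : R, 0 < r & forall x, K x -> norm2 x <= r ^+ 2 &
      forall x, ~ K x -> exists2 a, forall y, K y -> `|dot a y| <= 1 & 1 < dot a x].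

Lemma bodyP K x : body K ->
  (forall a, (forall y, K y -> `|dot a y| <= 1) -> dot a x <= 1) -> K x.
Proof.
move=> [_ _ sep] H; apply: contrapT => /sep[a Ka].
by rewrite ltNge => /negP; apply; exact: H.
Qed.

Lemma body_sym K x : body K -> K x -> K (- x).
Proof.
move=> bK Kx; apply: bodyP => // a Ka; rewrite dotN.
by have := Ka x Kx; rewrite ler_norml => /andP[]; lra.
Qed.

Lemma body_conv K x y z t : body K -> K x -> K y -> 0 <= t <= 1 ->
  t * x.1 + (1 - t) * y.1 = z.1 ->
  t * x.2 + (1 - t) * y.2 = z.2 -> K z.
Proof.
move=> bK Kx Ky /andP[t0 t1] z1 z2; apply: bodyP => // a Ka.
have -> : dot a z = t * dot a x + (1 - t) * dot a y by rewrite /dot -z1 -z2; ring.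
have := Ka x Kx; have := Ka y Ky; rewrite !ler_norml => /andP[_ ?] /andP[_ ?].
by nra.
Qed.

Lemma body_lin K (k l m n : R) : k * n - l * m != 0 -> body K -> body (lin k l m n @^-1` K).
Proof.
move=> D0 [[r r0 Kr] [s s0 Ks] sep].
have main (k' l' m' n' : R) (v : R) : 0 < v ->
    exists2 u : R, 0 < u & forall x, norm2 x <= u ^+ 2 -> norm2 (lin k' l' m' n' x) <= v ^+ 2.
  move=> v0; pose N := k' ^+ 2 + l' ^+ 2 + m' ^+ 2 + n' ^+ 2.
  have N0 : 0 <= N by rewrite !addr_ge0 ?sqr_ge0.
  have w0 : 0 < Num.sqrt (1 + N) by rewrite sqrtr_gt0; lra.
  exists (v / Num.sqrt (1 + N)); first by rewrite divr_gt0.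
  move=> x nx; apply: le_trans (norm2_lin_le _ _ _ _ _) _; rewrite -/N.
  have : norm2 x * (1 + N) <= v ^+ 2.
    by move: nx; rewrite expr_div_n sqr_sqrtr ?ler_pdivlMr//; lra.
  by have := norm2_ge0 x; nra.
split.
- have [u u0 Hu] := main k l m n r r0.
  by exists u => // x /Hu /Kr.
- pose D := k * n - l * m; pose N := (n / D) ^+ 2 + (- l / D) ^+ 2 + (- m / D) ^+ 2 + (k / D) ^+ 2.
  have N0 : 0 <= N by rewrite !addr_ge0 ?sqr_ge0.
  have w0 : 0 < Num.sqrt (1 + N) by rewrite sqrtr_gt0; lra.
  exists (s * Num.sqrt (1 + N)); first by rewrite mulr_gt0.
  move=> x /Ks le_s; rewrite -(lin_inv x D0); apply: le_trans (norm2_lin_le _ _ _ _ _) _.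
  rewrite -/D -/N exprMn sqr_sqrtr; last by lra.
  by have := norm2_ge0 (lin k l m n x); nra.
move=> x /sep[a Ka ax].
have E y : dot (k * a.1 + m * a.2, l * a.1 + n * a.2) y = dot a (lin k l m n y).
  by rewrite /dot /lin /=; ring.
exists (k * a.1 + m * a.2, l * a.1 + n * a.2); last by rewrite E.
by move=> y Ky; rewrite E; exact: Ka.
Qed.

(** Strips with rational normals form a countable family, which gives both measurability and the
    approximation by polygons. *)
Lemma body_strip_rat K x : body K -> ~ K x ->
  exists2 f : rat * rat, (forall y, K y -> `|dot (ratr f.1, ratr f.2) y| <= 1) &
    1 < dot (ratr f.1, ratr f.2) x.
Proof.
move=> [_ [r r0 Kr] sep] /sep[a Ka ax].
(* Scaling by the mean of 1 and [1 / dot a x] leaves slack on both sides: [k < 1 < k * dot a x]. The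
   rounding error [e] is fitted to this slack. *)
pose k := (1 + (dot a x)^-1) / 2.
have dx0 : 0 < dot a x by apply: lt_trans ax.
have kx : 1 < k * dot a x by rewrite /k; have := mulVf (lt0r_neq0 dx0); lra.
have k1 : k < 1 by rewrite /k; have : (dot a x)^-1 < 1 by [rewrite invf_lt1]; lra.
have k0 : 0 < k by rewrite divr_gt0// addr_gt0// invr_gt0.
pose N := `|x.1| + `|x.2| + 2 * r.
have N0 : 0 < N by rewrite ltr_wpDl ?addr_ge0// mulr_gt0.
pose e := Num.min (1 - k) (k * dot a x - 1) / N.
have m0 : 0 < Num.min (1 - k) (k * dot a x - 1) by rewrite lt_min !subr_gt0 k1.
have e0 : 0 < e by rewrite divr_gt0.
have approx (w : R) : exists f : rat, `|ratr f - w| < e.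
  have : w - e < w + e by lra.
  move=> /rat_in_itvoo[f]; rewrite in_itv /= => /andP[f1 f2].
  by exists f; rewrite ltr_norml; apply/andP; split; lra.
have [f1 Hf1] := approx (k * a.1); have [f2 Hf2] := approx (k * a.2).
have diff y : `|dot (ratr f1, ratr f2) y - k * dot a y| <= e * (`|y.1| + `|y.2|).
  rewrite (_ : _ - _ = (ratr f1 - k * a.1) * y.1 + (ratr f2 - k * a.2) * y.2); last first.
    by rewrite /dot /=; ring.
  apply: le_trans (ler_normD _ _) _; rewrite !normrM mulrDr.
  by apply: lerD; rewrite ler_wpM2r// ltW.
have eN : e * N = Num.min (1 - k) (k * dot a x - 1) by rewrite /e divfK// gt_eqF.
have eN1 : e * N <= 1 - k by rewrite eN ge_min lexx.
have eN2 : e * N <= k * dot a x - 1 by rewrite eN ge_min lexx orbT.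
have x12 : 0 <= `|x.1| + `|x.2| by rewrite addr_ge0.
exists (f1, f2) => [y Ky|] /=.
  have y12 : `|y.1| + `|y.2| <= 2 * r.
    have := Kr y Ky; rewrite /norm2 => ny.
    have h1 : `|y.1| <= r.
      apply: le_of_sqr; first exact: ltW.
      by rewrite real_normK ?num_real//; have := sqr_ge0 y.2; lra.
    have h2 : `|y.2| <= r.
      apply: le_of_sqr; first exact: ltW.
      by rewrite real_normK ?num_real//; have := sqr_ge0 y.1; lra.
    lra.
  have eNy : e * (`|y.1| + `|y.2|) <= e * N by apply: ler_wpM2l; [exact: ltW|rewrite /N; lra].
  have := Ka y Ky; rewrite ler_norml => /andP[a1 a2].
  have ka1 : - k <= k * dot a y by nra.
  have ka2 : k * dot a y <= k by nra.
  have := diff y; rewrite !ler_norml => /andP[? ?].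
  by apply/andP; split; lra.
have : e * (`|x.1| + `|x.2|) < e * N by rewrite ltr_pM2l// /N; lra.
by have := diff x; rewrite ler_norml => /andP[? ?]; lra.
Qed.

(** An enumeration through the codes of rational pairs, so that the polygons decrease to [K]; codes
    of no pair, or of a strip not containing [K], are skipped. *)
Definition rat_strips K (n : nat) : seq (plane R) :=
  pmap (fun i => match (unpickle i : option (rat * rat)) with
    | Some f => if `[< forall y, K y -> `|dot (ratr f.1, ratr f.2) y| <= 1 >]
                then Some ((ratr f.1, ratr f.2) : plane R) else None
    | None => None end) (iota 0 n).

Lemma rat_stripsP K n a : a \in rat_strips K n -> forall y, K y -> `|dot a y| <= 1.
Proof.
rewrite mem_pmap => /mapP[i _]; case: unpickle => // f.
by case: asboolP => // H [->].
Qed.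

Lemma rat_strips_mono K m n : (m <= n)%N -> polygon (rat_strips K n) `<=` polygon (rat_strips K m).
Proof.
move=> mn x H a; rewrite mem_pmap => /mapP[i im E]; apply: H.
rewrite mem_pmap; apply/mapP; exists i => //.
by move: im; rewrite !mem_iota !add0n /= => /leq_trans; apply.
Qed.

Lemma body_bigcap K : body K -> K = \bigcap_n polygon (rat_strips K n).
Proof.
move=> bK; apply/seteqP; split => [x Kx n _ a aK|x Hx].
  exact: rat_stripsP aK _ Kx.
apply: contrapT => /(body_strip_rat bK)[f Kf fx].
have := Hx (pickle f).+1 I (ratr f.1, ratr f.2).
rewrite mem_pmap => H; move: fx; rewrite ltNge => /negP; apply.
apply: le_trans (ler_norm _) (H _); apply/mapP; exists (pickle f).
  by rewrite mem_iota add0n ltnS leqnn.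
by rewrite pickleK; case: asboolP.
Qed.

Lemma body_measurable K : body K -> plane_measurable K.
Proof.
move=> /body_bigcap ->; apply: bigcap_measurable => // n _.
exact: plane_measurable_polygon.
Qed.

Lemma bmeas_body K : body K -> bmeas K.
Proof.
move=> bK; split; first exact: body_measurable.
by have [_ [r _ Kr] _] := bK; exists (r ^+ 2).
Qed.

(** Continuity of the measure from above along the decreasing polygons of [rat_strips]. *)
Lemma body_polygon K X (e : R) : body K -> bmeas X -> 0 < e ->
  exists2 l : seq (plane R), (forall a, a \in l -> forall y, K y -> `|dot a y| <= 1) &
    ar (X `&` polygon l) < ar (X `&` K) + e.
Proof.
move=> bK bX e0; pose F n := X `&` polygon (rat_strips K n).
have bF n : bmeas (F n) by apply: bmeasI => //; exact: plane_measurable_polygon.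
have FE : \bigcap_n F n = X `&` K.
  rewrite [in RHS](body_bigcap bK) /F; apply/seteqP; split => [x H|x [Xx H] n _].
    by split; [case: (H 0%N I)|move=> n _; case: (H n I)].
  by split=> //; exact: H.
have bXK : bmeas (X `&` K) by apply: bmeasI => //; exact: body_measurable.
have : (fun n => area (F n)) @ \oo --> area (\bigcap_n F n).
  apply: (@nonincreasing_cvg_mu _ _ _ (@lebesgue_measure R \x @lebesgue_measure R)%E F).
  - exact: bmeas_fin (bF 0%N).
  - by move=> n; case: (bF n).
  - by rewrite FE; case: bXK.
  - move=> m n mn; apply/subsetPset => x [Xx Px]; split=> //; exact: rat_strips_mono mn _ Px.
rewrite FE (arE bXK) => cF.
have : (fun n => ar (F n)) @ \oo --> ar (X `&` K).
  apply: fine_cvg; exact: cF.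
move=> /cvgrPdist_lt /(_ e e0) [n _ /(_ n (leqnn _))] /=.
rewrite ltr_norml => /andP[h _]; exists (rat_strips K n); first by move=> a; exact: rat_stripsP.
by rewrite -/(F n); lra.
Qed.

End bodies.

(** * Positive differences and continuity of the overlap *)

Section stretched_overlap.
Variable R : realType.
Implicit Types (a b c x y z : plane R) (p q u v s t : R) (X Y K S U C : set (plane R)).

Lemma norm2_le_coord x r : 0 <= r -> `|x.1| <= r -> `|x.2| <= r -> norm2 x <= 2 * r ^+ 2.
Proof.
by move=> r0; rewrite !ler_norml /norm2 => /andP[? ?] /andP[? ?]; nra.
Qed.

(** [C] contains a disk about 0, so after a slight contraction towards 0 the point [x] has a whole
    box around it inside [C], still within [U]. This turns a single point of a difference of sets
    into positive area. *)
Lemma convex_open_box C U x (r : R) :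
  (forall y z w t, C y -> C z -> 0 <= t <= 1 -> t * y.1 + (1 - t) * z.1 = w.1 ->
     t * y.2 + (1 - t) * z.2 = w.2 -> C w) ->
  0 < r -> (forall y, norm2 y <= r ^+ 2 -> C y) -> C x -> open U -> U x ->
  exists a b c d : R, [/\ a < b, c < d & box a b c d `<=` C `&` U].
Proof.
move=> cC r0 rC Cx oU Ux.
have /nbhs_ballP[d /= d0 dU] : nbhs x U by exact: open_nbhs_nbhs.
pose N := 1 + `|x.1| + `|x.2|.
have N0 : 0 < N by rewrite /N; have := normr_ge0 x.1; have := normr_ge0 x.2; lra.
pose k := Num.min 2^-1 (d / (2 * N)).
have k0 : 0 < k by rewrite lt_min invr_gt0 ltr0n divr_gt0// mulr_gt0.
have k1 : k <= 2^-1 by rewrite ge_min lexx.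
have kN : k * N <= d / 2.
  have : k <= d / (2 * N) by rewrite ge_min lexx orbT.
  by rewrite -(ler_pM2r N0); have -> : d / (2 * N) * N = d / 2 by field; rewrite gt_eqF.
pose e := Num.min (d / 4) (k * r / 2).
have e0 : 0 < e by rewrite lt_min !divr_gt0// mulr_gt0.
have ed : e <= d / 4 by rewrite ge_min lexx.
have ek : e <= k * r / 2 by rewrite ge_min lexx orbT.
have [x1 x2] : k * `|x.1| <= d / 2 /\ k * `|x.2| <= d / 2.
  by rewrite /N in kN; have := normr_ge0 x.1; have := normr_ge0 x.2; split; nra.
exists ((1 - k) * x.1 - e), ((1 - k) * x.1 + e), ((1 - k) * x.2 - e), ((1 - k) * x.2 + e).
split; [lra|lra|] => y /boxP[/andP[y1 y2] /andP[y3 y4]].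
have w1 : `|(y.1 - (1 - k) * x.1)| <= e by rewrite ler_norml; apply/andP; split; lra.
have w2 : `|(y.2 - (1 - k) * x.2)| <= e by rewrite ler_norml; apply/andP; split; lra.
split.
  pose w : plane R := ((y.1 - (1 - k) * x.1) / k, (y.2 - (1 - k) * x.2) / k).
  have wE (u : R) : `|u| <= e -> `|u / k| <= r / 2.
    by move=> ue; rewrite normrM normfV (gtr0_norm k0) ler_pdivrMr//; lra.
  apply: (cC x w y (1 - k)) => //.
  - have nw : norm2 w <= 2 * (r / 2) ^+ 2.
      by apply: norm2_le_coord; [lra|exact: wE|exact: wE].
    by apply: rC; have := sqr_ge0 r; move: nw; rewrite expr_div_n; lra.
  - by apply/andP; split; lra.
  - by rewrite /w /=; field; rewrite gt_eqF.
  - by rewrite /w /=; field; rewrite gt_eqF.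
apply: dU; split; rewrite /= /ball /= ltr_norml.
  move: w1 x1; rewrite ler_norml => /andP[? ?]; have := ler_norm x.1; have := ler_norm (- x.1).
  by rewrite normrN => ? ? ?; apply/andP; split; nra.
move: w2 x2; rewrite ler_norml => /andP[? ?]; have := ler_norm x.2; have := ler_norm (- x.2).
by rewrite normrN => ? ? ?; apply/andP; split; nra.
Qed.

Lemma disk_conv (r : R) y z w t : norm2 y <= r -> norm2 z <= r -> 0 <= t <= 1 ->
  t * y.1 + (1 - t) * z.1 = w.1 -> t * y.2 + (1 - t) * z.2 = w.2 -> norm2 w <= r.
Proof.
move=> ny nz /andP[t0 t1] w1 w2.
have -> : norm2 w = t * norm2 y + (1 - t) * norm2 z
   - t * (1 - t) * ((y.1 - z.1) ^+ 2 + (y.2 - z.2) ^+ 2).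
  by rewrite /norm2 -w1 -w2; ring.
have : 0 <= t * (1 - t) * ((y.1 - z.1) ^+ 2 + (y.2 - z.2) ^+ 2).
  by rewrite mulr_ge0 ?addr_ge0 ?sqr_ge0// mulr_ge0// subr_ge0.
by nra.
Qed.

Lemma open_norm2_gt (r : R) : open [set x | r < norm2 x].
Proof.
rewrite (_ : mkset _ = @norm2 R @^-1` [set u | r < u])//.
by apply: open_comp; [move=> x _; exact: continuous_norm2|exact: open_gt].
Qed.

Lemma open_dot_gt a (r : R) : open [set x | r < dot a x].
Proof.
rewrite (_ : mkset _ = dot a @^-1` [set u | r < u])//.
by apply: open_comp; [move=> x _; exact: continuous_dot|exact: open_gt].
Qed.

Lemma ar_bodyD_gt0 K x : body K -> K x -> 1 < norm2 x -> 0 < ar (K `\` @unit_disk R).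
Proof.
move=> bK Kx nx; have [[r r0 Kr] _ _] := bK.
have [|a [b [c [d [ab cd sub]]]]] := @convex_open_box K [set x | 1 < norm2 x] x r _ r0 Kr Kx
    (@open_norm2_gt 1) nx.
  by move=> y z w t Ky Kz t01 E1 E2; exact: (body_conv bK Ky Kz t01 E1 E2).
apply: (ar_box_gt0 ab cd) => [|y /sub[Ky /= ny]].
  by apply: bmeasD; [exact: bmeas_body|exact: plane_measurable_disk].
by split=> //; rewrite unit_diskE /=; apply/negP; rewrite -ltNge.
Qed.

Lemma ar_diskD_gt0 K x : body K -> ~ K x -> norm2 x <= 1 -> 0 < ar (@unit_disk R `\` K).
Proof.
move=> bK nKx nx; have [_ _ /(_ x nKx)[a Ka ax]] := bK.
have [||a1 [b [c [d [ab cd sub]]]]] := @convex_open_box (@unit_disk R) [set x | 1 < dot a x] x 1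
    _ ltr01 _ nx (@open_dot_gt a 1) ax.
- by move=> y z w t Ky Kz t01 E1 E2; exact: (disk_conv Ky Kz t01 E1 E2).
- by move=> y; rewrite expr1n.
apply: (ar_box_gt0 ab cd) => [|y /sub[Dy /= ay]].
  by apply: bmeasD; [exact: bmeas_disk|exact: body_measurable].
by split=> // /Ka; apply/negP; rewrite -ltNge (lt_le_trans ay)// ler_norm.
Qed.

Lemma ar_meet_diff X Y P : bmeas X -> bmeas Y -> plane_measurable P ->
  ar (X `&` P) - ar (Y `&` P) <= ar (X `\` Y).
Proof.
move=> bX bY mP; have [[mX _] [mY _]] := (bX, bY).
rewrite (ar_split (bmeasI bX mP) mY).
have : ar (X `&` P `&` Y) <= ar (Y `&` P).
  apply: ar_le; [|exact: bmeasI|by move=> x [[? ?] ?]].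
  by do 2 apply: plane_measurableI => //.
have : ar (X `&` P `\` Y) <= ar (X `\` Y).
  apply: ar_le; [|exact: bmeasD|by move=> x [[? ?] ?]].
  by apply: plane_measurableD => //; exact: plane_measurableI.
lra.
Qed.

(** The inequality between the forms puts the first ellipse inside the second one enlarged by
    [sqrt h], whose area is [h] times as large. *)
Lemma ellipse_diff (k l m n k' l' m' n' h : R) : 1 <= h ->
  k * n - l * m != 0 -> k' * n' - l' * m' != 0 ->
  (forall x, norm2 (lin k' l' m' n' x) <= h * norm2 (lin k l m n x)) ->
  ar (lin k l m n @^-1` @unit_disk R `\` lin k' l' m' n' @^-1` @unit_disk R) <=
  (h - 1) * ar (lin k' l' m' n' @^-1` @unit_disk R).
Proof.
move=> h1 D D' H; set X := _ @^-1` _; set Y := _ @^-1` _.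
have h0 : 0 < Num.sqrt h by rewrite sqrtr_gt0; lra.
have hh : Num.sqrt h ^+ 2 = h by rewrite sqr_sqrtr//; lra.
set r := Num.sqrt h in h0 hh.
pose Z := lin (k' / r) (l' / r) (m' / r) (n' / r) @^-1` @unit_disk R.
have detZ : k' / r * (n' / r) - l' / r * (m' / r) = (k' * n' - l' * m') / h.
  by rewrite -hh; field; rewrite gt_eqF.
have DZ : k' / r * (n' / r) - l' / r * (m' / r) != 0.
  by rewrite detZ mulf_neq0// invr_neq0// gt_eqF//; lra.
have bX : bmeas X by apply: bmeas_lin => //; exact: bmeas_disk.
have bY : bmeas Y by apply: bmeas_lin => //; exact: bmeas_disk.
have bZ : bmeas Z by apply: bmeas_lin => //; exact: bmeas_disk.
have nZ x : norm2 (lin (k' / r) (l' / r) (m' / r) (n' / r) x) = norm2 (lin k' l' m' n' x) / h.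
  by rewrite -hh /norm2 /lin /=; field; rewrite gt_eqF.
have arZ : ar Z = h * ar Y.
  rewrite !ar_lin//; [|exact: bmeas_disk|exact: bmeas_disk].
  rewrite detZ normrM normfV (ger0_norm (x := h)); last lra.
  by field; rewrite normr_eq0 D' gt_eqF//; lra.
have YZ : Y `<=` Z.
  move=> x; rewrite /Y /Z /= !unit_diskE /= nZ => nx.
  by rewrite ler_pdivrMr; lra.
have XZ : X `<=` Z.
  move=> x; rewrite /X /Z /= !unit_diskE /= nZ => nx.
  rewrite ler_pdivrMr; last lra.
  by apply: le_trans (H x) _; rewrite mulrC ler_pM2r//; lra.
apply: (@le_trans _ _ (ar (Z `\` Y))).
  apply: ar_le; [|by apply: bmeasD => //; case: bY|by move=> x [/XZ]].
  by apply: plane_measurableD; [case: bX|case: bY].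
rewrite ar_diff//; last by case: bY.
by rewrite setIC (setIidl YZ) arZ mulrBl mul1r.
Qed.

Lemma norm2_stretch_le s x : norm2 (stretch s x) <= expR (2 * `|s|) * norm2 x.
Proof.
rewrite norm2_stretch /qform /norm2 mulrDr.
apply: lerD; rewrite ler_wpM2r ?sqr_ge0// ler_expR.
  by rewrite ler_pM2l// ler_norm.
by have := ler_norm (- s); rewrite normrN; lra.
Qed.

Lemma stretched_overlap_dist P s t : plane_measurable P ->
  ar (stretched_disk s `&` P) - ar (stretched_disk t `&` P) <=
  (expR (2 * `|s - t|) - 1) * ar (@unit_disk R).
Proof.
move=> mP; apply: le_trans (ar_meet_diff (bmeas_stretched s) (bmeas_stretched t) mP) _.
rewrite -(ar_stretched t); apply: ellipse_diff.
- by rewrite -expR0 ler_expR mulr_ge0.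
- exact: stretch_det_neq0.
- exact: stretch_det_neq0.
move=> x; rewrite -/(stretch (- s) x) -/(stretch (- t) x).
rewrite [X in norm2 X <= _](_ : _ = stretch (s - t) (stretch (- s) x)).
  exact: norm2_stretch_le.
by rewrite stretchD; congr stretch; ring.
Qed.

Lemma continuous_stretched_overlap P : plane_measurable P ->
  continuous (fun t => ar (stretched_disk t `&` P)).
Proof.
move=> mP t; apply/cvgrPdist_le => /= e e0.
pose w := ar (@unit_disk R); have w0 : 0 < w by exact: ar_disk_gt0.
pose d := ln (1 + e / w) / 2.
have d0 : 0 < d by rewrite divr_gt0// ln_gt0// ltrDl divr_gt0.
have small (s : R) : `|s| <= d -> (expR (2 * `|s|) - 1) * w <= e.
  move=> sd; rewrite -ler_pdivlMr// lerBlDr addrC -[leRHS]lnK ?posrE; last first.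
    by rewrite addr_gt0// divr_gt0.
  by rewrite ler_expR; rewrite /d in sd; lra.
near=> s.
have sd : `|t - s| <= d by near: s; apply: (@cvgr_dist_le _ _ _ _ _ id) => //; exact: cvg_id.
rewrite ler_norml; apply/andP; split.
  rewrite lerNl opprB; apply: le_trans (stretched_overlap_dist s t mP) _.
  by apply: small; rewrite distrC.
by apply: le_trans (stretched_overlap_dist t s mP) _; exact: small.
Unshelve. all: by end_near. Qed.

End stretched_overlap.

(** * Uniqueness among centered ellipses *)

Section centered_uniqueness.
Variable R : realType.
Implicit Types (a b c x y z : plane R) (p q u v s t : R) (X Y K S U C : set (plane R)).

(** The preimage of the disk has the area of the disk divided by the absolute determinant. So the
    first two conditions say that no centered ellipse inside [K] is larger than the disk and none
    around [K] is smaller; together with [overlap_le] they are what normalization makes of the range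
    of [lambda] and of maximality. *)
Definition inscribed_ge1 K : Prop := forall k l m n : R, k * n - l * m != 0 ->
  lin k l m n @^-1` @unit_disk R `<=` K -> 1 <= `|k * n - l * m|.
Definition circumscribed_le1 K : Prop := forall k l m n : R, k * n - l * m != 0 ->
  K `<=` lin k l m n @^-1` @unit_disk R -> `|k * n - l * m| <= 1.
Definition overlap_le K (M : R) : Prop := forall k l m n : R, `|k * n - l * m| = 1 ->
  ar (lin k l m n @^-1` @unit_disk R `&` K) <= M.

Lemma stretched_diskE s x : stretched_disk s x <-> norm2 (stretch (- s) x) <= 1.
Proof. by []. Qed.

Lemma stretch_pre s t : stretch s @^-1` stretched_disk t = stretched_disk (t - s).
Proof.
apply/seteqP; split => x; rewrite /stretched_disk /= stretchD;
  by rewrite (_ : - t + s = - (t - s))//; ring.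
Qed.

Lemma ar_stretch_pre s X : bmeas X -> ar (stretch s @^-1` X) = ar X.
Proof. by move=> bX; apply: ar_lin1 => //; exact: norm_stretch_det. Qed.

Lemma body_stretch s K : body K -> body (stretch s @^-1` K).
Proof. by apply: body_lin; exact: stretch_det_neq0. Qed.

Lemma body_in_disk K (M : R) : body K -> ar K <= M -> ar (@unit_disk R `&` K) = M ->
  forall x, K x -> norm2 x <= 1.
Proof.
move=> bK KM DK x Kx; rewrite leNgt; apply/negP => nx.
have := ar_bodyD_gt0 bK Kx nx.
have := ar_split (bmeas_body bK) (plane_measurable_disk (1 : R)).
rewrite -unit_diskE setIC DK; lra.
Qed.

Lemma disk_in_body K (M : R) : body K -> ar (@unit_disk R) <= M -> ar (@unit_disk R `&` K) = M ->
  forall x, norm2 x <= 1 -> K x.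
Proof.
move=> bK KM DK x nx; apply: contrapT => nKx.
have := ar_diskD_gt0 bK nKx nx.
have := ar_split (bmeas_disk (1 : R)) (body_measurable bK).
rewrite -unit_diskE DK; lra.
Qed.

Lemma expR_add_inv_gt2 (t : R) : 0 < t -> 2 < expR t + expR (- t).
Proof.
move=> t0; have e1 : 1 < expR t by rewrite expR_gt1.
have E : expR t * expR (- t) = 1 by rewrite -expRD subrr expR0.
by have := expR_gt0 (- t); nra.
Qed.

(** Otherwise both disks contain [K], and so does the ellipse whose quadratic form is the mean of
    their forms; that ellipse is smaller than the disk. *)
Lemma overlap_lt_body K (M t : R) : body K -> circumscribed_le1 K -> 0 < t ->
  ar (@unit_disk R `&` K) = M -> ar (stretched_disk t `&` K) = M -> M < ar K.
Proof.
move=> bK HL t0 M0 Mt; rewrite ltNge; apply/negP => KM.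
have K0 := body_in_disk bK KM M0.
have bK1 := body_stretch t bK.
have K1 : forall x, (stretch t @^-1` K) x -> norm2 x <= 1.
  apply: (@body_in_disk _ M bK1); first by rewrite ar_stretch_pre//; exact: bmeas_body.
  rewrite -Mt -[RHS](@ar_stretch_pre t); last first.
    by apply: bmeasI; [exact: bmeas_stretched|exact: body_measurable].
  by rewrite preimage_setI stretch_pre subrr stretched_disk0.
clear M0 Mt KM; pose E := expR (2 * t); pose E' := expR (- (2 * t)).
have EE : E * E' = 1 by rewrite -expRD subrr expR0.
have E0 : 0 < E by exact: expR_gt0.
have E'0 : 0 < E' by exact: expR_gt0.
pose k := Num.sqrt ((1 + E') / 2); pose n := Num.sqrt ((1 + E) / 2).
have k2 : k ^+ 2 = (1 + E') / 2 by rewrite sqr_sqrtr//; lra.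
have n2 : n ^+ 2 = (1 + E) / 2 by rewrite sqr_sqrtr//; lra.
have k0 : 0 < k by rewrite sqrtr_gt0; lra.
have n0 : 0 < n by rewrite sqrtr_gt0; lra.
have kn : 1 < k * n.
  rewrite ltNge; apply/negP => kn.
  have : (k * n) ^+ 2 <= 1 by rewrite expr_le1//; apply: mulr_ge0; exact: ltW.
  rewrite exprMn k2 n2; have : 0 < 2 * t by lra.
  by move/expR_add_inv_gt2; rewrite -/E -/E'; lra.
have := HL k 0 0 n; rewrite mul0r subr0 gtr0_norm ?mulr_gt0//.
rewrite gt_eqF ?mulr_gt0// => /(_ isT) H.
suff : k * n <= 1 by rewrite leNgt kn.
apply: H => x Kx; rewrite /= unit_diskE /=.
have := K0 x Kx; have := K1 (stretch (- t) x).
rewrite /= stretchD subrr stretch0 => /(_ Kx).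
rewrite norm2_stretch /qform !mulrN opprK -/E -/E'.
rewrite /norm2 /lin /= !mul0r addr0 add0r !exprMn k2 n2; lra.
Qed.

(** Otherwise [K] contains both disks, and by convexity the image of the unit disk under the mean of
    the two matrices, whose determinant exceeds 1. *)
Lemma overlap_lt_disk K (M t : R) : body K -> inscribed_ge1 K -> 0 < t ->
  ar (@unit_disk R `&` K) = M -> ar (stretched_disk t `&` K) = M -> M < ar (@unit_disk R).
Proof.
move=> bK HJ t0 M0 Mt; rewrite ltNge; apply/negP => KM.
have K0 := disk_in_body bK KM M0.
have bK1 := body_stretch t bK.
have K1 : forall x, norm2 x <= 1 -> (stretch t @^-1` K) x.
  apply: (@disk_in_body _ M bK1 KM).
  rewrite -Mt -[RHS](@ar_stretch_pre t); last first.
    by apply: bmeasI; [exact: bmeas_stretched|exact: body_measurable].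
  by rewrite preimage_setI stretch_pre subrr stretched_disk0.
clear M0 Mt KM; pose E := expR t; pose E' := expR (- t).
have EE : E * E' = 1 by rewrite -expRD subrr expR0.
have E0 : 0 < E by exact: expR_gt0.
have E'0 : 0 < E' by exact: expR_gt0.
pose k := (1 + E) / 2; pose n := (1 + E') / 2.
have k0 : 0 < k by rewrite /k; lra.
have n0 : 0 < n by rewrite /n; lra.
have kn : 1 < k * n.
  by have := expR_add_inv_gt2 t0; rewrite -/E -/E' /k /n; lra.
have := HJ k^-1 0 0 n^-1; rewrite mul0r subr0 gtr0_norm ?mulr_gt0 ?invr_gt0//.
rewrite gt_eqF ?mulr_gt0 ?invr_gt0// => /(_ isT) H.
have kn0 : 0 < k * n by rewrite mulr_gt0.
suff : 1 <= k^-1 * n^-1 by rewrite -invfM (invf_ge1 kn0); lra.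
apply: H => x; rewrite /= unit_diskE /= /lin !mul0r addr0 add0r => nx.
apply: (body_conv bK (K0 _ nx) (K1 _ nx) (t := 2^-1)).
- by apply/andP; split; lra.
- rewrite /stretch /lin /= -/E; have -> : E = 2 * k - 1 by rewrite /k; lra.
  by field; rewrite !gt_eqF.
rewrite /stretch /lin /= -/E'; have -> : E' = 2 * n - 1 by rewrite /n; lra.
by field; rewrite !gt_eqF.
Qed.

Lemma polygon_stretch s (l : seq (plane R)) :
  stretch s @^-1` polygon l = polygon (map (stretch s) l).
Proof.
apply/seteqP; split => [x H b /mapP[a al ->]|x H a al].
  by rewrite -dot_stretch; exact: H.
by rewrite /= dot_stretch; apply: H; apply/mapP; exists a.
Qed.

(** Subtracting the parabola [e' * (s * (t - s))] from the overlap with a polygon pushes the value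
    at [t / 2] below those at both ends, so a minimum is attained strictly in between. There the
    overlap has the kind of approximate minimum that [no_slow_minimum] excludes. *)
Lemma stretch_unique K (M t : R) : body K -> inscribed_ge1 K -> circumscribed_le1 K ->
  overlap_le K M -> 0 < t ->
  ar (@unit_disk R `&` K) = M -> ar (stretched_disk t `&` K) = M -> False.
Proof.
move=> bK HJ HL HM t0 M0 Mt.
have MK := overlap_lt_body bK HL t0 M0 Mt.
have MD := overlap_lt_disk bK HJ t0 M0 Mt.
have [_ [r0 r00 Kr0] _] := bK.
(* Half of the excess of the disk over [M]; the other half absorbs the error of the polygon. *)
have [h1 [h10 H1]] : exists h1, 0 < h1 /\ forall m, m <= M + h1 -> h1 <= ar (@unit_disk R) - m.
  by clear -MD; move: (ar _) MD => w MD; exists ((w - M) / 2); split=> [|m]; lra.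
have [h2 [h20 H2]] : exists h2, 0 < h2 /\ forall m, m <= M -> h2 <= ar K - m.
  by clear -MK; move: (ar _) MK => w MK; exists (w - M); split=> [|m]; lra.
have [r [r_gt0 Hr]] : exists r, 0 < r /\ (expR t * r0) ^+ 2 <= r ^+ 2.
  by exists (expR t * r0); split; [rewrite mulr_gt0// expR_gt0|].
have [e e0 He] := no_slow_minimum h10 h20 r_gt0.
have t10 : 0 < 1 + t by rewrite addr_gt0.
have t20 : 0 < t ^+ 2 by rewrite exprn_gt0.
(* The first bound keeps the slope [e' * |t - 2 * t1|] and the coefficient [e'] below [e]; the
   second keeps the overlap at the minimum below [M + h1]. *)
have [e' [e'0 e'e e'h]] : exists e', [/\ 0 < e', e' * (1 + t) <= e & e' * t ^+ 2 <= h1].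
  exists (Num.min (e / (1 + t)) (h1 / t ^+ 2)); split.
  - by rewrite lt_min; apply/andP; split; apply: divr_gt0.
  - by rewrite -ler_pdivlMr// ge_min lexx.
  - by rewrite -ler_pdivlMr// ge_min lexx orbT.
have th0 : 0 < e' * t ^+ 2 / 4 by rewrite divr_gt0// mulr_gt0// exprn_gt0.
(* The parabola is [e' * t ^+ 2 / 4] at [t / 2], so the polygon has to be accurate to this amount
   there; at the ends it suffices that it contains [K]. *)
have [l lK lt] := body_polygon bK (bmeas_stretched (t / 2)) th0.
have bstr s : ar (stretched_disk s `&` K) <= M by apply: HM; exact: norm_stretch_det.
have mP := plane_measurable_polygon l.
have Kl x : K x -> polygon l x by move=> Kx a al; exact: lK.
have [f fdef] : exists f : R -> R, f = fun s => ar (stretched_disk s `&` polygon l) by eexists.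
have f_ge s : ar (stretched_disk s `&` K) <= f s.
  rewrite fdef; apply: ar_le.
  - by apply: plane_measurableI; [case: (bmeas_stretched s)|exact: body_measurable].
  - by apply: bmeasI => //; exact: bmeas_stretched.
  - by move=> x [? /Kl].
have [g gdef] : exists g : R -> R, g = fun s => f s - e' * (s * (t - s)) by eexists.
have cg : continuous g.
  rewrite gdef => s; apply: cvgB; first by rewrite fdef; exact: continuous_stretched_overlap.
  by apply: cvgM; [exact: cvg_cst|apply: cvgM; [exact: cvg_id|apply: cvgB; [exact: cvg_cst|exact: cvg_id]]].
have [t1 + tmin] := EVT_min (ltW t0) (continuous_subspaceT cg).
rewrite in_itv /= => /andP[t10' t1t].
have g0 : M <= g 0.
  by rewrite gdef mul0r mulr0 subr0 -M0 -stretched_disk0; exact: f_ge.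
have gt_ : M <= g t.
  by rewrite gdef subrr !mulr0 subr0 -Mt; exact: f_ge.
have gmid : g (t / 2) < M.
  have := bstr (t / 2); rewrite gdef fdef.
  have -> : e' * (t / 2 * (t - t / 2)) = e' * t ^+ 2 / 4 by field.
  by move=> h; rewrite ltrBlDr; apply: lt_le_trans lt _; rewrite lerD2r.
move: lt M0 Mt MK MD => _ _ _ _ _.
have gt1 : g t1 <= g (t / 2) by apply: tmin; rewrite in_itv /=; apply/andP; split; lra.
have t1_gt0 : 0 < t1.
  rewrite lt_neqAle t10' andbT; apply/eqP => E; move: gt1; rewrite -E; lra.
have t1_lt : t1 < t.
  rewrite lt_neqAle t1t andbT; apply/eqP => E; move: gt1; rewrite E; lra.
(* The stretch by [t1] moves the minimum to the unit disk. *)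
pose l' := map (stretch t1) l.
have fE s : ar (stretched_disk s `&` polygon l') = f (t1 + s).
  have E : t1 + s - t1 = s by rewrite addrC addKr.
  transitivity (ar (stretch t1 @^-1` (stretched_disk (t1 + s) `&` polygon l))).
    by rewrite preimage_setI stretch_pre polygon_stretch E.
  rewrite fdef ar_stretch_pre//.
  by apply: bmeasI => //; exact: bmeas_stretched.
have fE0 : ar (@unit_disk R `&` polygon l') = f t1 by rewrite -stretched_disk0 fE addr0.
pose S := stretch t1 @^-1` K `\` @unit_disk R.
have bK1 := body_stretch t1 bK.
have w0 : 0 < Num.min t1 (t - t1) by rewrite lt_min t1_gt0 subr_gt0.
(* Expanding the parabola about [t1] gives the slope [e' * (t - 2 * t1)] and the quadratic term
   [- e' * s ^+ 2]. *)
apply: (He l' (e' * (t - 2 * t1)) S (Num.min t1 (t - t1)) w0).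
- by apply: bmeasD; [exact: bmeas_body|exact: plane_measurable_disk].
- rewrite /S ar_diff; [|exact: bmeas_body|exact: plane_measurable_disk].
  rewrite -stretched_disk0 -(subrr t1) -stretch_pre -preimage_setI setIC.
  rewrite !ar_stretch_pre; last 2 first.
  + by apply: bmeasI; [exact: bmeas_stretched|exact: body_measurable].
  + exact: bmeas_body.
  exact: H2 (bstr t1).
- move=> x [Kx nx]; split.
  + by rewrite /l' -polygon_stretch; exact: Kl.
  + by rewrite ltNge; exact/negP.
  rewrite -(stretch0 x) -(addNr t1) -stretchD; apply: le_trans (norm2_stretch_le _ _) _.
  apply: le_trans Hr; rewrite exprMn normrN gtr0_norm// -[expR t ^+ 2]expRM_natl.
  apply: ler_pM; [exact/ltW/expR_gt0|exact: norm2_ge0| |exact: Kr0].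
  by rewrite ler_expR; lra.
- have fM : f t1 <= M + h1.
    have : e' * (t1 * (t - t1)) <= e' * t ^+ 2.
      by rewrite ler_wpM2l ?ltW//; nra.
    have : g t1 = f t1 - e' * (t1 * (t - t1)) by rewrite gdef.
    by move: gt1 gmid; lra.
  have := ar_polygonD l' (bmeas_disk (1 : R)); rewrite -unit_diskE fE0 => E.
  by apply: le_trans (H1 _ fM) _; rewrite E opprB addrCA subrr addr0.
- rewrite normrM gtr0_norm//; apply: le_trans e'e; apply: ler_wpM2l; first exact: ltW.
  by rewrite ler_norml; apply/andP; split; lra.
move=> s; rewrite lt_min !ltr_norml => /andP[/andP[s1 s2] /andP[s3 s4]].
rewrite fE fE0.
have := tmin (t1 + s); rewrite in_itv /= => /(_ _)H.
have {H} : g t1 <= g (t1 + s) by apply: H; apply/andP; split; lra.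
have : e' * s ^+ 2 <= e * s ^+ 2.
  by rewrite ler_wpM2r ?sqr_ge0//; have := mulr_gt0 e'0 t0; lra.
by rewrite gdef; lra.
Qed.

End centered_uniqueness.

(** * Linear changes of frame and principal axes *)

Section change_of_frame.
Variable R : realType.
Implicit Types (a b c x y z e : plane R) (p q u v s t : R) (X Y K S U C : set (plane R)).

Lemma lin_invr (k l m n : R) x : k * n - l * m != 0 ->
  let D := k * n - l * m in
  lin k l m n (lin (n / D) (- l / D) (- m / D) (k / D) x) = x.
Proof.
by move=> D0 /=; rewrite lin_comp; case: x => x y; rewrite /lin /=; congr pair; field.
Qed.

Lemma lin_surj (k l m n : R) y : k * n - l * m != 0 -> exists x, lin k l m n x = y.
Proof. by move=> D0; eexists; exact: lin_invr. Qed.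

Lemma lin_factor (k l m n k' l' m' n' : R) : k * n - l * m != 0 ->
  exists k2 l2 m2 n2, (forall x, lin k' l' m' n' x = lin k2 l2 m2 n2 (lin k l m n x)) /\
    k2 * n2 - l2 * m2 = (k' * n' - l' * m') / (k * n - l * m).
Proof.
move=> D0; set D := k * n - l * m in D0.
exists ((k' * n - l' * m) / D), ((l' * k - k' * l) / D),
  ((m' * n - n' * m) / D), ((n' * k - m' * l) / D); split.
  by move=> x; rewrite lin_comp; congr (lin _ _ _ _ x); rewrite /D; field.
by rewrite /D; field.
Qed.

Lemma lin_factor1 (k l m n k' l' m' n' : R) : `|k * n - l * m| = 1 ->
  exists k2 l2 m2 n2, (forall x, lin k' l' m' n' x = lin k2 l2 m2 n2 (lin k l m n x)) /\
    `|k2 * n2 - l2 * m2| = `|k' * n' - l' * m'|.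
Proof.
move=> D1; have D0 : k * n - l * m != 0 by rewrite -normr_eq0 D1 oner_neq0.
have [k2 [l2 [m2 [n2 [H1 H2]]]]] := lin_factor k' l' m' n' D0.
by exists k2, l2, m2, n2; rewrite H2 normrM normfV D1 invr1 mulr1.
Qed.

Lemma inscribed_lin K (k l m n : R) : `|k * n - l * m| = 1 ->
  inscribed_ge1 K -> inscribed_ge1 (lin k l m n @^-1` K).
Proof.
move=> D1 H k' l' m' n' D' sub; have D0 : k * n - l * m != 0 by rewrite -normr_eq0 D1 oner_neq0.
have [k2 [l2 [m2 [n2 [E1 E2]]]]] := lin_factor1 k' l' m' n' D1.
rewrite -E2; apply: H; first by rewrite -normr_eq0 E2 normr_eq0.
move=> y; have [x <-] := lin_surj y D0; rewrite /= -E1; exact: sub.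
Qed.

Lemma circumscribed_lin K (k l m n : R) : `|k * n - l * m| = 1 ->
  circumscribed_le1 K -> circumscribed_le1 (lin k l m n @^-1` K).
Proof.
move=> D1 H k' l' m' n' D' sub; have D0 : k * n - l * m != 0 by rewrite -normr_eq0 D1 oner_neq0.
have [k2 [l2 [m2 [n2 [E1 E2]]]]] := lin_factor1 k' l' m' n' D1.
rewrite -E2; apply: H; first by rewrite -normr_eq0 E2 normr_eq0.
move=> y; have [x <-] := lin_surj y D0; rewrite /= -E1; exact: sub.
Qed.

Lemma overlap_lin K (M : R) (k l m n : R) : `|k * n - l * m| = 1 -> body K ->
  overlap_le K M -> overlap_le (lin k l m n @^-1` K) M.
Proof.
move=> D1 bK H k' l' m' n' D'.
have [k2 [l2 [m2 [n2 [E1 E2]]]]] := lin_factor1 k' l' m' n' D1.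
rewrite (_ : _ `&` _ = lin k l m n @^-1` (lin k2 l2 m2 n2 @^-1` @unit_disk R `&` K)).
  rewrite (ar_lin1 D1); first by apply: H; rewrite E2.
  apply: bmeasI; last exact: body_measurable.
  apply: bmeas_lin; last exact: bmeas_disk.
  by rewrite -normr_eq0 E2 D' oner_neq0.
by apply/seteqP; split => x; rewrite /= E1.
Qed.

Lemma turn_det1 e : norm2 e = 1 -> `|e.1 * e.1 - e.2 * - e.2| = 1.
Proof. by move=> ne; rewrite -[RHS]normr1 -ne; congr `|_|; rewrite /norm2; ring. Qed.

Lemma turn_det_neq0 e : norm2 e = 1 -> e.1 * e.1 - e.2 * - e.2 != 0.
Proof. by move=> /turn_det1 h; rewrite -normr_eq0 h oner_neq0. Qed.

Lemma turn_disk e : norm2 e = 1 -> turn e @^-1` @unit_disk R = @unit_disk R.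
Proof. by move=> ne; apply/seteqP; split => x; rewrite /= !unit_diskE /= norm2_turn. Qed.

Lemma ar_turn e X : norm2 e = 1 -> bmeas X -> ar (turn e @^-1` X) = ar X.
Proof. by move=> /turn_det1 D1; exact: ar_lin1 D1. Qed.

(* Here [e] is a unit eigenvector for the smaller eigenvalue [u] of the form. *)
Lemma principal_axes (A B C : R) : 0 < A -> A * C - B ^+ 2 = 1 ->
  exists e (u : R), [/\ norm2 e = 1, 0 < u, u <= 1 &
    forall x, A * x.1 ^+ 2 + 2 * B * x.1 * x.2 + C * x.2 ^+ 2 =
      u * (turn e x).1 ^+ 2 + u^-1 * (turn e x).2 ^+ 2].
Proof.
move=> A0 det1.
have C0 : 0 < C by nra.
suff [e [u [ne u0 u1 [Q1 Q2]]]] : exists e (u : R), [/\ norm2 e = 1, 0 < u, u <= 1 &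
    A * e.1 + B * e.2 = u * e.1 /\ B * e.1 + C * e.2 = u * e.2].
  exists e, u; split=> // x.
  have ne12 : e.1 ^+ 2 + e.2 ^+ 2 = 1 by [].
  have Q11 : A * e.1 ^+ 2 + 2 * B * e.1 * e.2 + C * e.2 ^+ 2 = u.
    have -> : A * e.1 ^+ 2 + 2 * B * e.1 * e.2 + C * e.2 ^+ 2 =
      e.1 * (A * e.1 + B * e.2) + e.2 * (B * e.1 + C * e.2) by ring.
    by rewrite Q1 Q2 -[RHS]mulr1 -ne12; ring.
  have Q12 : - A * e.1 * e.2 + B * (e.1 ^+ 2 - e.2 ^+ 2) + C * e.1 * e.2 = 0.
    have -> : - A * e.1 * e.2 + B * (e.1 ^+ 2 - e.2 ^+ 2) + C * e.1 * e.2 =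
      - e.2 * (A * e.1 + B * e.2) + e.1 * (B * e.1 + C * e.2) by ring.
    by rewrite Q1 Q2; ring.
  have Q22 : A * e.2 ^+ 2 - 2 * B * e.1 * e.2 + C * e.1 ^+ 2 = u^-1.
    apply: (mulfI (lt0r_neq0 u0)); rewrite divff ?gt_eqF//.
    transitivity ((A * C - B ^+ 2) * (e.1 ^+ 2 + e.2 ^+ 2) ^+ 2); last first.
      by rewrite det1 ne12 expr1n mul1r.
    have -> : (A * C - B ^+ 2) * (e.1 ^+ 2 + e.2 ^+ 2) ^+ 2 =
      (A * e.1 ^+ 2 + 2 * B * e.1 * e.2 + C * e.2 ^+ 2) *
      (A * e.2 ^+ 2 - 2 * B * e.1 * e.2 + C * e.1 ^+ 2) -
      (- A * e.1 * e.2 + B * (e.1 ^+ 2 - e.2 ^+ 2) + C * e.1 * e.2) ^+ 2 by ring.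
    by rewrite Q11 Q12 expr0n subr0.
  have x1 : x.1 = e.1 * (turn e x).1 - e.2 * (turn e x).2.
    by rewrite /turn /lin /= -[LHS]mul1r -ne12; ring.
  have x2 : x.2 = e.2 * (turn e x).1 + e.1 * (turn e x).2.
    by rewrite /turn /lin /= -[LHS]mul1r -ne12; ring.
  move: (turn e x).1 (turn e x).2 x1 x2 => p q -> ->.
  transitivity ((A * e.1 ^+ 2 + 2 * B * e.1 * e.2 + C * e.2 ^+ 2) * p ^+ 2 +
     2 * (- A * e.1 * e.2 + B * (e.1 ^+ 2 - e.2 ^+ 2) + C * e.1 * e.2) * p * q +
     (A * e.2 ^+ 2 - 2 * B * e.1 * e.2 + C * e.1 ^+ 2) * q ^+ 2); first by ring.
  by rewrite Q11 Q12 Q22; ring.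
(* For [B = 0] the eigenvector [(B, u - A)] used below may vanish, so the coordinate axes are taken
   instead. *)
have [B0|B0] := eqVneq B 0.
  rewrite B0 expr0n subr0 in det1 *.
  have [A1|A1] := leP A 1.
    exists (1, 0), A; rewrite /norm2 /= expr1n expr0n addr0; split=> //.
    by rewrite !mulr1 !mulr0 !addr0.
  exists (0, 1), C; rewrite /norm2 /= expr1n expr0n add0r; split=> //.
    by rewrite leNgt; apply/negP; nra.
  by rewrite !mulr1 !mulr0 !add0r.
pose T := (A + C) / 2; pose d := Num.sqrt (T ^+ 2 - 1); pose u := T - d.
have T1 : 1 <= T.
  rewrite /T leNgt; apply/negP => T1.
  have := sqr_ge0 (A - C); have := sqr_ge0 B; nra.
have d2 : d ^+ 2 = T ^+ 2 - 1 by rewrite sqr_sqrtr//; nra.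
have d0 : 0 <= d by exact: sqrtr_ge0.
have u_gt0 : 0 < u by rewrite /u subr_gt0 ltNge; apply/negP; nra.
have u_le1 : u <= 1 by rewrite /u leNgt; apply/negP; nra.
have char : (u - A) * (u - C) = B ^+ 2.
  have -> : (u - A) * (u - C) = u ^+ 2 - 2 * T * u + A * C by rewrite /T; field.
  have -> : u ^+ 2 - 2 * T * u = d ^+ 2 - T ^+ 2 by rewrite /u; ring.
  by rewrite d2; lra.
pose N := B ^+ 2 + (u - A) ^+ 2.
have N0 : 0 < N by rewrite ltr_pwDl ?sqr_ge0// exprn_even_gt0.
pose r := Num.sqrt N.
have r0 : 0 < r by rewrite sqrtr_gt0.
have r2 : r ^+ 2 = N by rewrite sqr_sqrtr// ltW.
exists (B / r, (u - A) / r), u; split=> //.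
  by rewrite /norm2 /= !expr_div_n -mulrDl r2 divff// gt_eqF.
split => /=.
  by field; rewrite gt_eqF.
have -> : B * (B / r) + C * ((u - A) / r) = (B ^+ 2 + C * (u - A)) / r by field; rewrite gt_eqF.
by rewrite -char; field; rewrite gt_eqF.
Qed.

(** In the principal axes of the form [norm2 (lin k l m n x)], with eigenvalues [u] and [1 / u], the
    second maximizer is a stretched disk; [stretch_unique] leaves only [u = 1]. *)
Lemma centered_unique K (M k l m n : R) : body K -> inscribed_ge1 K -> circumscribed_le1 K ->
  overlap_le K M -> ar (@unit_disk R `&` K) = M -> `|k * n - l * m| = 1 ->
  ar (lin k l m n @^-1` @unit_disk R `&` K) = M -> forall x, norm2 (lin k l m n x) = norm2 x.
Proof.
move=> bK HJ HL HM M0 D1 Mg.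
pose A := k ^+ 2 + m ^+ 2; pose B := k * l + m * n; pose C := l ^+ 2 + n ^+ 2.
have QE x : norm2 (lin k l m n x) = A * x.1 ^+ 2 + 2 * B * x.1 * x.2 + C * x.2 ^+ 2.
  by rewrite /norm2 /lin /= /A /B /C; ring.
have det1 : A * C - B ^+ 2 = 1.
  have -> : A * C - B ^+ 2 = (k * n - l * m) ^+ 2 by rewrite /A /B /C; ring.
  by rewrite -[LHS]real_normK ?num_real// D1 expr1n.
have A0 : 0 < A.
  have A_ge0 : 0 <= A by rewrite addr_ge0 ?sqr_ge0.
  rewrite lt_neqAle A_ge0 andbT; apply/eqP => A_eq; move: det1; rewrite -A_eq mul0r sub0r.
  by have := sqr_ge0 B; lra.
have [e [u [ne u0 u1 HQ]]] := principal_axes A0 det1.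
have [u_eq1|u_neq1] := eqVneq u 1.
  by move=> x; rewrite QE HQ u_eq1 invr1 !mul1r -/(norm2 (turn e x)) norm2_turn.
have {u1 u_neq1} u1 : u < 1 by rewrite lt_neqAle u_neq1.
pose e' : plane R := (e.1, - e.2).
have ne' : norm2 e' = 1 by rewrite -ne /norm2 /= sqrrN.
have D1' := turn_det1 ne'; have D0' := turn_det_neq0 ne'.
(* Chosen so that [exp (- 2 t) = u], the coefficient of the first square in the form of
   [stretched_disk t]. *)
pose t := - ln u / 2.
have t0 : 0 < t by rewrite divr_gt0// oppr_gt0 ln_lt0// u0.
have E1 : expR (- (2 * t)) = u.
  have -> : - (2 * t) = ln u by rewrite /t; field.
  by rewrite lnK// posrE.
have E2 : expR (2 * t) = u^-1 by rewrite -[2 * t]opprK expRN E1.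
have bK' : body (turn e' @^-1` K) by exact: body_lin.
exfalso; apply: (@stretch_unique R (turn e' @^-1` K) M t bK') => //.
- exact: inscribed_lin.
- exact: circumscribed_lin.
- exact: overlap_lin.
- rewrite -M0 -{1}(turn_disk ne') -preimage_setI; apply: (ar_lin1 D1').
  by apply: bmeasI; [exact: bmeas_disk|exact: body_measurable].
have bg : bmeas (lin k l m n @^-1` @unit_disk R `&` K).
  apply: bmeasI; last exact: body_measurable.
  by apply: bmeas_lin (bmeas_disk _); rewrite -normr_eq0 D1 oner_neq0.
have stretched_turned : stretched_disk t = turn e' @^-1` (lin k l m n @^-1` @unit_disk R).
  apply/seteqP; split => x; rewrite stretched_diskE norm2_stretch /qform !mulrN opprK E1 E2;
    by rewrite /= unit_diskE /= QE HQ turnK.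
by rewrite stretched_turned -Mg -[RHS](ar_turn ne' bg).
Qed.

End change_of_frame.

(** * Disks with arbitrary center *)

Section folding.
Variable R : realType.
Implicit Types (X Y S : set (plane R)) (I J T : set R).
Local Notation mR := (measurableTypeR R).
Local Notation leb := (@lebesgue_measure R).

Lemma lebesgue_le_diam I (w : R) : I !=set0 -> measurable (I : set mR) ->
  (forall x y, I x -> I y -> y - x <= w) -> (leb I <= w%:E)%E.
Proof.
move=> [x0 Ix0] mI diam.
have w0 : 0 <= w by rewrite -(subrr x0); exact: diam.
have ubI : has_ubound I by exists (x0 + w) => y Iy; have := diam _ _ Ix0 Iy; lra.
have -> : w%:E = leb `[sup I - w, sup I]%classic.
  rewrite lebesgue_measure_itv /= lte_fin; case: ltP => h; first by rewrite -EFinB opprB subrKC.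
  have -> : w = 0 by lra.
  by [].
apply: (@le_measure _ _ _ leb); rewrite ?inE//.
move=> x Ix; rewrite /= in_itv /=; apply/andP; split; last exact: ub_le_sup.
rewrite lerBlDr; apply: ge_sup; first by exists x0.
by move=> y Iy; have := diam _ _ Ix Iy; lra.
Qed.

(* The one-dimensional Brunn-Minkowski inequality, with weights 1/2. *)
Lemma lebesgue_half_sum I J T : I !=set0 -> J !=set0 ->
  measurable (I : set mR) -> measurable (J : set mR) -> measurable (T : set mR) ->
  (forall y z, I y -> J z -> T ((y + z) / 2)) ->
  (forall x y z, T x -> T z -> x <= y <= z -> T y) ->
  (leb I + leb J <= 2%:E * leb T)%E.
Proof.
move=> I0 J0 mI mJ mT IJT convT.
have [->|Tfin] := eqVneq (leb T) +oo%E; first by rewrite gt0_muley ?leey ?lte_fin.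
have {Tfin} Tfin : leb T \is a fin_num by rewrite ge0_fin_numE ?ltey.
pose w := fine (leb T); have wE : leb T = w%:E by rewrite fineK.
have diamT x z : T x -> T z -> z - x <= w.
  move=> Tx Tz; have [xz|xz] := leP z x.
    by apply: (@le_trans _ _ 0); [rewrite subr_le0|exact: fine_ge0].
  rewrite -lee_fin -wE; have -> : (z - x)%:E = leb `[x, z]%classic.
    by rewrite lebesgue_measure_itv /= lte_fin xz EFinB.
  apply: (@le_measure _ _ _ leb); rewrite ?inE//.
  by move=> y; rewrite /= in_itv /=; exact: convT.
have main y1 y2 z1 z2 : I y1 -> I y2 -> J z1 -> J z2 -> (y2 - y1) + (z2 - z1) <= 2 * w.
  move=> h1 h2 h3 h4; have := diamT _ _ (IJT _ _ h1 h3) (IJT _ _ h2 h4); lra.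
have HI z1 z2 : J z1 -> J z2 -> (leb I <= (2 * w - (z2 - z1))%:E)%E.
  by move=> h3 h4; apply: lebesgue_le_diam => // y1 y2 h1 h2; rewrite lerBrDr; exact: main.
have Ifin : leb I \is a fin_num.
  have [z Jz] := J0; rewrite ge0_fin_numE//; exact: le_lt_trans (HI _ _ Jz Jz) (ltry _).
have HJ : (leb J <= (2 * w - fine (leb I))%:E)%E.
  apply: lebesgue_le_diam => // z1 z2 h3 h4.
  by have := HI _ _ h3 h4; rewrite -(fineK Ifin) lee_fin /=; lra.
rewrite wE -EFinM -(fineK Ifin); apply: le_trans (leeD2l _ HJ) _.
by rewrite -EFinD lee_fin; lra.
Qed.

(** The one-dimensional inequality on each vertical line, integrated over the first coordinate. The
    last hypothesis excludes lines on which just one of [X] and [Y] is empty, where half sums give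
    no information. *)
Lemma ar_fold X Y S : bmeas X -> bmeas Y -> bmeas S ->
  (forall x y z, X (x, y) -> Y (x, z) -> S (x, (y + z) / 2)) ->
  (forall s x y z, S (s, x) -> S (s, z) -> x <= y <= z -> S (s, y)) ->
  (forall x, (exists y, X (x, y)) <-> exists y, Y (x, y)) ->
  ar X + ar Y <= 2 * ar S.
Proof.
move=> bX bY bS XYS convS fibers.
have [[[mX _] [mY _]] [mS _]] := (bX, bY, bS).
have mfX := measurable_fun_xsection leb mX.
have mfY := measurable_fun_xsection leb mY.
have mfS := measurable_fun_xsection leb mS.
rewrite -lee_fin EFinM EFinD -(arE bX) -(arE bY) -(arE bS).
rewrite /area /product_measure1 -ge0_integralD//= -ge0_integralZl//=.
apply: ge0_le_integral => //=.
- by move=> x _; exact: adde_ge0.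
- exact: emeasurable_funD.
- exact: measurable_funeM.
move=> x _.
have [Xx|X0] := pselect (exists y, X (x, y)).
  apply: lebesgue_half_sum; try exact: measurable_xsection.
  - by have [y Xy] := Xx; exists y; rewrite xsectionE.
  - by have [y Yy] := (fibers x).1 Xx; exists y; rewrite xsectionE.
  - by rewrite !xsectionE => y z; exact: XYS.
  - by rewrite !xsectionE => y z w; exact: convS.
have Y0 : ~ exists y, Y (x, y) by move=> /fibers.
have -> : xsection X x = set0.
  by apply/seteqP; split => // y; rewrite xsectionE => Xy; apply: X0; exists y.
have -> : xsection Y x = set0.
  by apply/seteqP; split => // y; rewrite xsectionE => Yy; apply: Y0; exists y.
by rewrite measure0 adde0 mule_ge0.
Qed.

End folding.

(** * Folding the overlap with a translated disk *)

Section centering.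
Variable R : realType.
Implicit Types (a b c x y z e : plane R) (p q u v s t : R) (X Y K S U C : set (plane R)).

(* The overlap of [K] with the unit disk centered at [c], translated by [- c]. *)
Definition lens K c : set (plane R) := [set x | norm2 x <= 1 /\ K (x + c)].

Lemma lensE K c : lens K c = @unit_disk R `&` shift c @^-1` K.
Proof. by []. Qed.

Lemma bmeas_lens K c : body K -> bmeas (lens K c).
Proof.
move=> bK; rewrite lensE; apply: bmeasI; first exact: bmeas_disk.
by apply: plane_measurable_shift; exact: body_measurable.
Qed.

Lemma between_conv u v w : u <= w <= v -> exists2 t : R, 0 <= t <= 1 & t * u + (1 - t) * v = w.
Proof.
move=> /andP[uw wv]; have [uv|uv] := ltP u v; last first.
  by exists 1; [rewrite ler01 lexx|lra].
exists ((v - w) / (v - u)); last by field; rewrite subr_eq0 gt_eqF.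
by apply/andP; split; [rewrite divr_ge0 ?subr_ge0// ltW|rewrite ler_pdivrMr ?subr_gt0//; lra].
Qed.

Fact half01 : 0 <= (2^-1 : R) <= 1.
Proof. by apply/andP; split; lra. Qed.

Lemma square_average (k s u v : R) : (k + s) ^+ 2 + u ^+ 2 <= 1 ->
  (k - s) ^+ 2 + (- v) ^+ 2 <= 1 -> s ^+ 2 + ((u + v) / 2) ^+ 2 <= 1 - k ^+ 2.
Proof. by have := sqr_ge0 (u - v); nra. Qed.

Lemma itv_reflect (p q s : R) :
  (p <= (p + q) / 2 + s <= q) <-> (p <= (p + q) / 2 - s <= q).
Proof. by split=> /andP[h1 h2]; apply/andP; split; lra. Qed.

Lemma lens_conv K c x y z t : body K -> lens K c x -> lens K c y -> 0 <= t <= 1 ->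
  t * x.1 + (1 - t) * y.1 = z.1 -> t * x.2 + (1 - t) * y.2 = z.2 -> lens K c z.
Proof.
move=> bK [nx Kx] [ny Ky] t01 z1 z2; split; first exact: disk_conv nx ny t01 z1 z2.
by apply: (body_conv bK Kx Ky t01) => /=; rewrite -?z1 -?z2; ring.
Qed.

Lemma lens_fiber K c (x y : plane R) s : body K -> lens K c x -> lens K c y ->
  (forall z, lens K c z -> x.1 <= z.1 <= y.1) ->
  (exists u, lens K c (s, u)) <-> x.1 <= s <= y.1.
Proof.
move=> bK Lx Ly ext; split; first by move=> [u /ext].
move=> /between_conv[t t01 st]; exists (t * x.2 + (1 - t) * y.2).
exact: lens_conv bK Lx Ly t01 _ _.
Qed.

(* Chords of the lens lying symmetrically about its midline are averaged, after a
   half turn of one of them. *)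
Lemma lens_fold K c x y : body K -> lens K c x -> lens K c y ->
  (forall z, lens K c z -> x.1 <= z.1 <= y.1) ->
  ar (lens K c) <= ar ([set z | norm2 z <= 1 - ((x.1 + y.1) / 2) ^+ 2] `&` K).
Proof.
move=> bK Lx Ly ext; set m := (x.1 + y.1) / 2.
pose X := shift (m, 0) @^-1` lens K c; pose Y := lin (-1) 0 0 (-1) @^-1` X.
have bL := bmeas_lens c bK.
have bX : bmeas X by exact: bmeas_shift.
have D1 : `|(-1) * (-1) - 0 * 0 : R| = 1 by rewrite mulrNN mulr1 mul0r subr0 normr1.
have arX : ar X = ar (lens K c) by apply: ar_shift; case: bL.
have bY : bmeas Y by apply: bmeas_lin => //; rewrite -normr_eq0 D1 oner_neq0.
have arY : ar Y = ar (lens K c) by rewrite -arX; exact: ar_lin1.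
have XE s u : X (s, u) = lens K c (m + s, u).
  by rewrite /X /= /shift; congr lens; congr pair => /=; ring.
have YE s u : Y (s, u) = lens K c (m - s, - u).
  by rewrite /Y /= /lin /= XE; congr lens; congr pair; ring.
have bS : bmeas ([set z | norm2 z <= 1 - m ^+ 2] `&` K).
  by apply: bmeasI; [exact: bmeas_disk|exact: body_measurable].
suff : ar X + ar Y <= 2 * ar ([set z | norm2 z <= 1 - m ^+ 2] `&` K).
  by rewrite arX arY -mulr2n -[X in X <= _]mulr_natl ler_pM2l.
apply: ar_fold bX bY bS _ _ _.
- move=> s u v; rewrite XE YE => -[]; rewrite /norm2 /= => n1 K1 [n2 K2]; split.
    exact: square_average.
  by apply: (body_conv bK K1 (body_sym bK K2) half01) => /=; field.
- move=> s u v w [/= n1 K1] [n2 K2] /between_conv[t t01 tE].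
  have sE : t * s + (1 - t) * s = s by ring.
  split; first exact: (@disk_conv R _ _ _ (s, v) t n1 n2 t01).
  exact: (@body_conv R K _ _ (s, v) t bK K1 K2 t01).
move=> s; have F := lens_fiber _ bK Lx Ly ext.
have -> : (exists u, X (s, u)) <-> exists u, lens K c (m + s, u).
  by split=> -[u]; rewrite ?XE => h; exists u; rewrite ?XE.
have -> : (exists u, Y (s, u)) <-> exists u, lens K c (m - s, u).
  by split=> -[u h]; exists (- u); [rewrite -YE|rewrite YE opprK].
by rewrite !F; exact: itv_reflect.
Qed.

Lemma lens_turn K c e : norm2 e = 1 ->
  lens (turn (e.1, - e.2) @^-1` K) (turn e c) = turn (e.1, - e.2) @^-1` lens K c.
Proof.
move=> ne; have ne' : norm2 (e.1, - e.2) = 1 by rewrite -ne /norm2 /= sqrrN.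
have := turnK ne'; rewrite /= opprK -surjective_pairing => K1.
apply/seteqP; split => x; rewrite /lens /= norm2_turn// => -[n1 K2]; split => //.
  move: K2; rewrite (_ : turn _ (x + turn e c) = turn (e.1, - e.2) x + c)//.
  by rewrite -[in RHS](K1 c) /turn /lin; apply: injective_projections => /=; ring.
rewrite (_ : turn _ (x + turn e c) = turn (e.1, - e.2) x + c)//.
by rewrite -[in RHS](K1 c) /turn /lin; apply: injective_projections => /=; ring.
Qed.

(** [lens_fold] after the rotation that takes [e] to the first axis. *)
Lemma lens_fold_dir K c e x y : norm2 e = 1 -> body K -> lens K c x -> lens K c y ->
  (forall z, lens K c z -> dot e x <= dot e z <= dot e y) ->
  ar (lens K c) <= ar ([set z | norm2 z <= 1 - ((dot e x + dot e y) / 2) ^+ 2] `&` K).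
Proof.
move=> ne bK Lx Ly ext; pose e' : plane R := (e.1, - e.2).
have ne' : norm2 e' = 1 by rewrite -ne /norm2 /= sqrrN.
have K1 : cancel (turn e) (turn e').
  by have := turnK ne'; rewrite /= opprK -surjective_pairing.
have bK' : body (turn e' @^-1` K) by apply: body_lin => //; exact: turn_det_neq0.
have L' z : lens (turn e' @^-1` K) (turn e c) z = lens K c (turn e' z) by rewrite lens_turn.
have t1 z : (turn e z).1 = dot e z by [].
have := @lens_fold (turn e' @^-1` K) (turn e c) (turn e x) (turn e y) bK'.
rewrite !L' !K1 !t1 => /(_ Lx Ly) H.
rewrite -(ar_turn ne' (bmeas_lens c bK)) -lens_turn//.
rewrite -(ar_turn ne' (bmeasI (bmeas_disk _) (body_measurable bK))).
apply: le_trans (H _) _.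
  by move=> z; rewrite L' => /ext; rewrite -[dot e (turn _ _)]t1 turnK.
rewrite le_eqVlt; apply/orP; left; apply/eqP; congr ar.
by apply/seteqP; split => z [h1 h2]; split=> //; move: h1; rewrite /= norm2_turn.
Qed.

Lemma body_closed K : body K -> closed K.
Proof.
move=> [_ _ sep]; rewrite -[K]setCK; apply: open_closedC; rewrite openE => x /sep[a Ka ax].
apply: filterS (open_nbhs_nbhs (conj (@open_dot_gt R a 1) ax)) => y /= ay Ky.
by have := le_trans (ler_norm _) (Ka y Ky); rewrite leNgt ay.
Qed.

Lemma compact_lens K c : body K -> compact (lens K c).
Proof.
move=> bK; rewrite lensE; apply: compact_closedI; first exact: (@compact_disk R 1).
apply: preimage_closed; last exact: body_closed.
by move=> x _; apply: cvgD; [exact: cvg_id|exact: cvg_cst].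
Qed.

Lemma lens_extremes K c e : body K -> lens K c !=set0 -> exists x y,
  [/\ lens K c x, lens K c y & forall z, lens K c z -> dot e x <= dot e z <= dot e y].
Proof.
move=> bK L0; have cL := @compact_lens K c bK.
have cd a : {within lens K c, continuous (dot a)}.
  by apply: continuous_subspaceT; exact: continuous_dot.
have [y /set_mem Ly Hy] := compact_EVT_max L0 cL (@cd e).
have [x /set_mem Lx Hx] := compact_EVT_max L0 cL (@cd (- e)).
exists x, y; split=> // z Lz; apply/andP; split; last by apply: Hy; exact/mem_set.
by rewrite -lerN2 -!dotNl; apply: Hx; exact/mem_set.
Qed.

Lemma lens_le K c : body K -> ar (lens K c) <= ar (@unit_disk R `&` K).
Proof.
move=> bK; have [->|/set0P L0] := eqVneq (lens K c) set0.
  apply: ar_le => //; first exact: measurable0.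
  by apply: bmeasI; [exact: bmeas_disk|exact: body_measurable].
have [x [y [Lx Ly ext]]] := lens_extremes (1, 0) bK L0.
apply: le_trans (lens_fold_dir _ bK Lx Ly ext) _; first by rewrite /norm2 /= expr1n expr0n addr0.
apply: ar_le; last by move=> z /= [h Kz]; split=> //; apply: le_trans h _; rewrite gerBl sqr_ge0.
  by apply: plane_measurableI; [exact: plane_measurable_disk|exact: body_measurable].
by apply: bmeasI; [exact: bmeas_disk|exact: body_measurable].
Qed.

(** A point of [K] beyond the small disk could be moved towards 0 into the open annulus between the
    disks, and would then yield a box in [K] and in the annulus. Here [k] is the squared radius. *)
Lemma body_in_small_disk K (k : R) : body K -> 0 < k -> k < 1 ->
  ar (@unit_disk R `&` K) <= ar ([set z | norm2 z <= k] `&` K) -> forall x, K x -> norm2 x <= k.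
Proof.
move=> bK k0 k1 small x Kx; rewrite leNgt; apply/negP => nx.
have [[r r0 Kr] _ _] := bK.
have K0 : K 0 by apply: Kr; rewrite /norm2 /= !expr0n addr0 sqr_ge0.
have [y Ky ny] : exists2 y, K y & k < norm2 y < 1.
  have [nx1|nx1] := ltP (norm2 x) 1; first by exists x => //; rewrite nx.
  (* Scaling by [sqrt v] brings the squared norm to [(1 + k) / 2]. *)
  pose v := (1 + k) / 2 / norm2 x.
  have nx0 : 0 < norm2 x by lra.
  have v0 : 0 <= v by rewrite divr_ge0 ?ltW//; lra.
  have v1 : v <= 1 by rewrite ler_pdivrMr//; lra.
  have s1 : Num.sqrt v <= 1 by rewrite -sqrtr1 ler_wsqrtr.
  have s2 : Num.sqrt v ^+ 2 * norm2 x = (1 + k) / 2 by rewrite sqr_sqrtr// divfK// gt_eqF.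
  exists (Num.sqrt v * x.1, Num.sqrt v * x.2); last first.
    rewrite (_ : norm2 _ = (1 + k) / 2); first by apply/andP; split; lra.
    by rewrite -s2 /norm2 /=; ring.
  apply: (@body_conv R K x 0 _ (Num.sqrt v) bK Kx K0); rewrite ?sqrtr_ge0//= mulr0 addr0//.
have /andP[ny1 ny2] := ny.
have oU : open ([set z : plane R | k < norm2 z] `&` [set z | norm2 z < 1]).
  apply: openI; first exact: open_norm2_gt.
  rewrite (_ : [set z | _] = @norm2 R @^-1` [set u | u < 1])//.
  by apply: open_comp; [move=> ? _; exact: continuous_norm2|exact: open_lt].
have [|a [b [c [d [ab cd sub]]]]] := @convex_open_box R K _ y r _ r0 Kr Ky oU (conj ny1 ny2).
  by move=> z1 z2 w t Kz1 Kz2 t01 E1 E2; exact: (body_conv bK Kz1 Kz2 t01 E1 E2).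
pose D := @unit_disk R `&` K; pose Dk := [set z | norm2 z <= k] `&` K.
have bD : bmeas D by apply: bmeasI; [exact: bmeas_disk|exact: body_measurable].
have bDk : bmeas Dk by apply: bmeasI; [exact: bmeas_disk|exact: body_measurable].
have : 0 < ar (D `\` Dk).
  apply: (ar_box_gt0 ab cd); first by apply: bmeasD bD _; case: bDk.
  move=> z /sub[Kz [/= kz z1]]; split; first by split=> //; exact: ltW.
  by move=> [/= ]; rewrite leNgt kz.
have DDk : D `&` Dk = Dk.
  by apply: setIidr => z [/= h Kz]; split=> //; rewrite unit_diskE /=; lra.
by rewrite ar_diff ?DDk; [move: small; rewrite -/D -/Dk; lra|by []|by case: bDk].
Qed.

Fact ext_bound (p q u v s : R) : 0 < s -> 1 < s * (- u + v) -> s * (q + v) <= 1 -> p <= u ->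
  p + q < 0.
Proof. by move=> *; nra. Qed.

(** If [- x] is missing, some strip containing [K] excludes [- x + c], and along its normal the lens
    reaches less far forward than backward. Folding then bounds the overlap by that of a strictly
    smaller disk, which must contain [K]; this contradicts [circumscribed_le1]. *)
Lemma optimal_lens_sym K c x : body K -> circumscribed_le1 K ->
  ar (@unit_disk R `&` K) <= ar (lens K c) -> lens K c x -> lens K c (- x).
Proof.
move=> bK HL opt Lx; split; first by rewrite norm2N; case: Lx.
apply: contrapT => nK; have [_ _ /(_ _ nK)[a Ka ax]] := bK.
have a0 : 0 < norm2 a.
  rewrite lt_neqAle norm2_ge0 andbT; apply/eqP => /esym/eqP.
  rewrite paddr_eq0 ?sqr_ge0// !sqrf_eq0 => /andP[/eqP a1 /eqP a2].
  by move: ax; rewrite /dot a1 a2 !mul0r addr0 ltr10.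
pose w := Num.sqrt (norm2 a); have w0 : 0 < w by rewrite sqrtr_gt0.
have w2 : w ^+ 2 = norm2 a by rewrite sqr_sqrtr ?norm2_ge0.
pose e : plane R := (a.1 / w, a.2 / w).
have ne : norm2 e = 1.
  by rewrite /norm2 /= !expr_div_n -mulrDl w2 divff// gt_eqF.
have eE z : dot a z = w * dot e z by rewrite /dot /e /=; field; rewrite gt_eqF.
have L0 : lens K c !=set0 by exists x.
have [y [z [Ly Lz ext]]] := lens_extremes e bK L0.
have mid : dot e y + dot e z < 0.
  have dD (b d : plane R) : dot e (b + d) = dot e b + dot e d by rewrite /dot /=; ring.
  have /andP[yx _] := ext x Lx.
  have := Ka _ Lz.2; move: ax; rewrite !eE !dD dotN => h1 /(le_trans (ler_norm _)) h2.
  exact: ext_bound w0 h1 h2 yx.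
have le1 (v : plane R) : lens K c v -> -1 <= dot e v.
  move=> [nv _]; suff : dot e v ^+ 2 <= 1 by move=> ?; nra.
  have -> : dot e v ^+ 2 = norm2 e * norm2 v - (e.1 * v.2 - e.2 * v.1) ^+ 2.
    by rewrite /dot /norm2; ring.
  by rewrite ne mul1r; have := sqr_ge0 (e.1 * v.2 - e.2 * v.1); lra.
have := lens_fold_dir ne bK Ly Lz ext.
move: mid (le1 _ Ly) (le1 _ Lz); move: (dot e y) (dot e z) => p q mid p1 q1 fold.
(* With [m = (p + q) / 2] the squared radius [1 - m^2] might vanish; halving [m^2] keeps [k]
   positive. *)
pose k := 1 - ((p + q) / 2) ^+ 2 / 2.
have k1 : k < 1 by rewrite /k; nra.
have k0 : 0 < k by rewrite /k; nra.
have sub : forall v : plane R, K v -> norm2 v <= k.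
  apply: (body_in_small_disk bK k0 k1); apply: le_trans opt (le_trans fold _).
  apply: ar_le.
  - by apply: plane_measurableI; [exact: plane_measurable_disk|exact: body_measurable].
  - by apply: bmeasI; [exact: bmeas_disk|exact: body_measurable].
  move=> v [/= h Kv]; split=> //=; apply: le_trans h _; rewrite /k lerD2l lerN2.
  by rewrite ler_pdivrMr//; have := sqr_ge0 ((p + q) / 2); lra.
pose s := (Num.sqrt k)^-1.
have s2 : s ^+ 2 = k^-1 by rewrite exprVn sqr_sqrtr// ltW.
have := HL s 0 0 s; rewrite mul0r subr0 -expr2 s2 gtr0_norm ?invr_gt0//.
rewrite gt_eqF ?invr_gt0// => /(_ isT) H.
suff : k^-1 <= 1 by rewrite invf_le1// leNgt k1.
apply: H => v /sub nv; rewrite /= unit_diskE /=.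
have -> : norm2 (lin s 0 0 s v) = s ^+ 2 * norm2 v by rewrite /norm2 /lin /=; ring.
by rewrite s2 mulrC ler_pdivrMr// mul1r.
Qed.

(* The optimal lens is symmetric, hence contained in [K] together with its translates
   along [[-c, c]], and so with its image under a small shear in the direction of [c]. *)
Lemma optimal_centered K (M : R) c : body K -> inscribed_ge1 K -> circumscribed_le1 K ->
  overlap_le K M -> ar (@unit_disk R `&` K) = M -> ar (lens K c) = M -> c = 0.
Proof.
move=> bK HJ HL HM M0 Mc; apply: contrapT => c0.
have symL x : lens K c x -> lens K c (- x).
  by apply: optimal_lens_sym => //; rewrite M0 Mc.
have N0 : 0 < norm2 c.
  rewrite lt_neqAle norm2_ge0 andbT; apply/eqP => /esym/eqP.
  rewrite paddr_eq0 ?sqr_ge0// !sqrf_eq0 => /andP[/eqP c1 /eqP c2]; apply: c0.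
  by rewrite [c]surjective_pairing c1 c2.
(* Small enough for [|u| <= 1] below, since [|x.1 * c.2 - x.2 * c.1| <= |c|] on the disk. *)
pose t := (1 + norm2 c)^-1.
have t0 : 0 < t by rewrite invr_gt0; lra.
(* [h] is the shear that adds [t * (x.1 * c.2 - x.2 * c.1)] times [c] to [x], and [g] is its
   inverse. *)
pose g := lin (1 - t * (c.2 * c.1)) (t * c.1 ^+ 2) (- (t * c.2 ^+ 2)) (1 + t * (c.1 * c.2)).
pose h := lin (1 + t * (c.2 * c.1)) (- (t * c.1 ^+ 2)) (t * c.2 ^+ 2) (1 - t * (c.1 * c.2)).
have gh x : g (h x) = x.
  rewrite /g /h lin_comp [RHS]surjective_pairing /lin /=; congr pair; ring.
have D1 : `|(1 - t * (c.2 * c.1)) * (1 + t * (c.1 * c.2)) -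
    t * c.1 ^+ 2 * - (t * c.2 ^+ 2)| = 1.
  by rewrite -[RHS]normr1; congr `|_|; ring.
have D1' : `|(1 + t * (c.2 * c.1)) * (1 - t * (c.1 * c.2)) -
    - (t * c.1 ^+ 2) * (t * c.2 ^+ 2)| = 1.
  by rewrite -[RHS]normr1; congr `|_|; ring.
have bB : bmeas (g @^-1` @unit_disk R `&` K).
  apply: bmeasI; last exact: body_measurable.
  by apply: bmeas_lin (bmeas_disk _); rewrite -normr_eq0 D1 oner_neq0.
have sub : lens K c `<=` h @^-1` (g @^-1` @unit_disk R `&` K).
  move=> x Lx; have [nx K1] := Lx; have [_ K2] := symL _ Lx.
  split; first by rewrite /= gh.
  pose u := t * (x.1 * c.2 - x.2 * c.1).
  have /andP[u1 u2] : -1 <= u <= 1.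
    rewrite -ler_norml; apply: le_of_sqr => //; rewrite real_normK ?num_real// expr1n.
    rewrite exprMn exprVn mulrC ler_pdivrMr ?exprn_gt0//; last by lra.
    have -> : (x.1 * c.2 - x.2 * c.1) ^+ 2 = norm2 x * norm2 c - dot x c ^+ 2.
      by rewrite /norm2 /dot; ring.
    move: nx (norm2_ge0 x) (sqr_ge0 (dot x c)) N0.
    by move: (norm2 x) (norm2 c) (dot x c ^+ 2) => p q r; nra.
  have v01 : 0 <= (1 + u) / 2 <= 1 by apply/andP; split; lra.
  by apply: (body_conv bK K1 (body_sym bK K2) v01); rewrite /h /u /lin /=; field.
have geM : M <= ar (g @^-1` @unit_disk R `&` K).
  rewrite -Mc -(ar_lin1 D1' bB); apply: ar_le => //; first by case: (bmeas_lens c bK).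
  by apply: bmeas_lin bB; rewrite -normr_eq0 D1' oner_neq0.
have eqM : ar (g @^-1` @unit_disk R `&` K) = M.
  by apply/eqP; rewrite eq_le geM andbT; exact: HM.
(* Tested on a vector orthogonal to [c], which the shear lengthens. *)
have := centered_unique bK HJ HL HM M0 D1 eqM (- c.2, c.1).
rewrite (_ : norm2 (lin _ _ _ _ _) = norm2 c + t ^+ 2 * norm2 c ^+ 3); last first.
  by rewrite /norm2 /lin /=; ring.
rewrite (_ : norm2 (_, _) = norm2 c); last by rewrite /norm2 /=; ring.
have : 0 < t ^+ 2 * norm2 c ^+ 3 by rewrite mulr_gt0// exprn_gt0.
by lra.
Qed.

End centering.

(** * Existence among centered ellipses *)

Section existence.
Variable R : realType.
Implicit Types (a b c x y z : plane R) (A B C h r : R) (X K : set (plane R)).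

(** A centered ellipse is determined by its form, and [A * C - B ^+ 2 = 1] fixes its area; with
    [A > 0] only [A] and [B] remain free. *)
Definition quad A B C x : R := A * x.1 ^+ 2 + 2 * B * x.1 * x.2 + C * x.2 ^+ 2.
Definition quad_disk A B C : set (plane R) := [set x | quad A B C x <= 1].

Lemma quad_norm2 (k l m n : R) x :
  norm2 (lin k l m n x) = quad (k ^+ 2 + m ^+ 2) (k * l + m * n) (l ^+ 2 + n ^+ 2) x.
Proof. by rewrite /norm2 /quad /lin /=; ring. Qed.

Lemma lin_disk (k l m n : R) : lin k l m n @^-1` @unit_disk R =
  quad_disk (k ^+ 2 + m ^+ 2) (k * l + m * n) (l ^+ 2 + n ^+ 2).
Proof. by apply/seteqP; split => x; rewrite /quad_disk /= unit_diskE /= quad_norm2. Qed.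

(** Completing the square; the upper triangular matrix is the Cholesky factor of the form. *)
Lemma norm2_root A B C x : 0 < A -> A * C - B ^+ 2 = 1 ->
  norm2 (lin (Num.sqrt A) (B / Num.sqrt A) 0 (Num.sqrt A)^-1 x) = quad A B C x.
Proof.
move=> A0 det1; have s0 : Num.sqrt A != 0 by rewrite gt_eqF// sqrtr_gt0.
have s2 : Num.sqrt A ^+ 2 = A by rewrite sqr_sqrtr// ltW.
have CE : C = (1 + B ^+ 2) / Num.sqrt A ^+ 2.
  by rewrite s2 -det1 subrK mulrC mulKf// gt_eqF.
move: (Num.sqrt A) s0 s2 CE => s s0 s2 ->.
by rewrite quad_norm2 /quad -s2 expr0n !mul0r !addr0; field.
Qed.

Lemma quad_diskE A B C : 0 < A -> A * C - B ^+ 2 = 1 ->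
  quad_disk A B C =
  lin (Num.sqrt A) (B / Num.sqrt A) 0 (Num.sqrt A)^-1 @^-1` @unit_disk R.
Proof.
move=> A0 det1; apply/seteqP; split => x;
  by rewrite /quad_disk /= unit_diskE /= (norm2_root x A0 det1).
Qed.

Lemma sqrt_det1 A B : 0 < A ->
  `|Num.sqrt A * (Num.sqrt A)^-1 - B / Num.sqrt A * 0| = 1.
Proof. by move=> A0; rewrite mulr0 subr0 divff ?normr1// gt_eqF// sqrtr_gt0. Qed.

Lemma bmeas_quad A B C : 0 < A -> A * C - B ^+ 2 = 1 -> bmeas (quad_disk A B C).
Proof.
move=> A0 det1; rewrite quad_diskE//; apply: bmeas_lin (bmeas_disk _).
by rewrite -normr_eq0 sqrt_det1// oner_neq0.
Qed.

Lemma ar_quad A B C : 0 < A -> A * C - B ^+ 2 = 1 -> ar (quad_disk A B C) = ar (@unit_disk R).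
Proof.
by move=> A0 det1; rewrite (quad_diskE A0 det1) (ar_lin1 (sqrt_det1 B A0) (bmeas_disk 1)).
Qed.

(** By Cayley-Hamilton the symmetric matrix [Q] of the form, of determinant 1, satisfies
    [(A + C) Q - 1 = Q^2], which is nonnegative. *)
Lemma norm2_le_quad A B C x : 0 < A -> A * C - B ^+ 2 = 1 ->
  norm2 x <= (A + C) * quad A B C x.
Proof.
move=> A0 det1; rewrite -subr_ge0 /norm2 /quad.
rewrite [leRHS](_ : _ = (A * x.1 + B * x.2) ^+ 2 + (B * x.1 + C * x.2) ^+ 2 +
  (A * C - B ^+ 2 - 1) * (x.1 ^+ 2 + x.2 ^+ 2)); last by ring.
by rewrite det1 subrr mul0r addr0 addr_ge0 ?sqr_ge0.
Qed.

(** The forms differ by at most [d * norm2 x], hence relative to the first form by at most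
    [d * (A + C)]; [ellipse_diff] converts this into area. *)
Lemma quad_overlap_diff A B C A' B' C' K : 0 < A -> A * C - B ^+ 2 = 1 ->
  0 < A' -> A' * C' - B' ^+ 2 = 1 -> plane_measurable K ->
  ar (quad_disk A B C `&` K) - ar (quad_disk A' B' C' `&` K) <=
  (`|A - A'| + `|B - B'| + `|C - C'|) * (A + C) * ar (@unit_disk R).
Proof.
move=> A0 det A0' det' mK.
apply: le_trans (ar_meet_diff (bmeas_quad A0 det) (bmeas_quad A0' det') mK) _.
set d := _ + _ + _; have d0 : 0 <= d by rewrite !addr_ge0.
have C0 : 0 < C by have := sqr_ge0 B; nra.
have AC : 0 <= d * (A + C) by rewrite mulr_ge0// addr_ge0 ?ltW.
rewrite -(ar_quad A0' det') [d * _](_ : _ = 1 + d * (A + C) - 1); last by ring.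
rewrite (quad_diskE A0 det) (quad_diskE A0' det').
have h1 : 1 <= 1 + d * (A + C) by rewrite lerDl.
have D0 : Num.sqrt A * (Num.sqrt A)^-1 - B / Num.sqrt A * 0 != 0.
  by rewrite -normr_eq0 sqrt_det1// oner_neq0.
have D0' : Num.sqrt A' * (Num.sqrt A')^-1 - B' / Num.sqrt A' * 0 != 0.
  by rewrite -normr_eq0 sqrt_det1// oner_neq0.
apply: (ellipse_diff h1 D0 D0') => x.
rewrite (norm2_root x A0 det) (norm2_root x A0' det').
have nx := norm2_le_quad x A0 det.
suff : quad A' B' C' x - quad A B C x <= d * norm2 x.
  have := ler_wpM2l d0 nx; move: (quad A B C x) (quad A' B' C' x) (norm2 x) => p q v Hv Hq.
  have -> : (1 + d * (A + C)) * p = p + d * ((A + C) * p) by ring.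
  by lra.
have bnd (p v : R) : `|v| <= norm2 x -> p * v <= `|p| * norm2 x.
  move=> vn; apply: le_trans (ler_norm _) _; rewrite normrM; exact: ler_wpM2l.
have -> : quad A' B' C' x - quad A B C x =
    (A' - A) * x.1 ^+ 2 + (B' - B) * (2 * x.1 * x.2) + (C' - C) * x.2 ^+ 2.
  by rewrite /quad; ring.
rewrite /d (distrC A) (distrC B) (distrC C) [leRHS]mulrDl [X in _ <= X + _]mulrDl.
apply: lerD; [apply: lerD|]; apply: bnd.
- by rewrite ger0_norm ?sqr_ge0// lerDl sqr_ge0.
- rewrite ler_norml /norm2; apply/andP; split.
    by have := sqr_ge0 (x.1 + x.2); rewrite sqrrD; lra.
  by have := sqr_ge0 (x.1 - x.2); rewrite sqrrB; lra.
- by rewrite ger0_norm ?sqr_ge0// lerDr sqr_ge0.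
Qed.

Lemma strip_small X (u v h r : R) : plane_measurable X -> 0 < u -> 0 <= h -> 0 <= r ->
  (forall x, X x -> `|u * x.1 + v * x.2| <= h /\ `|x.2| <= r) -> ar X <= 4 * h * r / u.
Proof.
move=> mX u0 h0 r0 sub; have D0 : u * 1 - v * 0 != 0 by rewrite mulr1 mulr0 subr0 gt_eqF.
have -> : 4 * h * r / u = ar (lin u v 0 1 @^-1` box (- h) h (- r) r).
  rewrite (ar_lin D0 (bmeas_box _ _ _ _)) ar_box; [|by lra|by lra].
  by rewrite mulr1 mulr0 subr0 gtr0_norm//; congr (_ / _); ring.
apply: ar_le => //; first exact: (bmeas_lin D0 (bmeas_box _ _ _ _)).
by move=> x /sub; rewrite /= boxP /= mul0r mul1r add0r !ler_norml.
Qed.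

(** In Cholesky coordinates the ellipse lies in a strip of horizontal half width [1 / sqrt A], so a
    large [A] forces a small overlap. *)
Lemma quad_small A B C r K : 0 < A -> A * C - B ^+ 2 = 1 -> bmeas K ->
  0 <= r -> (forall x, K x -> `|x.1| <= r /\ `|x.2| <= r) ->
  ar (quad_disk A B C `&` K) * Num.sqrt A <= 4 * r.
Proof.
move=> A0 det bK r0 Kr; have s0 : 0 < Num.sqrt A by rewrite sqrtr_gt0.
rewrite -ler_pdivlMr// -[4 in leRHS]mulr1; apply: (@strip_small _ _ (B / Num.sqrt A)) => //.
  by apply: plane_measurableI; [case: (bmeas_quad A0 det)|case: bK].
move=> x [Qx /Kr[_ ?]]; split=> //; apply: le_of_sqr => //.
rewrite real_normK ?num_real// expr1n; apply: le_trans Qx.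
by rewrite -(norm2_root x A0 det) /norm2 /= lerDl sqr_ge0.
Qed.

Lemma quad_swap A B C x : quad A B C (lin 0 1 1 0 x) = quad C B A x.
Proof. by rewrite /quad /lin /=; ring. Qed.

Lemma quad_small2 A B C r K : 0 < A -> A * C - B ^+ 2 = 1 -> bmeas K ->
  0 <= r -> (forall x, K x -> `|x.1| <= r /\ `|x.2| <= r) ->
  ar (quad_disk A B C `&` K) * Num.sqrt C <= 4 * r.
Proof.
move=> A0 det bK r0 Kr; have C0 : 0 < C by have := sqr_ge0 B; nra.
have D1 : `|0 * 0 - 1 * 1 : R| = 1 by rewrite mulr0 mulr1 sub0r normrN normr1.
have bX : bmeas (quad_disk A B C `&` K).
  by apply: bmeasI; [exact: bmeas_quad|case: bK].
have D0 : (0 * 0 - 1 * 1 : R) != 0 by rewrite -normr_eq0 D1 oner_neq0.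
rewrite -(ar_lin1 D1 bX) preimage_setI.
have -> : lin 0 1 1 0 @^-1` quad_disk A B C = quad_disk C B A.
  by apply/seteqP; split => x; rewrite /quad_disk /= quad_swap.
apply: quad_small => //; [by rewrite mulrC|exact: bmeas_lin|].
by move=> x /Kr[]; rewrite /= !mul0r !mul1r add0r addr0.
Qed.

Lemma continuous_quad_overlap K a : plane_measurable K -> 0 < a.1 ->
  {for a, continuous (fun b : plane R => ar (quad_disk b.1 b.2 ((1 + b.2 ^+ 2) / b.1) `&` K))}.
Proof.
move=> mK a0; pose C (b : plane R) := (1 + b.2 ^+ 2) / b.1.
have det (b : plane R) : 0 < b.1 -> b.1 * C b - b.2 ^+ 2 = 1.
  by move=> b0; rewrite /C; field; rewrite gt_eqF.
have C0 (b : plane R) : 0 < b.1 -> 0 < C b.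
  by move=> b0; rewrite divr_gt0// ltr_pwDl ?sqr_ge0.
(* Symmetric in [a] and [b], so as to bound the difference of the overlaps in both directions. *)
pose w (b : plane R) := (`|a.1 - b.1| + `|a.2 - b.2| + `|C a - C b|) *
  ((a.1 + C a) + (b.1 + C b)) * ar (@unit_disk R).
have c1 : (fun b : plane R => b.1) @ a --> a.1 by exact: cvg_fst.
have c2 : (fun b : plane R => b.2) @ a --> a.2 by exact: cvg_snd.
have cC : C b @[b --> a] --> C a.
  apply: cvgM; last by apply: cvgV => //; rewrite gt_eqF.
  by apply: cvgD; [exact: cvg_cst|apply: cvgM; exact: c2].
have cw : w b @[b --> a] --> w a.
  apply: cvgM; last exact: cvg_cst.
  apply: cvgM; last by apply: cvgD; [exact: cvg_cst|apply: cvgD].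
  apply: cvgD; first apply: cvgD; apply: cvg_norm; apply: cvgB => //; exact: cvg_cst.
have wa : w a = 0 by rewrite /w !subrr normr0 !addr0 !mul0r.
rewrite wa in cw.
have near1 : \forall b \near a, 0 < b.1.
  have := c1; move/cvgr_gt; apply; exact: a0.
apply/cvgrPdist_le => e e0.
have near2 : \forall b \near a, w b <= e.
  by move/cvgr_le : cw; apply.
near=> b.
have b0 : 0 < b.1 by near: b.
have we : w b <= e by near: b.
apply: le_trans we; have ar0 := ar_ge0 (@unit_disk R).
have H1 := quad_overlap_diff a0 (det a a0) b0 (det b b0) mK.
have H2 := quad_overlap_diff b0 (det b b0) a0 (det a a0) mK.
have d0 : 0 <= `|a.1 - b.1| + `|a.2 - b.2| + `|C a - C b| by rewrite !addr_ge0.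
have [Ca Cb] := (C0 _ a0, C0 _ b0).
rewrite ler_norml lerNl opprB; apply/andP; split.
  apply: le_trans H2 _; rewrite /w (distrC b.1) (distrC b.2) (distrC (C b)).
  by apply: ler_wpM2r => //; apply: ler_wpM2l => //; lra.
apply: le_trans H1 _; rewrite /w.
by apply: ler_wpM2r => //; apply: ler_wpM2l => //; lra.
Unshelve. all: by end_near. Qed.

Lemma ar_diskI_gt0 K : body K -> 0 < ar (@unit_disk R `&` K).
Proof.
move=> bK; have [[r r0 Kr] _ _] := bK.
pose s := Num.min 1 r / 2.
have m0 : 0 < Num.min 1 r by rewrite lt_min ltr01.
have m1 : Num.min 1 r <= 1 by rewrite ge_min lexx.
have mr : Num.min 1 r <= r by rewrite ge_min lexx orbT.
have s0 : 0 < s by rewrite divr_gt0.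
have sE : 2 * s = Num.min 1 r by rewrite /s; field.
apply: (@ar_box_gt0 _ (- s) s (- s) s); [lra|lra| |].
  by apply: bmeasI; [exact: bmeas_disk|exact: body_measurable].
move=> x /boxP; rewrite -!ler_norml => -[x1 x2].
have := norm2_le_coord (ltW s0) x1 x2; rewrite -sE in m1 mr => nx.
have s2 : s ^+ 2 <= (2 * s) ^+ 2 by nra.
split; first by rewrite unit_diskE /=; nra.
by apply: Kr; nra.
Qed.

Lemma quad_disk1 : quad_disk 1 0 1 = @unit_disk R.
Proof.
apply/seteqP; split => x; rewrite /quad_disk /quad /= unit_diskE /= /norm2;
  by rewrite !mul1r mulr0 !mul0r addr0.
Qed.

(** An ellipse with large [A] or [C] meets the bounded set [K] in less area than the unit disk does.
    The remaining pairs [(A, B)] lie in a compact box, on which the overlap is continuous. *)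
Lemma exists_optimal K : body K -> exists k l m n : R, `|k * n - l * m| = 1 /\
  overlap_le K (ar (lin k l m n @^-1` @unit_disk R `&` K)).
Proof.
move=> bK; have mK := body_measurable bK; have bmK := bmeas_body bK.
have [_ [r r0 Kr] _] := bK.
have Kr' x : K x -> `|x.1| <= r /\ `|x.2| <= r.
  move=> /Kr; rewrite /norm2 => nx; have := sqr_ge0 x.1; have := sqr_ge0 x.2.
  by split; apply: le_of_sqr; [exact: ltW|rewrite real_normK ?num_real//; lra|
    exact: ltW|rewrite real_normK ?num_real//; lra].
pose f0 := ar (@unit_disk R `&` K); have f00 : 0 < f0 by exact: ar_diskI_gt0.
(* For [u > N] the bound [4 * r / sqrt u] of [quad_small] is below [f0]. *)
pose N := 1 + (4 * r / f0) ^+ 2.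
have N1 : 1 <= N by rewrite lerDl sqr_ge0.
have N0 : 0 < N by lra.
have big (u s : R) : s * Num.sqrt u <= 4 * r -> N < u -> s < f0.
  move=> su Nu; rewrite ltNge; apply/negP => fs.
  have h : f0 * Num.sqrt u <= 4 * r.
    by apply: le_trans su; apply: ler_wpM2r.
  have : Num.sqrt u <= 4 * r / f0 by rewrite ler_pdivlMr// mulrC.
  rewrite -ler_sqr ?nnegrE ?sqrtr_ge0//; last by rewrite divr_ge0 ?ltW// mulr_gt0.
  by rewrite sqr_sqrtr; [move: Nu; rewrite /N; lra|lra].
pose F (a : plane R) := ar (quad_disk a.1 a.2 ((1 + a.2 ^+ 2) / a.1) `&` K).
(* If [A] and [C] are at most [N], then [A * C = 1 + B ^+ 2] yields [A >= 1 / N] and [|B| <= N]. *)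
pose Bx := box N^-1 N (- N) N.
have iN : N^-1 <= 1 by rewrite invf_le1.
have BxP a : Bx a -> 0 < a.1.
  by move=> /boxP[/andP[h _] _]; apply: lt_le_trans h; rewrite invr_gt0.
have Bx1 : Bx (1, 0) by apply/boxP; split; apply/andP; split => //=; lra.
have E1 : (1 + 0 ^+ 2) / 1 = 1 :> R by rewrite expr0n addr0 divr1.
have F1 : F (1, 0) = f0 by rewrite /f0 -quad_disk1 -[X in quad_disk 1 0 X]E1.
have [|a /set_mem Ba amax] := compact_EVT_max (ex_intro _ (1, 0) Bx1) (@compact_box R N^-1 N (- N) N) _ (f := F).
  apply: continuous_in_subspaceT => a /set_mem /BxP; exact: continuous_quad_overlap.
have a0 := BxP a Ba.
have deta : a.1 * ((1 + a.2 ^+ 2) / a.1) - a.2 ^+ 2 = 1 by field; rewrite gt_eqF.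
exists (Num.sqrt a.1), (a.2 / Num.sqrt a.1), 0, (Num.sqrt a.1)^-1.
split; first exact: sqrt_det1.
rewrite -(quad_diskE a0 deta) -/(F a) => k l m n D1; rewrite lin_disk.
set A := k ^+ 2 + m ^+ 2; set B := k * l + m * n; set C := l ^+ 2 + n ^+ 2.
have det : A * C - B ^+ 2 = 1.
  have -> : A * C - B ^+ 2 = (k * n - l * m) ^+ 2 by rewrite /A /B /C; ring.
  by rewrite -[LHS]real_normK ?num_real// D1 expr1n.
have A0 : 0 < A.
  have A_ge0 : 0 <= A by rewrite addr_ge0 ?sqr_ge0.
  rewrite lt_neqAle A_ge0 andbT; apply/eqP => A_eq; move: det; rewrite -A_eq mul0r sub0r.
  by have := sqr_ge0 B; lra.
have F1a : f0 <= F a by rewrite -F1; apply: amax; exact: mem_set.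
have [NA|NA] := ltP N A.
  apply: le_trans (ltW _) F1a; apply: (big A) => //.
  exact: quad_small (ltW r0) Kr'.
have [NC|NC] := ltP N C.
  apply: le_trans (ltW _) F1a; apply: (big C) => //.
  exact: quad_small2 (ltW r0) Kr'.
have CE : C = (1 + B ^+ 2) / A by rewrite -det subrK mulrC mulKf// gt_eqF.
rewrite CE; apply: (amax (A, B)); apply: mem_set; apply/boxP => /=.
move: A B C A0 det NA NC {CE} => A B C A0 det NA NC; have B0 := sqr_ge0 B.
have C0 : 0 < C by nra.
rewrite NA andbT -ler_norml; split.
  by rewrite -[N^-1]div1r ler_pdivrMr//; nra.
by apply: le_of_sqr; [exact: ltW|rewrite real_normK ?num_real//; nra].
Qed.

End existence.

(** * Reduction to the unit disk *)

Section convex_bodies.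
Variable R : realType.
Implicit Types (x y z p : plane R) (K : set (plane R)).

Lemma convex_plane K x y z (t : R) : convex_set (K : set (convex_lmodType (plane R))) ->
  K x -> K y -> 0 <= t <= 1 -> t * x.1 + (1 - t) * y.1 = z.1 ->
  t * x.2 + (1 - t) * y.2 = z.2 -> K z.
Proof.
move=> cK Kx Ky t01 z1 z2.
have := cK x y (Itv01 (andP t01).1 (andP t01).2) (mem_set Kx) (mem_set Ky).
move=> /set_mem; congr K; rewrite /conv /=.
by apply: injective_projections; rewrite /= -?z1 -?z2.
Qed.

(** [p] is the point of [K] nearest to [x]. Moving from [p] towards [y] cannot reduce the distance,
    and the first-order term of this condition is the inequality. *)
Lemma separation K x : compact K -> convex_set (K : set (convex_lmodType (plane R))) ->
  K !=set0 -> ~ K x -> exists2 p, K p & forall y, K y ->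
    0 < norm2 (x - p) /\ dot (x - p) y <= dot (x - p) p.
Proof.
move=> cK convK K0 nKx; pose f y := norm2 (y - x).
have cf : {within K, continuous f}.
  apply: continuous_subspaceT => y; apply: (@continuous_comp _ _ _ (fun z => z - x) (@norm2 R)); last exact: continuous_norm2.
  by apply: cvgB; [exact: cvg_id|exact: cvg_cst].
have [p /set_mem Kp pmin] := compact_EVT_min K0 cK cf.
exists p => // y Ky; split.
  rewrite lt_neqAle norm2_ge0 andbT; apply/eqP => /esym/eqP.
  rewrite paddr_eq0 ?sqr_ge0// !sqrf_eq0 /= !subr_eq0 => /andP[/eqP x1 /eqP x2].
  by apply: nKx; rewrite [x]surjective_pairing x1 x2 -surjective_pairing.
have step (t : R) : 0 < t -> t <= 1 ->
    2 * (dot (x - p) y - dot (x - p) p) <= t * norm2 (y - p).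
  move=> t0 t1; have t01 : 0 <= t <= 1 by rewrite ltW.
  pose z : plane R := (t * y.1 + (1 - t) * p.1, t * y.2 + (1 - t) * p.2).
  have Kz : K z by exact: (@convex_plane K y p z t).
  have := pmin z (mem_set Kz); rewrite /f.
  have -> : norm2 (z - x) = norm2 (p - x) +
      t * (t * norm2 (y - p) - 2 * (dot (x - p) y - dot (x - p) p)).
    by rewrite /norm2 /dot /z /=; ring.
  by rewrite lerDl pmulr_rge0// subr_ge0.
rewrite leNgt; apply/negP => lt_py.
have N0 := norm2_ge0 (y - p).
move: (dot (x - p) y) (dot (x - p) p) (norm2 (y - p)) lt_py step N0 => a b n ab step n0.
have n1 : 0 <= n / (a - b) by apply: divr_ge0; rewrite // subr_ge0 ltW.
(* The step length [1 / (1 + n / (a - b))] is at most 1 and makes the quadratic term too small to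
   offset a violation [b < a]. *)
have h : 0 < 1 + n / (a - b) by lra.
have hi : (1 + n / (a - b))^-1 <= 1 by rewrite invf_le1//; lra.
have h' : 0 < (1 + n / (a - b))^-1 by rewrite invr_gt0.
have := step _ h' hi; rewrite [leRHS]mulrC ler_pdivlMr//.
have -> : 2 * (a - b) * (1 + n / (a - b)) = 2 * (a - b) + 2 * n.
  by field; rewrite subr_eq0 gt_eqF.
by lra.
Qed.

(** Averaging a ball around an interior point with the reflection of that point gives a disk about
    0, and by symmetry a separating half plane can be replaced by a strip. *)
Lemma convex_body_body K : convex_body K -> centrally_symmetric K -> body K.
Proof.
move=> [cK convK [c]] /= /nbhs_ballP[e /= e0 ceK] symK.
have Kopp x : K x -> K (- x) by move=> Kx; rewrite symK; exists x.
have Kc : K c by apply: ceK; exact: ballxx.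
have half : 0 <= 2^-1 <= 1 := half01 R.
have Kdisk x : norm2 x <= (e / 4) ^+ 2 -> K x.
  (* [x] is the midpoint of [y], which is close to [c], and of [- c]. *)
  move=> nx; pose y : plane R := (c.1 + 2 * x.1, c.2 + 2 * x.2).
  have Ky : K y.
    have lt_e (u v : R) : u ^+ 2 + v ^+ 2 <= (e / 4) ^+ 2 -> `|2 * u| < e.
      move=> uv; rewrite normrM ger0_norm// -ltr_pdivlMl//.
      apply: le_lt_trans (_ : e / 4 < _); last by lra.
      apply: le_of_sqr; first by lra.
      by rewrite real_normK ?num_real//; have := sqr_ge0 v; lra.
    apply: ceK; split; rewrite /ball /= opprD addNKr normrN.
      exact: lt_e nx.
    by apply: lt_e (x.1) _; rewrite addrC.
  by apply: (convex_plane convK Ky (Kopp _ Kc) half); rewrite /y /=; field.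
have e4 : 0 < e / 4 by lra.
have K0 : K 0 by apply: Kdisk; rewrite /norm2 /= !expr0n addr0 sqr_ge0.
split.
- by exists (e / 4).
- have [m _ mmax] := compact_EVT_max (ex_intro _ c Kc) cK
    (continuous_subspaceT (@continuous_norm2 R)).
  exists (1 + norm2 m) => [|x Kx]; first by rewrite ltr_wpDr ?norm2_ge0.
  by have := mmax x (mem_set Kx); have := norm2_ge0 m; nra.
move=> x /(separation cK convK (ex_intro _ c Kc))[p Kp Hp].
have [N0 _] := Hp p Kp; have p0 : 0 <= dot (x - p) p.
  by have [_] := Hp 0 K0; rewrite {1}/dot /= !mulr0 addr0.
(* [h] is halfway between the values of the functional at [p], its maximum on [K], and at [x];
   dividing by it puts [K] in the strip and [x] outside. *)
pose h := dot (x - p) p + norm2 (x - p) / 2.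
have h0 : 0 < h by rewrite ltr_wpDl// divr_gt0.
have dE y : dot ((x - p).1 / h, (x - p).2 / h) y = dot (x - p) y / h.
  by rewrite /dot /=; field; rewrite gt_eqF.
have ph : dot (x - p) p <= h by rewrite lerDl divr_ge0 ?norm2_ge0.
exists ((x - p).1 / h, (x - p).2 / h) => [y Ky|]; rewrite dE.
  rewrite ler_norml ler_pdivrMr// ler_pdivlMr// mulN1r mul1r lerNl -dotN.
  by apply/andP; split; [have [_ H] := Hp _ (Kopp _ Ky)|have [_ H] := Hp _ Ky];
    exact: le_trans H ph.
rewrite ltr_pdivlMr// mul1r.
have -> : dot (x - p) x = dot (x - p) p + norm2 (x - p) by rewrite /dot /norm2 /=; ring.
by rewrite ltrD2l; lra.
Qed.

End convex_bodies.

(** * Ellipses as affine preimages of the disk *)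

Section ellipses.
Variable R : realType.
Implicit Types (x y c : plane R) (k l m n : R) (E K : set (plane R)).

(** The matrix takes the ellipse to the disk, so it is inverse to the map in [ellipse]: a larger
    determinant means a smaller area. *)
Definition ell k l m n c : set (plane R) := [set x | norm2 (lin k l m n (x - c)) <= 1].

Lemma linB k l m n x y : lin k l m n (x - y) = lin k l m n x - lin k l m n y.
Proof. by rewrite /lin; apply: injective_projections => /=; ring. Qed.

Lemma lin_is_linear k l m n : linear (lin k l m n).
Proof.
by move=> t x y; rewrite /lin; apply: injective_projections; rewrite /= /GRing.scale /=; ring.
Qed.

HB.instance Definition _ k l m n :=
  GRing.isLinear.Build R (plane R) (plane R) _ (lin k l m n) (@lin_is_linear k l m n).

Lemma lin_bij k l m n : k * n - l * m != 0 -> bijective (lin k l m n).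
Proof.
move=> D0; eexists; first by move=> x; exact: (lin_inv x D0).
by move=> x; exact: (lin_invr x D0).
Qed.

Lemma linear_lin (f : {linear plane R -> plane R}) x :
  f x = lin (f (1, 0)).1 (f (0, 1)).1 (f (1, 0)).2 (f (0, 1)).2 x.
Proof.
have -> : f x = x.1 *: f (1, 0) + x.2 *: f (0, 1).
  rewrite -!linearZ -linearD; congr (f _).
  by apply: injective_projections; rewrite /= /GRing.scale /= !(mulr1, mulr0, addr0, add0r).
by rewrite /lin; apply: injective_projections; rewrite /= /GRing.scale /=; ring.
Qed.

(** If the determinant is 0, the columns of the adjugate lie in the kernel; injectivity then makes
    every entry vanish, which is absurd. *)
Lemma lin_inj_det k l m n : injective (lin k l m n) -> k * n - l * m != 0.
Proof.
move=> inj; apply/eqP => D0.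
have ker x : lin k l m n x = 0 -> x = 0.
  by move=> x0; apply: inj; rewrite x0 /lin /= !mulr0 addr0.
have [n0 k0] : n = 0 /\ k = 0.
  have /ker[] : lin k l m n (n, - m) = 0.
    by rewrite /lin /=; apply: injective_projections => /=; [rewrite -D0|]; ring.
  have /ker[] : lin k l m n (- l, k) = 0.
    by rewrite /lin /=; apply: injective_projections => /=; [|rewrite -D0]; ring.
  by [].
have [l0 m0] : l = 0 /\ m = 0.
  have /ker[_ /eqP] : lin k l m n (n, - m) = 0.
    by rewrite /lin /=; apply: injective_projections => /=; [rewrite -D0|]; ring.
  have /ker[/eqP] : lin k l m n (- l, k) = 0.
    by rewrite /lin /=; apply: injective_projections => /=; [|rewrite -D0]; ring.
  by rewrite !oppr_eq0 => /eqP ? _ /eqP ?.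
have /ker[/eqP] : lin k l m n (1, 0) = 0 by rewrite /lin /= n0 k0 l0 m0 !mul0r addr0.
by rewrite oner_eq0.
Qed.

Lemma ellipseP E : ellipse E <->
  exists k l m n c, k * n - l * m != 0 /\ E = ell k l m n c.
Proof.
split.
  move=> [f [c [bf ->]]].
  pose k := (f (1, 0)).1; pose l := (f (0, 1)).1; pose m := (f (1, 0)).2; pose n := (f (0, 1)).2.
  have fE x : f x = lin k l m n x := linear_lin f x.
  have D0 : k * n - l * m != 0.
    by apply: lin_inj_det => x y; rewrite -!fE; exact: bij_inj.
  pose D := k * n - l * m.
  exists (n / D), (- l / D), (- m / D), (k / D), c; split.
    rewrite (_ : _ - _ = D^-1) ?invr_eq0//.
    by rewrite /D; field.
  apply/seteqP; split => [_ [x Dx <-]|x Ex].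
    by rewrite /ell /= addrAC subrr add0r fE (lin_inv x D0).
  exists (lin (n / D) (- l / D) (- m / D) (k / D) (x - c)) => //.
  by rewrite fE (lin_invr (x - c) D0) subrKC.
move=> [k [l [m [n [c [D0 ->]]]]]].
pose D := k * n - l * m.
have D0' : n / D * (k / D) - - l / D * (- m / D) != 0.
  by rewrite (_ : _ - _ = D^-1) ?invr_eq0//; rewrite /D; field.
exists (lin (n / D) (- l / D) (- m / D) (k / D)), c; split; first exact: lin_bij.
apply/seteqP; split => [x Ex|_ [x Dx <-]].
  by exists (lin k l m n (x - c)) => //; rewrite /= (lin_inv (x - c) D0) subrKC.
by rewrite /ell /= addrAC subrr add0r (lin_invr x D0).
Qed.

Lemma ellE k l m n c : ell k l m n c = shift (- c) @^-1` (lin k l m n @^-1` @unit_disk R).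
Proof. by []. Qed.

Lemma bmeas_ell k l m n c : k * n - l * m != 0 -> bmeas (ell k l m n c).
Proof. by move=> D0; rewrite ellE; apply: bmeas_shift; apply: bmeas_lin (bmeas_disk _). Qed.

Lemma ar_ell k l m n c : k * n - l * m != 0 ->
  ar (ell k l m n c) = ar (@unit_disk R) / `|k * n - l * m|.
Proof.
move=> D0; have [mX _] := bmeas_lin D0 (bmeas_disk (1 : R)).
by rewrite ellE (ar_shift (- c) mX) (ar_lin D0 (bmeas_disk (1 : R))).
Qed.

Lemma ell0 k l m n : ell k l m n 0 = lin k l m n @^-1` @unit_disk R.
Proof. by apply/seteqP; split => x; rewrite /ell /= subr0. Qed.

Lemma ell_pull k l m n c (k' l' m' n' : R) : k' * n' - l' * m' != 0 ->
  exists k2 l2 m2 n2 c2, lin k' l' m' n' @^-1` ell k l m n c = ell k2 l2 m2 n2 c2 /\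
    k2 * n2 - l2 * m2 = (k * n - l * m) * (k' * n' - l' * m').
Proof.
move=> D0; have [d dc] := lin_surj c D0.
exists (k * k' + l * m'), (k * l' + l * n'), (m * k' + n * m'), (m * l' + n * n'), d.
split; last by ring.
by apply/seteqP; split => x; rewrite /ell /= -lin_comp (linB k' l' m' n') dc.
Qed.

(** The inverse matrix preserves area and turns the ellipse into a disk about [d], so [lens_le]
    applies to the transformed body. With equality the centered disk is optimal for that body as
    well, which forces [d = 0]; [centered_unique] for [K] then makes the matrix an isometry. *)
Lemma normal_optimum K (M : R) k l m n c : body K -> inscribed_ge1 K -> circumscribed_le1 K ->
  overlap_le K M -> ar (@unit_disk R `&` K) = M -> `|k * n - l * m| = 1 ->
  ar (ell k l m n c `&` K) <= M /\
  (ar (ell k l m n c `&` K) = M -> ell k l m n c = @unit_disk R).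
Proof.
move=> bK HJ HL HM M0 D1; have D0 : k * n - l * m != 0 by rewrite -normr_eq0 D1 oner_neq0.
pose D := k * n - l * m.
pose K' := lin (n / D) (- l / D) (- m / D) (k / D) @^-1` K.
have D1' : `|n / D * (k / D) - - l / D * (- m / D)| = 1.
  rewrite (_ : _ - _ = D^-1); first by rewrite normfV D1 invr1.
  by rewrite /D; field.
have D0' : n / D * (k / D) - - l / D * (- m / D) != 0 by rewrite -normr_eq0 D1' oner_neq0.
have bK' : body K' by exact: body_lin.
have mK := body_measurable bK.
have bX : bmeas (ell k l m n c `&` K) by apply: bmeasI => //; exact: bmeas_ell.
pose d := lin k l m n c.
have arE1 : ar (ell k l m n c `&` K) = ar (lens K' d).
  have [mX _] := bmeas_lin D0' bX.
  rewrite -(ar_lin1 D1' bX) -(ar_shift d mX); congr ar.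
  have E z : lin k l m n (lin (n / D) (- l / D) (- m / D) (k / D) (z + d) - c) = z.
    by rewrite linB (lin_invr (z + d) D0) addrK.
  by apply/seteqP; split => z; rewrite /ell /lens /K' /= /shift E.
have bG : bmeas (lin k l m n @^-1` @unit_disk R `&` K).
  by apply: bmeasI => //; exact: bmeas_lin (bmeas_disk _).
have arE2 : ar (lin k l m n @^-1` @unit_disk R `&` K) = ar (@unit_disk R `&` K').
  rewrite -(ar_lin1 D1' bG); congr ar.
  by apply/seteqP; split => z; rewrite /K' /= (lin_invr z D0).
have leM : ar (@unit_disk R `&` K') <= M by rewrite -arE2; exact: HM.
have le1 := lens_le d bK'.
rewrite arE1; split; first exact: le_trans le1 leM.
move=> eM; have M1 : ar (@unit_disk R `&` K') = M.
  by apply/eqP; rewrite eq_le leM -eM.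
have d0 : d = 0.
  exact: optimal_centered bK' (inscribed_lin D1' HJ) (circumscribed_lin D1' HL)
    (overlap_lin D1' bK HM) M1 eM.
have isom := centered_unique bK HJ HL HM M0 D1 (etrans arE2 M1).
by apply/seteqP; split => x; rewrite /ell /= linB -/d d0 subr0 isom unit_diskE.
Qed.

End ellipses.

(** * Normalizing the optimal centered ellipse *)

Section normalization.
Variable R : realType.
Implicit Types (E K J L : set (plane R)).

Lemma ellipse_bmeas E : ellipse E -> bmeas E.
Proof. by move=> /ellipseP[k [l [m [n [c [D0 ->]]]]]]; exact: bmeas_ell. Qed.

Lemma ellipse_ar_gt0 E : ellipse E -> 0 < ar E.
Proof.
move=> /ellipseP[k [l [m [n [c [D0 ->]]]]]]; rewrite ar_ell//.
by rewrite divr_gt0 ?normr_gt0//; exact: ar_disk_gt0.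
Qed.

Lemma ellipse_pull E (k l m n : R) : k * n - l * m != 0 -> ellipse E ->
  ellipse (lin k l m n @^-1` E).
Proof.
move=> D0 /ellipseP[k1 [l1 [m1 [n1 [c1 [D1 ->]]]]]].
have [k2 [l2 [m2 [n2 [c2 [-> D2]]]]]] := ell_pull k1 l1 m1 n1 c1 D0.
by apply/ellipseP; exists k2, l2, m2, n2, c2; rewrite D2 mulf_neq0.
Qed.

Lemma lin_ellipse (k l m n : R) : k * n - l * m != 0 -> ellipse (lin k l m n @^-1` @unit_disk R).
Proof. by move=> D0; apply/ellipseP; exists k, l, m, n, 0; rewrite ell0. Qed.

(** Scaling by [s] turns the area [lambda] into that of the disk, and the inverse of an optimal
    matrix then makes the disk itself an optimal centered ellipse. *)
Lemma normalize K J L (lambda : R) : body K -> john_ellipse K J -> loewner_ellipse K L ->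
  ar J <= lambda -> lambda <= ar L ->
  exists k l m n, let K' := lin k l m n @^-1` K in
    [/\ k * n - l * m != 0, ar (@unit_disk R) * `|k * n - l * m| = lambda,
        inscribed_ge1 K', circumscribed_le1 K' & overlap_le K' (ar (@unit_disk R `&` K'))].
Proof.
move=> bK [eJ JK Jmax] [eL KL Lmin] Jl lL.
have w0 : 0 < ar (@unit_disk R) by exact: ar_disk_gt0.
have l0 : 0 < lambda by apply: lt_le_trans Jl; exact: ellipse_ar_gt0.
pose s := Num.sqrt (lambda / ar (@unit_disk R)).
have s0 : 0 < s by rewrite sqrtr_gt0 divr_gt0.
have s2 : ar (@unit_disk R) * (s * s) = lambda.
  by rewrite -expr2 sqr_sqrtr ?divr_ge0 ?ltW// mulrC divfK// gt_eqF.
have Ds : s * s - 0 * 0 != 0 by rewrite mul0r subr0 mulf_neq0// gt_eqF.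
have bKs := body_lin Ds bK.
have [k [l [m [n [D1 opt]]]]] := exists_optimal bKs.
have D0 : k * n - l * m != 0 by rewrite -normr_eq0 D1 oner_neq0.
pose D := k * n - l * m.
pose H := lin (s * (n / D)) (s * (- l / D)) (s * (- m / D)) (s * (k / D)).
have HE x : H x = lin s 0 0 s (lin (n / D) (- l / D) (- m / D) (k / D) x).
  by rewrite lin_comp /H; congr (lin _ _ _ _ x); ring.
have detH : `|s * (n / D) * (s * (k / D)) - s * (- l / D) * (s * (- m / D))| = s * s.
  rewrite (_ : _ - _ = s * s / D); last by rewrite /D; field.
  by rewrite normrM normfV D1 invr1 mulr1 gtr0_norm// mulr_gt0.
have detH0 : s * (n / D) * (s * (k / D)) - s * (- l / D) * (s * (- m / D)) != 0.
  by rewrite -normr_eq0 detH mulf_neq0// gt_eqF.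
exists (s * (n / D)), (s * (- l / D)), (s * (- m / D)), (s * (k / D)) => /=; rewrite -/H.
have K'E : H @^-1` K = lin (n / D) (- l / D) (- m / D) (k / D) @^-1` (lin s 0 0 s @^-1` K).
  by apply/seteqP; split => x; rewrite /= HE.
have DI : `|n / D * (k / D) - - l / D * (- m / D)| = 1.
  rewrite (_ : _ - _ = D^-1); first by rewrite normfV D1 invr1.
  by rewrite /D; field.
(* Every centered ellipse in the new coordinates comes from one in the original plane whose area is
   [lambda] over the determinant; maximality of [J] and minimality of [L] are applied to the
   latter. *)
have back (p q u v : R) : p * v - q * u != 0 ->
    exists p' q' u' v', [/\ p' * v' - q' * u' != 0,
      ar (lin p' q' u' v' @^-1` @unit_disk R) * `|p * v - q * u| = lambda &
      H @^-1` (lin p' q' u' v' @^-1` @unit_disk R) = lin p q u v @^-1` @unit_disk R].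
  move=> E0; have [p' [q' [u' [v' [E1 E2]]]]] := lin_factor p q u v detH0.
  have E3 : p' * v' - q' * u' != 0 by rewrite E2 mulf_neq0// invr_eq0.
  exists p', q', u', v'; split=> //.
    rewrite (ar_lin E3 (bmeas_disk 1)) E2 normrM normfV detH -s2.
    have N0 : `|p * v - q * u| != 0 by rewrite normr_eq0.
    by field; rewrite N0 gt_eqF.
  by apply/seteqP; split => x; rewrite /= E1.
split; [exact: detH0|by rewrite detH|..].
- move=> p q u v E0 sub; have [p' [q' [u' [v' [E1 E2 E3]]]]] := back p q u v E0.
  have subK : lin p' q' u' v' @^-1` @unit_disk R `<=` K.
    move=> y; have [x <-] := lin_surj y detH0; rewrite -/(H x) => Hx.
    by apply: (sub x); rewrite -E3.
  have eE := lin_ellipse E1.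
  have := Jmax _ eE subK; rewrite (arE (ellipse_bmeas eE)) (arE (ellipse_bmeas eJ)) lee_fin.
  move=> /le_trans /(_ Jl); rewrite -E2 => h.
  by rewrite (ler_pMr _ (ellipse_ar_gt0 eE)) in h.
- move=> p q u v E0 sub; have [p' [q' [u' [v' [E1 E2 E3]]]]] := back p q u v E0.
  have subK : K `<=` lin p' q' u' v' @^-1` @unit_disk R.
    move=> y; have [x <-] := lin_surj y detH0; rewrite -/(H x) => Kx.
    by have := sub x Kx; rewrite -E3.
  have eE := lin_ellipse E1.
  have := Lmin _ eE subK; rewrite (arE (ellipse_bmeas eE)) (arE (ellipse_bmeas eL)) lee_fin.
  move=> /(le_trans lL); rewrite -E2 => h.
  by rewrite (ger_pMr _ (ellipse_ar_gt0 eE)) in h.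
have bG : bmeas (lin k l m n @^-1` @unit_disk R `&` lin s 0 0 s @^-1` K).
  apply: bmeasI; last exact: body_measurable.
  exact: bmeas_lin (bmeas_disk _).
have arE2 : ar (@unit_disk R `&` H @^-1` K) =
    ar (lin k l m n @^-1` @unit_disk R `&` lin s 0 0 s @^-1` K).
  rewrite -(ar_lin1 DI bG) K'E; congr ar.
  by apply/seteqP; split => z; rewrite /= (lin_invr z D0).
by rewrite arE2 K'E; exact: overlap_lin.
Qed.

End normalization.

Theorem theorem1p2 (R : realType) (K J L : set (plane R)) (lambda : R)
  (K_body : convex_body K) (K_sym : centrally_symmetric K)
  (J_john : john_ellipse K J) (L_loewner : loewner_ellipse K L)
  (lambda_range : (area J <= lambda%:E <= area L)%E) :
  exists M : set (plane R),
    unique (fun E => MI_ellipse K E /\ area E = lambda%:E) M /\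
    centrally_symmetric M.
Proof.
have [eJ _ _] := J_john; have [eL _ _] := L_loewner.
have bK := convex_body_body K_body K_sym.
have /andP[Jl lL] : ar J <= lambda <= ar L.
  by move: lambda_range; rewrite (arE (ellipse_bmeas eJ)) (arE (ellipse_bmeas eL)) !lee_fin.
have [k [l [m [n [D0 wl HJ HL HM]]]]] := normalize bK J_john L_loewner Jl lL.
have bK' : body (lin k l m n @^-1` K) by exact: body_lin.
have mK := body_measurable bK.
(* Factoring the identity through the normalizing matrix gives its inverse. *)
have [p [q [u [v [E1 E2]]]]] := lin_factor 1 0 0 1 D0.
have {}E1 x : lin p q u v (lin k l m n x) = x.
  by rewrite -E1 [RHS]surjective_pairing /lin !mul1r !mul0r addr0 add0r.
have E0 : p * v - q * u != 0 by rewrite E2 mulf_neq0 ?invr_eq0// mul0r subr0 mulr1 oner_neq0.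
pose M := lin p q u v @^-1` @unit_disk R.
have HMD : lin k l m n @^-1` M = @unit_disk R.
  by apply/seteqP; split => x; rewrite /M /= E1.
have eM : ellipse M by exact: lin_ellipse.
have pull E : bmeas E -> ar (lin k l m n @^-1` E) * `|k * n - l * m| = ar E.
  by move=> bE; rewrite ar_lin// divfK// normr_eq0.
have arM : ar M = lambda by rewrite -(pull _ (ellipse_bmeas eM)) HMD.
(* In normalized coordinates an ellipse of area [lambda] has a determinant of absolute value 1, so
   [normal_optimum] gives both the bound and the case of equality. *)
have main E : ellipse E -> ar E = lambda ->
    ar (E `&` K) <= ar (M `&` K) /\ (ar (E `&` K) = ar (M `&` K) -> E = M).
  move=> eE aE; have bE := ellipse_bmeas eE; have bM := ellipse_bmeas eM.
  have /ellipseP[k1 [l1 [m1 [n1 [c1 [D1 EE]]]]]] := ellipse_pull D0 eE.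
  have w0 : 0 < ar (@unit_disk R) by exact: ar_disk_gt0.
  have N0 : 0 < `|k * n - l * m| by rewrite normr_gt0.
  have det1 : `|k1 * n1 - l1 * m1| = 1.
    have := pull E bE; rewrite aE -wl EE ar_ell// => /(mulIf (lt0r_neq0 N0)).
    move=> /(congr1 (fun t => t / ar (@unit_disk R))); rewrite mulrAC !divff ?gt_eqF// mul1r.
    by move=> /(congr1 GRing.inv); rewrite invrK invr1.
  have [le_opt eq_opt] := normal_optimum c1 bK' HJ HL HM erefl det1.
  rewrite -(pull _ (bmeasI bE mK)) -(pull _ (bmeasI bM mK)) !preimage_setI HMD EE.
  split; first by rewrite ler_pM2r.
  move=> /(mulIf (lt0r_neq0 N0)) /eq_opt; rewrite -EE -HMD => EM.
  apply/seteqP; split => y; have [x <-] := lin_surj y D0 => h.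
    by have : (lin k l m n @^-1` E) x by []; rewrite EM.
  by have : (lin k l m n @^-1` M) x by []; rewrite -EM.
have areaP E : ellipse E -> (area E = lambda%:E) <-> (ar E = lambda).
  by move=> eE; rewrite (arE (ellipse_bmeas eE)); split => [[]|->].
exists M; split; last first.
  apply/seteqP; split => [x Mx|_ [x Mx <-]].
    by exists (- x); rewrite ?opprK// /M /= linearN unit_diskE /= norm2N.
  by rewrite /M /= linearN unit_diskE /= norm2N.
have arI E : ellipse E -> area (E `&` K) = (ar (E `&` K))%:E.
  by move=> eE; apply: arE; apply: bmeasI => //; exact: ellipse_bmeas.
split; first split; first split=> // E eE.
- rewrite ((areaP M eM).2 arM) => /(areaP E eE) aE.
  by rewrite !arI// lee_fin; have [] := main E eE aE.
- exact/areaP.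
move=> E [[eE Emax] /(areaP E eE) aE].
have [le1 eq1] := main E eE aE; apply/esym/eq1/eqP; rewrite eq_le le1 /=.
have := Emax M eM; rewrite (arI M eM) (arI E eE) lee_fin; apply.
by rewrite ((areaP M eM).2 arM) ((areaP E eE).2 aE).
Qed.
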